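(* Let $\Pi^*$ be a prior on $\mathcal F^*$ and let $\Pi$ be the prior on $\mathcal F$ induced by $\Pi^*$ through the rounding map $g:\mathcal F^*\to\mathcal F$ (all defined in the context). Let $f_0\in\mathcal F$ be in the Kullback--Leibler support of $\Pi$, and let $\mathbf y_1,\mathbf y_2,\dots$ be i.i.d. from $f_0$. For $\epsilon>0$ let $U=U_\epsilon=\{f\in\mathcal F:\|f-f_0\|<\epsilon\}$. Suppose that for each $\epsilon>0$ there are $\delta$ with $0<\delta<\epsilon$, constants $c_1,c_2>0$, $\beta<\epsilon^2/8$, and sets $\mathcal F_n^*\subset\mathcal F^*$ such that for all $n$ large (i) $\Pi^*\big((\mathcal F_n^{*})^{C}\big)\le c_1e^{-nc_2}$; (ii) $J(\delta,\mathcal F_n^* )<n\beta$. Then (for each $\epsilon>0$) $\Pi(U\mid \mathbf y_1,\dots,\mathbf y_n)\to1$ as $n\to\infty$, almost surely with respect to $P_{f_0}$.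
   Context: Setting. Let $p=p_1+p_2$. The observations are $y=(y_1,y_2)\in\Omega=\mathcal Y\times Q$, where $\mathcal Y=\mathcal Y_1\times\cdots\times\mathcal Y_{p_1}\subseteq\mathbb R^{p_1}$ and $Q=\prod_{j=1}^{p_2}\{0,1,\dots,q_j-1\}$, with $q_j\in\{2,3,\dots\}\cup\{\infty\}$ ($q_j=\infty$ means the $j$-th factor is all non-negative integers). Let $\mu=\mu_1\times\mu_2$, with $\mu_1$ Lebesgue measure on $\mathcal Y$ and $\mu_2$ counting measure on $Q$. $\mathcal F$ is the set of probability densities on $\Omega$ with respect to $\mu$; $\mathcal F^*$ is the set of probability densities on $\mathbb R^p$ with respect to Lebesgue measure. Rounding map. For $j=1,\dots,p_1$, $h_{1,j}:\mathbb R\to\mathcal Y_j$ is a fixed monotone differentiable bijection with differentiable inverse, and $h_1=(h_{1,1},\dots,h_{1,p_1})$. For $j=1,\dots,p_2$, $\{A^{(j)}_k:0\le k<q_j\}$ is a fixed partition of $\mathbb R$ into mutually exclusive subsets, ordered so that $A^{(j)}_k$ is placed before $A^{(j)}_l$ whenever $k<l$. For $y_2\in Q$ put $A_{y_2}=\{y_2^*\in\mathbb R^{p_2}: y^*_{2,j}\in A^{(j)}_{y_{2,j}},\ j=1,\dots,p_2\}$. The map $g:\mathcal F^*\to\mathcal F$ is $$g(f^* )(y_1,y_2)=\int_{A_{y_2}}f^*\big(h_1^{-1}(y_1),y_2^*\big)\,|J_{h_1^{-1}(y_1)}|\,dy_2^*,$$ where $|J_{h_1^{-1}(y_1)}|$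 is the absolute Jacobian determinant of $h_1^{-1}$ at $y_1$. Priors. A prior is a probability measure on the space of densities (with the Borel $\sigma$-algebra of the $L_1$ metric). The prior $\Pi$ induced by $\Pi^*$ is the law of $f=g(f^* )$ when $f^*\sim\Pi^*$. $\Pi(\cdot\mid\mathbf y_1,\dots,\mathbf y_n)$ is the posterior under the model $\mathbf y_1,\dots,\mathbf y_n\mid f$ i.i.d. from $f$, $f\sim\Pi$; $P_{f_0}$ is the law of the i.i.d. sequence from $f_0$. Notation. $\|f-f'\|$ is the $L_1$ distance, $\int_\Omega|f-f'|\,d\mu$ on $\mathcal F$ and $\int_{\mathbb R^p}|f-f'|$ on $\mathcal F^*$. The Kullback--Leibler divergence is $d_{KL}(f_0,f)=\int_\Omega f_0\log(f_0/f)\,d\mu$; $f_0$ is in the KL support of $\Pi$ if $\Pi(\{f:d_{KL}(f_0,f)<\eta\})>0$ for every $\eta>0$. $J(\delta,\mathcal G)$ is the $L_1$ metric entropy: the logarithm of the minimum number of $L_1$ balls of radius $\delta$ needed to cover $\mathcal G$. $(\cdot)^C$ denotes complement (in $\mathcal F^*$ for subsets of $\mathcal F^*$). *)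

(* Defs.v *)
From HB Require Import structures.
From mathcomp Require Import all_boot all_order all_algebra finmap.
From mathcomp Require Import all_classical all_reals all_analysis.
From mathcomp Require Import measurable_realfun.
Set Implicit Arguments.
Unset Strict Implicit.
Unset Printing Implicit Defensive.
Import Order.TTheory GRing.Theory Num.Theory.
Import numFieldNormedType.Exports.
Local Open Scope classical_set_scope.
Local Open Scope ring_scope.

Section tuple_measure.
Context d (T : measurableType d) (R : realType).
Variable m : {sigma_finite_measure set T -> \bar R}.

Definition tcons n (x : T * n.-tuple T) : n.+1.-tuple T := [tuple of x.1 :: x.2].

Lemma measurable_tcons n : measurable_fun [set: T * n.-tuple T] (@tcons n).
Proof. exact: measurable_cons. Qed.

Definition tcons_measure n (mn : {sigma_finite_measure set n.-tuple T -> \bar R})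
  : set (n.+1.-tuple T) -> \bar R := pushforward (m \x mn)%E (@tcons n).

Section tcons_measure.
Variables (n : nat) (mn : {sigma_finite_measure set n.-tuple T -> \bar R}).

HB.instance Definition _ := Measure.copy (tcons_measure mn)
  (measure_function_pushforward__canonical__measure_function_Measure
    (m \x mn)%E (@measurable_tcons n)).

Let tcons_measure_sigma_finite : sigma_finite setT (tcons_measure mn).
Proof.
have /sigma_finiteP[F [TF ndF Foo]] := sigma_finiteT m.
have /sigma_finiteP[G [TG ndG Goo]] := sigma_finiteT mn.
pose u (t : n.+1.-tuple T) : T * n.-tuple T := (thead t, [tuple of behead t]).
have tK t : tcons (u t) = t by rewrite [RHS]tuple_eta.
have uK x : u (tcons x) = x.
  by case: x => x t; rewrite /u /tcons theadE; congr (_, _); apply/val_inj.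
have mu_ : measurable_fun setT u.
  apply/measurable_fun_pairP; split; last exact: measurable_behead.
  exact: (measurable_tnth ord0).
exists (fun k => u @^-1` (F k `*` G k)).
  apply/seteqP; split => // t _.
  have [i _ Fi] : (\bigcup_k F k) (u t).1 by rewrite -TF.
  have [j _ Gj] : (\bigcup_k G k) (u t).2 by rewrite -TG.
  exists (maxn i j) => //; split.
    by move: Fi; exact/subsetPset/ndF/leq_maxl.
  by move: Gj; exact/subsetPset/ndG/leq_maxr.
move=> k; have [mF Fkoo] := Foo k; have [mG Gkoo] := Goo k; split.
  by rewrite -[X in measurable X]setTI; apply: mu_ => //; exact: measurableX.
rewrite /tcons_measure /pushforward (_ : _ @^-1` _ = F k `*` G k).
  by rewrite product_measure1E// lte_mul_pinfty// ge0_fin_numE.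
by apply/funext => x; rewrite -[in RHS](uK x).
Qed.

HB.instance Definition _ := @Measure_isSigmaFinite.Build _ _ _
  (tcons_measure mn) tcons_measure_sigma_finite.

End tcons_measure.

(* the n-fold product measure m x ... x m *)
Fixpoint tuple_measure n : {sigma_finite_measure set n.-tuple T -> \bar R} :=
  match n with
  | 0 => [the {sigma_finite_measure set 0.-tuple T -> \bar R} of
           \d_([tuple] : 0.-tuple T)]
  | n'.+1 => [the {sigma_finite_measure set n'.+1.-tuple T -> \bar R} of
               tcons_measure (tuple_measure n')]
  end.

Lemma tuple_measure_box n (B : 'I_n -> set T) : (forall i, measurable (B i)) ->
  tuple_measure n [set t | forall i, B i (tnth t i)] = (\prod_(i < n) m (B i))%E.
Proof.
elim: n B => [|n IH] B mB.
  rewrite big_ord0 /= diracE mem_set//= => -[]//.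
rewrite big_ord_recl -IH// -product_measure1E//; last first.
  rewrite (_ : [set _ | _] = \bigcap_(i in [set: 'I_n])
      ((@tnth _ T ^~ i) @^-1` B (lift ord0 i))).
    apply: fin_bigcap_measurable => // i _.
    by rewrite -[X in measurable X]setTI; exact: measurable_tnth.
  by apply/seteqP; split => t /= h i; [move=> _; exact: h|exact: h].
rewrite /= /tcons_measure /pushforward; congr (_ _).
apply/seteqP; split => -[x t] /=.
  move=> h; split; first exact: (h ord0).
  by move=> i; have := h (lift ord0 i); rewrite tnthS.
move=> [h0 h] i; case: (unliftP ord0 i) => [j|] ->; last by [].
by rewrite tnthS.
Qed.

End tuple_measure.

(* Densities are functions rather than classes of functions: the L1 distance is
   a pseudometric on them.  Its open sets are saturated for mu-a.e. equality, so
   its Borel sets are those of the metric space of classes. *)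
Record density d (T : measurableType d) (R : realType)
    (mu : {measure set T -> \bar R}) := Density {
  dens :> T -> R ;
  measurable_dens : measurable_fun [set: T] dens ;
  dens_ge0 : forall x, 0 <= dens x ;
  integral_dens : (\int[mu]_x (dens x)%:E = 1)%E }.

HB.instance Definition _ d (T : measurableType d) (R : realType)
  (mu : {measure set T -> \bar R}) := gen_eqMixin (density mu).
HB.instance Definition _ d (T : measurableType d) (R : realType)
  (mu : {measure set T -> \bar R}) := gen_choiceMixin (density mu).

Section L1_distance.
Context d (T : measurableType d) (R : realType) (mu : {measure set T -> \bar R}).
Implicit Types f g h : density mu.

Definition L1dist f g : R := \int[mu]_x `|f x - g x|.

Lemma integrable_dens f : mu.-integrable [set: T] (EFin \o f).
Proof.
apply/integrableP; split; first exact/measurable_EFinP/measurable_dens.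
under eq_integral do rewrite /= ger0_norm ?dens_ge0//.
by rewrite integral_dens ltry.
Qed.

Lemma integrable_dist f g :
  mu.-integrable [set: T] (EFin \o (fun x => `|f x - g x|)).
Proof.
have -> : EFin \o (fun x => `|f x - g x|) =
    abse \o ((EFin \o f) \- (EFin \o g))%E by [].
by apply: integrable_abse; apply: integrableB => //; exact: integrable_dens.
Qed.

Let L1ball f (e : R) : set (density mu) := [set g | L1dist f g < e].

Let ball_center f (e : R) : 0 < e -> L1ball f e f.
Proof.
move=> e0; rewrite /L1ball/= /L1dist.
under eq_Rintegral do rewrite subrr normr0.
by rewrite /Rintegral integral0.
Qed.

Let ball_sym f g (e : R) : L1ball f e g -> L1ball g e f.
Proof.
by rewrite /L1ball/= /L1dist; under eq_Rintegral do rewrite distrC.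
Qed.

Let ball_triangle f g h (e1 e2 : R) :
  L1ball f e1 g -> L1ball g e2 h -> L1ball f (e1 + e2) h.
Proof.
rewrite /L1ball/= => fg gh; apply: le_lt_trans (ltrD fg gh).
rewrite /L1dist -RintegralD//; [|exact: integrable_dist..].
apply: le_Rintegral => //; first exact: integrable_dist.
  have := integrableD measurableT (integrable_dist f g) (integrable_dist g h).
  by apply: eq_integrable.
by move=> x _; rewrite ler_distD.
Qed.

HB.instance Definition _ := hasNbhs.Build (density mu)
  (nbhs_ (entourage_ L1ball)).
HB.instance Definition _ := @Nbhs_isPseudoMetric.Build R (density mu)
  (entourage_ L1ball) erefl L1ball ball_center ball_sym ball_triangle erefl.

Lemma ball_L1E f (e : R) : ball f e = [set g | L1dist f g < e].
Proof. by []. Qed.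

End L1_distance.

(* A measurableType is pointed; f only provides the point. *)
Definition dspace d (T : measurableType d) (R : realType)
  (mu : {measure set T -> \bar R}) (f : density mu) := density mu.

Section density_space.
Context d (T : measurableType d) (R : realType) (mu : {measure set T -> \bar R}).
Variable f : density mu.
HB.instance Definition _ := PseudoMetric.on (dspace f).
HB.instance Definition _ := isPointed.Build (dspace f) f.
End density_space.

Definition borel_density d (T : measurableType d) (R : realType)
  (mu : {measure set T -> \bar R}) (f : density mu) :=
  g_sigma_algebraType (@open (dspace f)).

Section law.
Context d (T : measurableType d) (R : realType) (mu : {measure set T -> \bar R}).
Variable f : density mu.

(* the probability P_f with density f *)
Definition law (A : set T) : \bar R := (\int[mu]_(x in A) (f x)%:E)%E.

Let law0 : law set0 = 0%E.
Proof. exact: integral_set0. Qed.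

Let law_ge0 A : (0 <= law A)%E.
Proof. by apply: integral_ge0 => x _; rewrite lee_fin dens_ge0. Qed.

Let law_sigma_additive : semi_sigma_additive law.
Proof.
move=> F mF tF mU; rewrite /law ge0_integral_bigcup//.
- by apply: is_cvg_ereal_nneg_natsum_cond => n _ _; exact: law_ge0.
- apply: measurable_funTS; exact/measurable_EFinP/measurable_dens.
- by move=> x _; rewrite lee_fin dens_ge0.
Qed.

HB.instance Definition _ :=
  isMeasure.Build _ _ _ law law0 law_ge0 law_sigma_additive.

Let law_setT : law [set: T] = 1%E.
Proof. exact: integral_dens. Qed.

HB.instance Definition _ := Measure_isProbability.Build _ _ _ law law_setT.
End law.

Definition iid_law d (T : measurableType d) (R : realType)
  (mu : {measure set T -> \bar R}) (f : density mu) n := tuple_measure (law f) n.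

Section uniform_density.
Context d (T : measurableType d) (R : realType) (mu : {measure set T -> \bar R}).
Variables (S : set T) (mS : measurable S).
Hypotheses (S_gt0 : (0 < mu S)%E) (S_fin : (mu S < +oo)%E).

Let u (x : T) : R := (fine (mu S))^-1 * \1_S x.

Let mfun_u : measurable_fun [set: T] u.
Proof. by apply: measurable_funM => //; exact: measurable_indic. Qed.

Let u_ge0 x : 0 <= u x.
Proof. by rewrite mulr_ge0// invr_ge0 fine_ge0. Qed.

Let int_u : (\int[mu]_x (u x)%:E = 1)%E.
Proof.
have S0 : 0 < fine (mu S) by rewrite fine_gt0// S_gt0.
under eq_integral do rewrite EFinM.
rewrite ge0_integralZl_EFin//; last first.
  by apply: measurableT_comp => //; exact: measurable_indic.
rewrite integral_indic// setIT -[X in (_ * X)%E]fineK ?ge0_fin_numE//.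
by rewrite -EFinM mulVf// gt_eqF.
Qed.

Definition uniform_density : density mu := Density mfun_u u_ge0 int_u.

End uniform_density.

Definition lebesgue_vec (R : realType) n :
    {sigma_finite_measure set (n.-tuple (measurableTypeR R)) -> \bar R} :=
  tuple_measure (@lebesgue_measure R) n.

Lemma lebesgue_vec_box (R : realType) n (a b : 'I_n -> R) :
  (forall i, a i < b i) ->
  let S := [set t : n.-tuple (measurableTypeR R) |
    forall i, `[a i, b i]%classic (tnth t i)] in
  [/\ measurable S, (0 < lebesgue_vec R n S)%E & (lebesgue_vec R n S < +oo)%E].
Proof.
move=> ab S.
have mS : measurable S.
  rewrite (_ : S = \bigcap_(i in [set: 'I_n])
      ((@tnth _ (measurableTypeR R) ^~ i) @^-1` `[a i, b i])).
    apply: fin_bigcap_measurable => // i _.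
    by rewrite -[X in measurable X]setTI; apply: measurable_tnth => //.
  by apply/seteqP; split => t /= h i; [move=> _; exact: h|exact: h].
have -> : lebesgue_vec R n S = (\prod_(i < n) (b i - a i))%:E.
  apply: (etrans (@tuple_measure_box _ (measurableTypeR R) R
    (@lebesgue_measure R) n (fun i => `[a i, b i]%classic) _)) => //.
  rewrite -prodEFin; apply: eq_bigr => i _.
  by rewrite /= lebesgue_measure_itv/= lte_fin ab EFinB.
by split => //; rewrite ?ltry// lte_fin prodr_gt0// => i _; rewrite subr_gt0.
Qed.

(* R^p, p = p1 + p2, is R^p1 x R^p2.  Observations live in R^p1 x N^p2, and the
   reference measure mixed_measure below is carried by Omega. *)
Notation latT R p1 p2 :=
  (p1.-tuple (measurableTypeR R) * p2.-tuple (measurableTypeR R))%type.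
Notation obsT R p1 p2 := (p1.-tuple (measurableTypeR R) * p2.-tuple nat)%type.

Definition latent_measure (R : realType) p1 p2 :
    {measure set (latT R p1 p2) -> \bar R} :=
  (lebesgue_vec R p1 \x lebesgue_vec R p2)%E.

Definition unit_box (R : realType) n : set (n.-tuple (measurableTypeR R)) :=
  [set t | forall i, `[0, 1]%classic (tnth t i)].

Fact unit_cube_latent (R : realType) p1 p2 :
  let S := @unit_box R p1 `*` @unit_box R p2 in
  [/\ measurable S, (0 < latent_measure R p1 p2 S)%E
    & (latent_measure R p1 p2 S < +oo)%E].
Proof.
have [m1 g1 l1] := @lebesgue_vec_box R p1 (fun=> 0) (fun=> 1) (fun=> ltr01).
have [m2 g2 l2] := @lebesgue_vec_box R p2 (fun=> 0) (fun=> 1) (fun=> ltr01).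
split; first exact: measurableX.
  by rewrite /latent_measure/= product_measure1E// mule_gt0.
by rewrite /latent_measure/= product_measure1E// lte_mul_pinfty// ge0_fin_numE.
Qed.

Definition latent_base (R : realType) p1 p2 : density (latent_measure R p1 p2) :=
  let: And3 mS S0 Soo := unit_cube_latent R p1 p2 in uniform_density mS S0 Soo.

(* {k | k < q}, where None stands for q = oo *)
Definition level_set (q : option nat) : set nat :=
  [set k | if q is Some m then (k < m)%N else true].

(* Yfac j is an open interval, so that differentiability of h1inv j on Yfac j is
   the usual one; h1inv j is arbitrary outside of Yfac j. *)
Record rounding_map (R : realType) (p1 p2 : nat) := RoundingMap {
  Yfac : 'I_p1 -> set R ;
  h1 : 'I_p1 -> R -> R ;
  h1inv : 'I_p1 -> R -> R ;
  qlev : 'I_p2 -> option nat ;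
  Acell : 'I_p2 -> nat -> set R ;
  h1_monotone : forall j,
    {homo h1 j : x y / x <= y} \/ {homo h1 j : x y /~ x <= y} ;
  h1_bij : forall j, set_bij [set: R] (Yfac j) (h1 j) ;
  h1_derivable : forall j x, derivable (h1 j) x 1 ;
  h1K : forall j, cancel (h1 j) (h1inv j) ;
  h1inv_derivable : forall j y, Yfac j y -> derivable (h1inv j) y 1 ;
  qlev_ge2 : forall j m, qlev j = Some m -> (2 <= m)%N ;
  Acell_partition : forall j, partition (level_set (qlev j)) (Acell j) [set: R] ;
  Acell_ordered : forall j k l,
    level_set (qlev j) k -> level_set (qlev j) l -> (k < l)%N -> forall x y,
    Acell j k x -> Acell j l y -> x < y }.

Section mixed_space.
Context (R : realType) (p1 p2 : nat) (r : rounding_map R p1 p2).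

Definition Yset : set (p1.-tuple (measurableTypeR R)) :=
  [set y | forall j, Yfac r j (tnth y j)].
Definition Qset : set (p2.-tuple nat) :=
  [set y | forall j, level_set (qlev r j) (tnth y j)].
Definition Omega : set (obsT R p1 p2) := Yset `*` Qset.

Lemma Yfac_interval j : is_interval (Yfac r j).
Proof.
have [_ _ sY] := h1_bij r j.
have sub : range (h1 r j) `<=` Yfac r j.
  by have [+ _ _] := h1_bij r j; move=> h _ [x _ <-]; exact: h.
have ch : continuous (h1 r j).
  by move=> x; apply/differentiable_continuous/derivable1_diffP/h1_derivable.
move=> a b /sY[x _ <-] /sY[y _ <-] c hc.
have main u v : u <= v -> Num.min (h1 r j u) (h1 r j v) <= c <=
    Num.max (h1 r j u) (h1 r j v) -> Yfac r j c.
  move=> uv /(IVT uv)[|w _ <-]; last by apply: sub; exists w.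
  exact: continuous_subspaceT.
have [xy|yx] := leP x y.
  by apply: (main x y) => //; case/andP: hc => ? ?;
    rewrite ge_min le_max; apply/andP; split; apply/orP; [left|right].
by apply: (main y x) => //; [exact: ltW|]; case/andP: hc => ? ?;
    rewrite ge_min le_max; apply/andP; split; apply/orP; [right|left].
Qed.

Lemma measurable_Yset : measurable Yset.
Proof.
rewrite (_ : Yset = \bigcap_(i in [set: 'I_p1])
    ((@tnth _ (measurableTypeR R) ^~ i) @^-1` Yfac r i)).
  apply: fin_bigcap_measurable => // i _.
  rewrite -[X in measurable X]setTI; apply: measurable_tnth => //.
  by apply: is_interval_measurable; exact: Yfac_interval.
by apply/seteqP; split => t /= h i; [move=> _; exact: h|exact: h].
Qed.

Lemma measurable_nat_tuple n (A : set (n.-tuple nat)) : measurable A.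
Proof.
rewrite (_ : A = \bigcup_t (if t \in A then [set t] else set0)); last first.
  apply/seteqP; split => [t At|t [s _]]; first by exists t => //; rewrite mem_set.
  by case: ifPn => // /set_mem ? ->.
apply: countable_bigcupT_measurable => // t; case: ifPn => // _.
rewrite (_ : [set t] = \bigcap_(i in [set: 'I_n])
    ((@tnth _ nat ^~ i) @^-1` [set tnth t i])).
  apply: fin_bigcap_measurable => // i _.
  by rewrite -[X in measurable X]setTI; exact: measurable_tnth.
apply/seteqP; split => s /=; first by move=> ->.
by move=> h; apply: eq_from_tnth => i; exact: h.
Qed.

Definition mu_leb := mrestr (lebesgue_vec R p1) measurable_Yset.
HB.instance Definition _ := Measure.on mu_leb.

Definition mu_count := mrestr (@counting _ R) (measurable_nat_tuple Qset).
HB.instance Definition _ := Measure.on mu_count.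

Let mu_count_sigma_finite : sigma_finite [set: p2.-tuple nat] mu_count.
Proof.
exists (fun k : nat => [set t : p2.-tuple nat | choice.pickle t = k]).
  by apply/seteqP; split => // t _; exists (choice.pickle t).
move=> k; split; first exact: measurable_nat_tuple.
rewrite /mu_count /mrestr /counting asboolT ?ltry//.
apply: (@sub_finite_set _ _
    (if @choice.unpickle (p2.-tuple nat) k is Some t then [set t] else set0)).
  by move=> t [/= <- _]; rewrite choice.pickleK.
by case: choice.unpickle.
Qed.

HB.instance Definition _ := @Measure_isSigmaFinite.Build _ _ _ mu_count
  mu_count_sigma_finite.

Definition mixed_measure : {measure set (obsT R p1 p2) -> \bar R} :=
  (mu_leb \x mu_count)%E.

Fact mixed_box : exists S : set (obsT R p1 p2),
  [/\ measurable S, (0 < mixed_measure S)%E & (mixed_measure S < +oo)%E].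
Proof.
pose a j := Num.min (h1 r j 0) (h1 r j 1).
pose b j := Num.max (h1 r j 0) (h1 r j 1).
have ab j : a j < b j.
  have [_ hi _] := h1_bij r j; rewrite /a /b.
  case: (ltgtP (h1 r j 0) (h1 r j 1)) => // /hi.
  by rewrite !in_setT => /(_ isT isT)/eqP; rewrite eq_sym oner_eq0.
have abY j : `[a j, b j]%classic `<=` Yfac r j.
  have Yh x : Yfac r j (h1 r j x) by have [hf _ _] := h1_bij r j; exact: (hf x).
  have Ya : Yfac r j (a j) by rewrite /a; case: ltP.
  have Yb : Yfac r j (b j) by rewrite /b; case: ltP.
  by move=> x /=; rewrite in_itv /=; exact: (Yfac_interval Ya Yb).
have [mS S0 Soo] := lebesgue_vec_box ab.
set S := [set t | _] in mS S0 Soo.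
pose o : p2.-tuple nat := [tuple 0%N | _ < p2].
have So : mixed_measure (S `*` [set o]) = lebesgue_vec R p1 S.
  rewrite /mixed_measure /= product_measure1E//; last exact: measurable_nat_tuple.
  rewrite -[RHS]mule1; congr (_ * _)%E.
    rewrite -[LHS]/(lebesgue_vec R p1 (S `&` Yset)) setIidl// => t St j.
    by apply: abY; exact: St.
  rewrite -[LHS]/(counting ([set o] `&` Qset)) setIidl; last first.
    move=> _ -> j; rewrite tnth_mktuple /level_set /=.
    case E : (qlev r j) => [m|//].
    by exact: (leq_trans _ (@qlev_ge2 _ _ _ r j m E)).
  by rewrite /counting asboolT// fset_set1 cardfs1.
exists (S `*` [set o]); rewrite So; split => //.
by apply: measurableX => //; exact: measurable_nat_tuple.
Qed.

Definition mixed_base : density mixed_measure :=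
  let: And3 mS S0 Soo := projT2 (cid mixed_box) in uniform_density mS S0 Soo.

Definition h1inv_mx (u : 'rV[R]_p1) : 'rV[R]_p1 := \row_j h1inv r j (u ord0 j).

Definition absJ (y1 : p1.-tuple R) : R :=
  `|\det ('J h1inv_mx (\row_j tnth y1 j))|.

Definition cell_of (y2 : p2.-tuple nat) : set (p2.-tuple R) :=
  [set u | forall j, Acell r j (tnth y2 j) (tnth u j)].

(* The map g, extended by 0 outside of Omega.  The integral is real-valued, with
   value 0 where it diverges: for a density fs, this is a null set. *)
Definition round_density (fs : p1.-tuple R * p2.-tuple R -> R) :
    p1.-tuple R * p2.-tuple nat -> R :=
  (fun y => \int[lebesgue_vec R p2]_(u in cell_of y.2)
    (fs ([tuple h1inv r j (tnth y.1 j) | j < p1], u) * absJ y.1)) \_ Omega.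

End mixed_space.

Section bayes.
Context d (T : measurableType d) (R : realType) (m : {measure set T -> \bar R}).
Variable (base : density m).

(* lne 0 = -oo, x / 0 = +oo for x > 0, lne +oo = +oo and 0 * _ = 0 in \bar R, so
   the integrand is 0 where f0 = 0, and +oo where f = 0 < f0. *)
Definition KL (f0 f : density m) : \bar R :=
  (\int[m]_x ((f0 x)%:E * lne ((f0 x)%:E / (f x)%:E)))%E.

Definition KL_support (P : probability (borel_density base) R) : set (density m) :=
  [set f0 | forall eta : R, 0 < eta -> (0 < P [set f | KL f0 f < eta%:E])%E].

(* K is a version of the conditional law of f given (y_1, .., y_n), when f has law
   P and y_1, .., y_n are i.i.d. from f given f.  Bayes' formula cannot be used as
   a definition, as f |-> f x is not a function of the class of f. *)
Definition is_posterior (P : probability (borel_density base) R) n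
    (K : R.-pker (n.-tuple T) ~> borel_density base) :=
  forall (A : set (borel_density base)) (B : set (n.-tuple T)),
    measurable A -> measurable B ->
    (\int[P]_(f in A) iid_law f n B
     = \int[P]_f \int[iid_law f n]_(y in B) K y A)%E.

Definition iid_from d' (W : measurableType d') (Pr : probability W R)
    (f0 : density m) (X : nat -> W -> T) :=
  [/\ forall i, measurable_fun [set: W] (X i),
      forall i A, measurable A -> Pr (X i @^-1` A) = law f0 A
    & forall (J : {fset nat}) (A : nat -> set T), (forall i, measurable (A i)) ->
        Pr (\bigcap_(i in [set` J]) (X i @^-1` A i))
        = (\prod_(i <- J) Pr (X i @^-1` A i))%E ].

End bayes.

(* centers are densities; entropy is -oo for the empty set and +oo for a set that
   has no finite cover *)
Definition covering_number d (T : measurableType d) (R : realType)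
    (m : {measure set T -> \bar R}) (delta : R) (G : set (density m)) : \bar R :=
  ereal_inf [set (N%:R)%:E | N in
    [set N : nat | exists c : 'I_N -> density m,
      G `<=` \bigcup_i [set f | L1dist f (c i) < delta]]].

Definition L1_entropy d (T : measurableType d) (R : realType)
    (m : {measure set T -> \bar R}) (delta : R) (G : set (density m)) : \bar R :=
  lne (covering_number delta G).

Definition Fstar (R : realType) p1 p2 := borel_density (latent_base R p1 p2).
Definition Fmix (R : realType) p1 p2 (r : rounding_map R p1 p2) :=
  borel_density (mixed_base r).

(* P is the image of Ps by round_density: the argument of Ps is the preimage of B,
   seen as a set of functions. *)
Definition induced_prior (R : realType) p1 p2 (r : rounding_map R p1 p2)
    (Ps : probability (Fstar R p1 p2) R) (P : probability (Fmix r) R) :=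
  forall B : set (Fmix r), measurable B ->
    P B = Ps [set fs | exists2 f : density (mixed_measure r), B f &
      dens f = round_density r (fs : density (latent_measure R p1 p2))].

(* Main.v *)
(* Rounding does not increase L1 distances: integration over the disjoint cells
   A_y2 is a contraction, and for each inverse transformation the change of
   variables formula is only needed as an inequality, which follows from Fatou's
   lemma applied to difference quotients.  Hence a cover of F*_n by balls of radius
   delta gives a cover of all densities, up to a set of exponentially small
   Pi-probability, by balls of radius 2 delta.

   On the side of the observations, testing f0 against such a ball with the
   frequency of the event {f0 < f1}, where f1 is its center, has exponentially small
   error probabilities.  Summing over the cover gives sets C_n with small f0-mass
   whose complements have small mass under every f far from f0, up to small prior
   probability.  Then the marginal law of the data gives exponentially small mass to
   {K_n U^c > 1/k} minus C_n.  By the Borel-Cantelli lemma under Pi, so does the law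
   of the data from some f with KL f0 f as small as desired.  The log-likelihood
   ratio of f0 to f is o(1) + KL f0 f per observation, by a one-sided strong law of
   large numbers, so that the law from f0 gives small mass to these sets as well. *)
Require Import Defs.
From HB Require Import structures.
From mathcomp Require Import all_boot all_order all_algebra finmap.
From mathcomp Require Import all_classical all_reals all_analysis.
From mathcomp Require Import measurable_realfun ring lra.
Set Implicit Arguments.
Unset Strict Implicit.
Unset Printing Implicit Defensive.
Import Order.TTheory GRing.Theory Num.Theory.
Import numFieldNormedType.Exports.
Local Open Scope classical_set_scope.
Local Open Scope ring_scope.

(** * Integration on tuples *)

(** Probabilities of events are compared instead: [marginal_posterior_le] is Markov's inequality
    under the joint law of density and data, and one well-chosen density [f] stands in for the lower
    bound on the marginal likelihood. For the same reason, measurability on the space of densities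
    has to come from the $L_1$ metric: sets are open or closed, functionals are Lipschitz or
    monotone limits of Lipschitz ones. The constants close up because the sieve hypothesis may be
    used at any radius. At [e / 20], with [e] the minimum of [eps] and 1, it gives
    [2 * delta < e / 10], the radius that the tests tolerate, and a bound $e^2/3200$ on [beta],
    below the exponent $e^2/2048$ of the tests. *)

Section tuple_integral.
Context d (T : measurableType d) (R : realType).
Implicit Type m : {sigma_finite_measure set T -> \bar R}.
Local Open Scope ereal_scope.

Lemma tuple_measure_integral0 m (f : 0.-tuple T -> \bar R) :
  \int[tuple_measure m 0]_t f t = f [tuple].
Proof.
rewrite (eq_integral (cst (f [tuple]))); last first.
  by move=> t _; rewrite (tuple0 t).
by rewrite integral_cst//= diracT mule1.
Qed.

Lemma tuple_measure_integralS m n (f : n.+1.-tuple T -> \bar R) :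
  measurable_fun setT f -> (forall t, 0 <= f t) ->
  \int[tuple_measure m n.+1]_t f t =
  \int[m]_x \int[tuple_measure m n]_s f (tcons (x, s)).
Proof.
move=> mf f0.
rewrite [LHS](@ge0_integral_pushforward _ _ _ _ _ _ (@measurable_tcons _ T n) _
  setT f)//.
rewrite preimage_setT (fubini_tonelli1 (f \o @tcons _ T n))//.
  apply: measurableT_comp => //; exact: measurable_tcons.
by move=> x /=.
Qed.

Lemma measurable_tcons_section n d' (U : measurableType d')
    (f : n.+1.-tuple T -> U) x :
  measurable_fun setT f -> measurable_fun setT (fun s => f (tcons (x, s))).
Proof.
move=> mf; apply: (@measurableT_comp _ _ _ _ _ _ f) => //.
exact: (measurableT_comp (@measurable_tcons _ T n) (@pair1_measurable _ _ _ _ x)).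
Qed.

Lemma measurable_tcons_integral m n (f : n.+1.-tuple T -> \bar R) :
  measurable_fun setT f -> (forall t, 0 <= f t) ->
  measurable_fun setT (fun x => \int[tuple_measure m n]_s f (tcons (x, s))).
Proof.
move=> mf f0.
apply: (measurable_fun_fubini_tonelli_F (f \o @tcons _ T n)) => //=.
by apply: measurableT_comp => //; exact: measurable_tcons.
Qed.

Definition tuple_boxes n : set_system (n.-tuple T) :=
  [set A | exists2 B : 'I_n -> set T, (forall i, measurable (B i)) &
    A = [set t | forall i, B i (tnth t i)]].

Lemma tuple_boxesI n : setI_closed (@tuple_boxes n).
Proof.
move=> _ _ [A mA ->] [B mB ->]; exists (fun i => A i `&` B i).
  by move=> i; exact: measurableI.
apply/seteqP; split=> t /= h; first by case: h => hA hB i; split.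
by split=> i; case: (h i).
Qed.

Lemma tuple_boxes_measurable n : @tuple_boxes n `<=` measurable.
Proof.
move=> _ [B mB ->]; rewrite (_ : [set _ | _] = \bigcap_(i in [set: 'I_n])
    ((@tnth _ T ^~ i) @^-1` B i)).
  apply: fin_bigcap_measurable => // i _.
  by rewrite -[X in measurable X]setTI; exact: measurable_tnth.
by apply/seteqP; split => t /= h i; [move=> _; exact: h|exact: h].
Qed.

Lemma measurable_tupleE n : @measurable _ (n.-tuple T) = <<s @tuple_boxes n >>.
Proof.
apply/seteqP; split; last first.
  apply: smallest_sub; first exact: sigma_algebra_measurable.
  exact: tuple_boxes_measurable.
apply: smallest_sub; first exact: smallest_sigma_algebra.
move=> A; rewrite -bigcup_seq => -[/= i _ [B mB <-]].
apply: sub_sigma_algebra; exists (fun j => if j == i then B else setT).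
  by move=> j; case: ifP.
rewrite setTI; apply/seteqP; split => t /=.
  by move=> Bt j; case: eqP => // ->.
by move/(_ i); rewrite eqxx.
Qed.

Lemma tuple_boxesT n : @tuple_boxes n setT.
Proof. by exists (fun=> setT) => //; apply/seteqP; split. Qed.

(** Boxes form a generating pi-system, and [m setT = 1] makes the whole space a box of finite mass,
    as uniqueness of measures requires. *)
Lemma tuple_measure_unique m n (nu : {measure set (n.-tuple T) -> \bar R}) :
  m setT = 1 ->
  (forall B : 'I_n -> set T, (forall i, measurable (B i)) ->
    nu [set t | forall i, B i (tnth t i)] = \prod_(i < n) m (B i)) ->
  forall A, measurable A -> nu A = tuple_measure m n A.
Proof.
move=> m1 nuE A mA.
apply: (measure_unique (@tuple_boxes n) (fun=> setT)) => //.
- exact: measurable_tupleE.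
- exact: tuple_boxesI.
- by move=> _; exact: tuple_boxesT.
- by rewrite bigcup_const//; exists 0%N.
- by move=> _ [B mB ->]; rewrite nuE//; exact/esym/tuple_measure_box.
- move=> _; rewrite (_ : setT = [set t | forall i : 'I_n, [set: T] (tnth t i)]).
    by rewrite (nuE (fun=> setT))// big1// ltry.
  by apply/seteqP; split.
Qed.

End tuple_integral.

Section measurable_comparison.
Context d (T : measurableType d) (R : realType).

Lemma measurable_set_lee (f g : T -> \bar R) : measurable_fun setT f ->
  measurable_fun setT g -> measurable [set x | (f x <= g x)%E].
Proof.
by move=> mf mg; rewrite -[X in measurable X]setTI; exact: measurable_lee.
Qed.

Lemma measurable_set_lte (f g : T -> \bar R) : measurable_fun setT f ->
  measurable_fun setT g -> measurable [set x | (f x < g x)%E].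
Proof.
by move=> mf mg; rewrite -[X in measurable X]setTI; exact: measurable_lte.
Qed.

Lemma measurable_set_ler (f g : T -> R) : measurable_fun setT f ->
  measurable_fun setT g -> measurable [set x | f x <= g x].
Proof.
move=> mf mg; under eq_set => x do rewrite -lee_fin.
by apply: measurable_set_lee; exact/measurable_EFinP.
Qed.

Lemma measurable_set_ltr (f g : T -> R) : measurable_fun setT f ->
  measurable_fun setT g -> measurable [set x | f x < g x].
Proof.
move=> mf mg; under eq_set => x do rewrite -lte_fin.
by apply: measurable_set_lte; exact/measurable_EFinP.
Qed.

End measurable_comparison.

Lemma measurable_prod_tnth d (U : measurableType d) (R : realType) n (w : 'I_n -> U -> R) :
  (forall i, measurable_fun setT (w i)) ->
  measurable_fun setT (fun t : n.-tuple U => \prod_(i < n) w i (tnth t i)).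
Proof.
move=> mw; rewrite (_ : (fun _ => _) =
    (fun t => \prod_(i <- index_enum 'I_n) (fun i t => w i (@tnth n U t i)) i t)).
  apply: measurable_prod => i _; apply: measurableT_comp => //.
  exact: measurable_tnth.
by [].
Qed.

Section tuple_transport.
Context d d' (T : measurableType d) (T' : measurableType d') (R : realType).
Variables (m : {sigma_finite_measure set T -> \bar R})
  (m' : {sigma_finite_measure set T' -> \bar R}).
Local Open Scope ereal_scope.

(** Tonelli, one coordinate at a time. The two weights allow two uses: inverse transformations with
    their Jacobian factors [w] on the left, and a change of density with likelihood ratios [v] on
    the right, the maps then being identities. *)
Lemma tuple_measure_transport_le n (a : 'I_n -> T -> T') (w : 'I_n -> T -> R)
    (v : 'I_n -> T' -> R) :
  (forall i, measurable_fun setT (a i)) ->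
  (forall i, measurable_fun setT (w i)) -> (forall i x, (0 <= w i x)%R) ->
  (forall i, measurable_fun setT (v i)) -> (forall i x, (0 <= v i x)%R) ->
  (forall i (f : T' -> \bar R), measurable_fun setT f -> (forall x, 0 <= f x) ->
     \int[m]_x (f (a i x) * (w i x)%:E) <= \int[m']_x (f x * (v i x)%:E)) ->
  forall f : n.-tuple T' -> \bar R, measurable_fun setT f ->
    (forall t, 0 <= f t) ->
  \int[tuple_measure m n]_t
     (f [tuple a i (tnth t i) | i < n] * (\prod_(i < n) w i (tnth t i))%:E) <=
  \int[tuple_measure m' n]_t (f t * (\prod_(i < n) v i (tnth t i))%:E).
Proof.
elim: n a w v => [|n IH] a w v ma mw w0 mv v0 avw f mf f0.
  rewrite !tuple_measure_integral0 !big_ord0.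
  by rewrite [X in f X]tuple0.
have mtup k (b : 'I_k -> T -> T') : (forall i, measurable_fun setT (b i)) ->
    measurable_fun setT (fun t : k.-tuple T => [tuple b i (tnth t i) | i < k]).
  move=> mb; apply/measurable_fun_tnthP => i.
  rewrite (_ : _ \o _ = b i \o (@tnth k T ^~ i)).
    by apply: measurableT_comp => //; exact: measurable_tnth.
  by apply/funext => t /=; rewrite tnth_mktuple.
have tupS x (s : n.-tuple T) : [tuple a i (tnth (tcons (x, s)) i) | i < n.+1] =
    tcons (a ord0 x, [tuple a (lift ord0 i) (tnth s i) | i < n]).
  apply/eq_from_tnth => i; rewrite tnth_mktuple; case: (unliftP ord0 i) => [j|] ->.
    by rewrite !tnthS tnth_mktuple.
  by [].
rewrite tuple_measure_integralS; last 2 first.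
- apply: emeasurable_funM; first exact: (measurableT_comp mf (mtup _ _ ma)).
  by apply/measurable_EFinP; exact: measurable_prod_tnth.
- by move=> t; rewrite mule_ge0// lee_fin prodr_ge0.
rewrite tuple_measure_integralS; last 2 first.
- apply: emeasurable_funM => //.
  by apply/measurable_EFinP; exact: measurable_prod_tnth.
- by move=> t; rewrite mule_ge0// lee_fin prodr_ge0.
pose h x := \int[tuple_measure m' n]_s (f (tcons (x, s)) *
  (\prod_(i < n) v (lift ord0 i) (tnth s i))%:E).
have mh : measurable_fun setT h.
  apply: (measurable_fun_fubini_tonelli_F (fun xs => f (tcons xs) *
    (\prod_(i < n) v (lift ord0 i) (tnth xs.2 i))%:E)); last first.
    by move=> xs; rewrite mule_ge0// lee_fin prodr_ge0.
  apply: emeasurable_funM.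
    exact: (measurableT_comp mf (@measurable_tcons _ T' n)).
  apply/measurable_EFinP.
  have mvl : measurable_fun setT (fun s : n.-tuple T' =>
      \prod_(i < n) v (lift ord0 i) (tnth s i))%R.
    by apply: (measurable_prod_tnth (w := fun i => v (lift ord0 i))) => i; exact: mv.
  exact: (measurableT_comp mvl).
have h0 x : 0 <= h x.
  by apply: integral_ge0 => s _; rewrite mule_ge0// lee_fin prodr_ge0.
(* In the middle term the last [n] coordinates are already transported by [IH], and the first one is
   not yet. *)
apply: (@le_trans _ _ (\int[m]_x (h (a ord0 x) * (w ord0 x)%:E))); last first.
  apply: (le_trans (avw ord0 h mh h0)); apply: ge0_le_integral => //.
  - by move=> x _; rewrite mule_ge0// lee_fin.
  - by apply: emeasurable_funM => //; exact/measurable_EFinP.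
  - apply: (measurable_tcons_integral m' (f := fun t => f t *
      (\prod_(i < n.+1) v i (tnth t i))%:E)).
      apply: emeasurable_funM => //.
      by apply/measurable_EFinP; exact: measurable_prod_tnth.
    by move=> t; rewrite mule_ge0// lee_fin prodr_ge0.
  - move=> x _; rewrite -ge0_integralZr//; last 3 first.
    + apply: emeasurable_funM; first exact: measurable_tcons_section.
      apply/measurable_EFinP.
      by apply: (measurable_prod_tnth (w := fun i => v (lift ord0 i))) => i; exact: mv.
    + by move=> s _; rewrite mule_ge0// lee_fin prodr_ge0.
    + by rewrite lee_fin.
    rewrite le_eqVlt; apply/orP; left; apply/eqP; apply: eq_integral => s _.
    rewrite big_ord_recl -muleA -EFinM mulrC; congr (_ * _%:E).
    by congr (_ * _)%R; apply: eq_bigr => i _; rewrite tnthS.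
apply: ge0_le_integral => //.
- by move=> x _; apply: integral_ge0 => s _; rewrite mule_ge0// lee_fin prodr_ge0.
- apply: (measurable_tcons_integral m (f := fun t =>
    f [tuple a i (tnth t i) | i < n.+1] * (\prod_(i < n.+1) w i (tnth t i))%:E)).
    apply: emeasurable_funM; first exact: (measurableT_comp mf (mtup _ _ ma)).
    by apply/measurable_EFinP; exact: measurable_prod_tnth.
  by move=> t; rewrite mule_ge0// lee_fin prodr_ge0.
- apply: emeasurable_funM; last exact/measurable_EFinP.
  exact: measurableT_comp mh (ma ord0).
move=> x _.
have IHx := IH (fun i => a (lift ord0 i)) (fun i => w (lift ord0 i))
  (fun i => v (lift ord0 i)) (fun i => ma _) (fun i => mw _) (fun i => w0 _)
  (fun i => mv _) (fun i => v0 _) (fun i => avw _)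
  (fun s => f (tcons (a ord0 x, s))) (measurable_tcons_section _ mf)
  (fun s => f0 _).
apply: (le_trans _ (lee_wpmul2r _ IHx)); last by rewrite lee_fin.
rewrite -ge0_integralZr//; last 3 first.
- apply: emeasurable_funM.
    apply: (measurableT_comp (f := fun s => f (tcons (a ord0 x, s)))).
      exact: measurable_tcons_section.
    by apply: (mtup _ (fun i => a (lift ord0 i))) => i; exact: ma.
  apply/measurable_EFinP.
  by apply: (measurable_prod_tnth (w := fun i => w (lift ord0 i))) => i; exact: mw.
- by move=> s _; rewrite mule_ge0// lee_fin prodr_ge0.
- by rewrite lee_fin.
rewrite le_eqVlt; apply/orP; left; apply/eqP; apply: eq_integral => s _.
rewrite tupS big_ord_recl -muleA -EFinM mulrC; congr (_ * _%:E).
by congr (_ * _)%R; apply: eq_bigr => i _; rewrite tnthS.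
Qed.

Lemma tuple_measure_prod_le n (g : T -> R) (c : R) :
  measurable_fun setT g -> (forall x, (0 <= g x)%R) -> (0 <= c)%R ->
  \int[m]_x (g x)%:E <= c%:E ->
  \int[tuple_measure m n]_t (\prod_(i < n) g (tnth t i))%:E <= (c ^+ n)%:E.
Proof.
move=> mg g0 c0 gc; elim: n => [|n IH].
  by rewrite tuple_measure_integral0 big_ord0 expr0.
rewrite tuple_measure_integralS; last 2 first.
- by apply/measurable_EFinP; exact: (measurable_prod_tnth (w := fun=> g)).
- by move=> t; rewrite lee_fin prodr_ge0.
rewrite (eq_integral (fun x => (g x)%:E *
    \int[tuple_measure m n]_s (\prod_(i < n) g (tnth s i))%:E)).
  rewrite ge0_integralZr//; last 3 first.
  - exact/measurable_EFinP.
  - by move=> x _; rewrite lee_fin.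
  - by apply: integral_ge0 => s _; rewrite lee_fin prodr_ge0.
  rewrite exprS EFinM; apply: lee_pmul => //.
  - by apply: integral_ge0 => s _; rewrite lee_fin.
  - by apply: integral_ge0 => s _; rewrite lee_fin prodr_ge0.
move=> x _; rewrite -ge0_integralZl_EFin//; last 2 first.
- by move=> s _; rewrite lee_fin prodr_ge0.
- by apply/measurable_EFinP; exact: (measurable_prod_tnth (w := fun=> g)).
apply: eq_integral => s _; rewrite big_ord_recl EFinM; congr (_ * _%:E).
by apply: eq_bigr => i _; rewrite tnthS.
Qed.

End tuple_transport.

(** * Independent samples *)

Section borel_cantelli_exp.
Context (R : realType).

Lemma expR_natlN (c : R) (n : nat) : expR (- (n%:R * c)) = expR (- c) ^+ n.
Proof. by rewrite -mulrN expRM_natl. Qed.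

Lemma lim_sup_set_expR_decay d (T : measurableType d) (mu : probability T R)
    (F : (set T)^nat) (C c : R) :
  (forall n, measurable (F n)) -> 0 < c ->
  (\forall n \near \oo, mu (F n) <= (C * expR (- (n%:R * c)))%:E)%E ->
  mu (lim_sup_set F) = 0%E.
Proof.
move=> mF c0 [N _ FN]; apply: lim_sup_set_cvg0 => //.
set q := expR (- c).
have q0 : 0 < q by exact: expR_gt0.
have q1 : q < 1 by rewrite -expR0 ltr_expR oppr_lt0.
(* The summand [q ^- N] takes care of the ranks below [N], where only the bound 1 on probabilities
   is known: there [q ^- N * q ^+ n] is at least 1. *)
pose D : R := `|C| + q ^- N.
have D0 : 0 <= D by rewrite addr_ge0// invr_ge0 exprn_ge0// ltW.
apply: (@le_lt_trans _ _ (\sum_(0 <= n <oo) (D * q ^+ n)%:E)%E).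
  apply: lee_nneseries => [i _ _|n _]; first exact: measure_ge0.
  have [Nn|nN] := leqP N n.
    apply: (le_trans (FN _ _)) => //.
    rewrite lee_fin expR_natlN ler_wpM2r ?exprn_ge0 ?expR_ge0//.
    by rewrite (le_trans (ler_norm _))// lerDl invr_ge0 exprn_ge0// ltW.
  apply: (le_trans (probability_le1 _ _)) => //.
  rewrite lee_fin mulrDl (le_trans _ (lerD (mulr_ge0 _ _) (lexx _)))//.
  - by rewrite add0r ler_pdivlMl ?exprn_gt0// mulr1; apply: ler_wiXn2l; [exact: ltW..|exact: ltnW].
  - by rewrite exprn_ge0// ltW.
apply: (@le_lt_trans _ _ (D / (1 - q))%:E); last exact: ltry.
apply: lime_le.
  apply: is_cvg_nneseries => k _ _.
  by rewrite lee_fin mulr_ge0// exprn_ge0// ltW.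
apply: nearW => n; rewrite sumEFin lee_fin.
apply: geometric_le_lim => //.
by rewrite ger0_norm// ltW.
Qed.

End borel_cantelli_exp.

Section iid_tuples.
Context d (T : measurableType d) (R : realType) (m : {measure set T -> \bar R}).
Context d' (W : measurableType d') (Pr : probability W R).
Variables (f0 : density m) (y : nat -> W -> T).
Hypothesis hy : iid_from Pr f0 y.

Lemma measurable_iid_tuple n : measurable_fun setT (fun w => [tuple y i w | i < n]).
Proof.
have [my _ _] := hy; apply/measurable_fun_tnthP => i.
rewrite (_ : _ \o _ = y i)//.
by apply/funext => w /=; rewrite tnth_mktuple.
Qed.

Lemma iid_tuple_law n (A : set (n.-tuple T)) : measurable A ->
  Pr [set w | A [tuple y i w | i < n]] = iid_law f0 n A.
Proof.
move=> mA; have [my ly iy] := hy.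
pose nu := pushforward Pr (fun w => [tuple y i w | i < n]).
have := @tuple_measure_unique _ _ _ (law f0) n
  (measure_function_pushforward__canonical__measure_function_Measure
    Pr (@measurable_iid_tuple n)).
apply => //; first exact: (@probability_setT _ _ _ (law f0)).
move=> B mB.
(* [iid_from] wants a family indexed by all of [nat]; the box is completed by [setT]. *)
pose A' k : set T := if insub k is Some i then B i else setT.
have mA' k : measurable (A' k) by rewrite /A'; case: insubP.
have A'E (i : 'I_n) : A' i = B i by rewrite /A' valK.
transitivity (Pr (\bigcap_(i in [set` [fset x in iota 0 n]%fset]) (y i @^-1` A' i))).
  rewrite /pushforward; congr (Pr _); apply/seteqP; split => w /=.
    move=> h i /=; rewrite inE/= mem_iota add0n/= => ni.
    by rewrite -[i]/(val (Ordinal ni)) A'E; have := h (Ordinal ni); rewrite tnth_mktuple.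
  move=> h i; rewrite tnth_mktuple -A'E; apply: h => /=.
  by rewrite inE/= mem_iota add0n/=.
rewrite iy// (perm_big (iota 0 n)); last first.
  apply: uniq_perm; [exact: fset_uniq|exact: iota_uniq|].
  by move=> k; rewrite inE.
rewrite -[X in iota _ X]subn0 -/(index_iota 0 n) big_mkord.
by apply: eq_bigr => i _; rewrite ly// A'E.
Qed.

End iid_tuples.

Section chernoff.
Context d (T : measurableType d) (R : realType).
Implicit Types (Q : probability T R) (phi : T -> R).

Lemma tuple_measure_setT Q n : tuple_measure Q n setT = 1%E.
Proof.
rewrite (_ : setT = [set t | forall i : 'I_n, [set: T] (tnth t i)]).
  rewrite (tuple_measure_box Q (B := fun=> setT))// big1// => i _.
  exact: probability_setT.
by apply/seteqP; split.
Qed.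

(** $e^x = 1/e^{-x} \le 1/(1-x)$, and $(1-x)(1+x+2x^2) = 1 + x^2(1-2x)$ is at least 1 for $x \le
    1/2$, negative values included. *)
Lemma expR_le_quadratic (x : R) : x <= 2^-1 -> expR x <= 1 + x + 2 * x ^+ 2.
Proof.
move=> x2; have x1 : 0 < 1 - x by rewrite subr_gt0; lra.
rewrite -[x in expR x]opprK expRN.
apply: (@le_trans _ _ (1 - x)^-1).
  by rewrite lef_pV2 ?posrE ?expR_gt0// expR_ge1Dx.
rewrite -[leLHS]mul1r ler_pdivrMr//; nra.
Qed.

Lemma integrable_bounded Q phi (b : R) : measurable_fun setT phi ->
  (forall x, `|phi x| <= b) -> Q.-integrable setT (EFin \o phi).
Proof.
move=> mphi phib; apply: measurable_bounded_integrable => //.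
  by rewrite (le_lt_trans (probability_le1 _ _))// ltry.
exists b; split; first exact: num_real.
by move=> M bM x _; apply: (le_trans (phib x)); exact: ltW.
Qed.

Lemma chernoff_tuple Q phi (gamma : R) n :
  measurable_fun setT phi -> (forall x, `|phi x| <= 1) ->
  0 < gamma <= 1 -> (\int[Q]_x (phi x)%:E <= (- gamma)%:E)%E ->
  (tuple_measure Q n [set t | (0 <= \sum_(i < n) phi (tnth t i))%R]
    <= (expR (- (n%:R * (gamma ^+ 2 / 8))))%:E)%E.
Proof.
move=> mphi phi1 /andP[gamma0 gamma1] phig.
(* The exponent [- s * gamma + 2 * s ^+ 2] is least at this [s], with value [- gamma ^+ 2 / 8]. *)
pose s := gamma / 4; pose g x := expR (s * phi x).
have mg : measurable_fun setT g.
  by apply: measurableT_comp => //; exact: measurable_funM.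
have iphi := integrable_bounded Q mphi phi1.
have gle : (\int[Q]_x (g x)%:E <= (expR (- (gamma ^+ 2 / 8)))%:E)%E.
  apply: (@le_trans _ _ (\int[Q]_x ((1 + 2 * s ^+ 2)%:E + s%:E * (phi x)%:E))%E).
    apply: ge0_le_integral => //.
    - by move=> x _; rewrite lee_fin expR_ge0.
    - exact/measurable_EFinP.
    - apply: emeasurable_funD => //; apply: emeasurable_funM => //.
      exact/measurable_EFinP.
    move=> x _; rewrite -EFinM -EFinD lee_fin /g.
    have /ler_normlP[p1 p2] := phi1 x.
    have s0 : 0 <= s <= 4^-1 by rewrite /s; apply/andP; split; lra.
    apply: (le_trans (expR_le_quadratic _)); first by rewrite /s; nra.
    have : (s * phi x) ^+ 2 <= s ^+ 2.
      rewrite exprMn ler_piMr ?sqr_ge0//.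
      by rewrite -real_normK ?num_real// expr_le1.
    lra.
  rewrite integralD//; last 2 first.
  - exact: finite_measure_integrable_cst.
  - exact: integrableZl.
  rewrite integral_cst// integralZl//= probability_setT mule1.
  apply: (@le_trans _ _ ((1 + 2 * s ^+ 2)%:E + s%:E * (- gamma)%:E)%E).
    by rewrite leeD2l// lee_wpmul2l// lee_fin /s divr_ge0// ltW.
  rewrite -EFinM -EFinD lee_fin; apply: le_trans (expR_ge1Dx _).
  by rewrite /s; nra.
have mS : measurable [set t : n.-tuple T | 0 <= \sum_(i < n) phi (tnth t i)].
  apply: measurable_set_ler => //.
  apply: measurable_sum => i; apply: measurableT_comp => //.
  exact: measurable_tnth.
rewrite expR_natlN.
apply: (le_trans _ (tuple_measure_prod_le n mg _ (expR_ge0 _) gle)); last first.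
  by move=> x; exact: expR_ge0.
rewrite -(setIT [set t | _]) -integral_indic//.
apply: ge0_le_integral => //.
- by apply/measurable_EFinP.
- by apply/measurable_EFinP; exact: (measurable_prod_tnth (w := fun=> g)).
move=> t _; rewrite lee_fin -expR_sum -mulr_sumr indicE.
case: (boolP (t \in _)) => [|_]; last exact: expR_ge0.
rewrite inE/= => h; rewrite -expR0 ler_expR mulr_ge0//.
by rewrite divr_ge0// ltW.
Qed.

End chernoff.

Section maximal_inequality.
Context d (T : measurableType d) (R : realType).
Variables (Q : probability T R).

(* [maxsum x t] is the maximum of [0] and of the sums of [x] over the nonempty
   prefixes of [t]. *)
Fixpoint maxsum (x : T -> R) (s : seq T) : R :=
  if s is a :: s' then Num.max 0 (x a + maxsum x s') else 0.

Lemma maxsum_ge0 x s : 0 <= maxsum x s.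
Proof. by case: s => //= a s; rewrite le_max lexx. Qed.

Lemma maxsum_rcons x s a : maxsum x s <= maxsum x (rcons s a).
Proof.
elim: s => [|b s IH] /=; first by rewrite le_max lexx.
rewrite ge_max le_max lexx/= le_max lerD2l IH orbT//.
Qed.

Lemma maxsum_take x s n : \sum_(a <- take n s) x a <= maxsum x s.
Proof.
elim: s n => [|a s IH] [|n] /=; rewrite ?big_nil ?le_max ?lexx//.
by rewrite big_cons lerD2l IH orbT.
Qed.

Lemma measurable_maxsum x n : measurable_fun setT x ->
  measurable_fun setT (fun t : n.-tuple T => maxsum x t).
Proof.
move=> mx; elim: n => [|n IH].
  rewrite (_ : (fun _ => _) = cst 0); first exact: measurable_cst.
  by apply/funext => t; rewrite (tuple0 t).
rewrite (_ : (fun _ => _) = (fun t : n.+1.-tuple T =>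
    Num.max 0 (x (thead t) + maxsum x [tuple of behead t]))).
  apply: measurable_maxr => //; apply: measurable_funD.
    apply: measurableT_comp => //; exact: (measurable_tnth ord0).
  exact: (measurableT_comp IH (@measurable_behead _ T n)).
by apply/funext => t; rewrite [in LHS](tuple_eta t).
Qed.

Local Open Scope ereal_scope.

(** An extra observation at the end can only increase the mean. [tuple_measure] grows at the front,
    so the induction moves the first entry into [psi]; this is why [psi] is a function on
    sequences. *)
Lemma tuple_measure_integral_rcons (psi : seq T -> R) n :
  (forall k, measurable_fun setT (fun t : k.-tuple T => psi t)) ->
  (forall s, (0 <= psi s)%R) -> (forall s a, (psi s <= psi (rcons s a))%R) ->
  \int[tuple_measure Q n]_t (psi t)%:E <= \int[tuple_measure Q n.+1]_t (psi t)%:E.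
Proof.
elim: n psi => [|n IH] psi mpsi psi0 psiS.
  rewrite tuple_measure_integral0 tuple_measure_integralS; last 2 first.
  - by apply/measurable_EFinP; exact: mpsi.
  - by move=> t; rewrite lee_fin.
  rewrite -[leLHS](mule1) -(@probability_setT _ _ _ Q) -integral_cst//.
  apply: ge0_le_integral => //.
  - by move=> t _; rewrite lee_fin.
  - apply: (measurable_tcons_integral Q (f := fun t : 1.-tuple T => (psi t)%:E)).
      by apply/measurable_EFinP; exact: mpsi.
    by move=> t; rewrite lee_fin.
  by move=> a _; rewrite tuple_measure_integral0 lee_fin; exact: (psiS [::]).
have mpsiE k : measurable_fun setT (fun t : k.-tuple T => (psi t)%:E).
  by apply/measurable_EFinP; exact: mpsi.
have psi0E k (t : k.-tuple T) : 0 <= (psi t)%:E by rewrite lee_fin.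
rewrite tuple_measure_integralS// [leRHS]tuple_measure_integralS//.
apply: ge0_le_integral => //.
- by move=> a _; apply: integral_ge0 => s _; rewrite lee_fin.
- exact: (measurable_tcons_integral Q (mpsiE _)).
- exact: (measurable_tcons_integral Q (mpsiE _)).
move=> a _; apply: (IH (fun s => psi (a :: s))) => //.
  move=> k; exact: (measurable_tcons_section (f := fun t => psi t)).
by move=> s b; exact: (psiS (a :: s)).
Qed.

(** Hopf's maximal inequality, by Garsia's argument. If [a k] is the mean of the maximum over [k]
    observations, one step bounds [lam] times the mass plus [a k.+1] by the mean of [Z] plus [a k];
    since [a] is finite and nondecreasing, it cancels. Only a first moment is used, and the bound is
    uniform in [n]. *)
Lemma maximal_tuple (Z : T -> R) (lam : R) n :
  measurable_fun setT Z -> (forall x, (0 <= Z x)%R) -> (0 < lam)%R ->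
  lam%:E * tuple_measure Q n [set t : n.-tuple T | (0 < maxsum (fun x => Z x - lam) t)%R]
    <= \int[Q]_x (Z x)%:E.
Proof.
move=> mZ Z0 lam0.
have [Zoo|] := ltP (\int[Q]_x (Z x)%:E) +oo; last first.
  by rewrite leye_eq => /eqP ->; rewrite leey.
set x := fun a => (Z a - lam)%R.
have mx : measurable_fun setT x by exact: measurable_funB.
have mM k := @measurable_maxsum x k mx.
have mME k : measurable_fun setT (fun t : k.-tuple T => (maxsum x t)%:E).
  by apply/measurable_EFinP; exact: mM.
have M0 k (t : k.-tuple T) : 0 <= (maxsum x t)%:E.
  by rewrite lee_fin maxsum_ge0.
have mS k : measurable [set t : k.-tuple T | (0 < maxsum x t)%R].
  apply: measurable_set_ltr; [exact: measurable_cst|exact: mM].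
case: n => [|n].
  rewrite (_ : [set t : 0.-tuple T | (0 < maxsum x t)%R] = set0).
    rewrite measure0 mule0.
    by apply: integral_ge0 => a _; rewrite lee_fin.
  by apply/seteqP; split => // t /=; rewrite (tuple0 t) ltxx.
pose a k := \int[tuple_measure Q k]_t (maxsum x t)%:E.
have a0 k : 0 <= a k by apply: integral_ge0.
have aS k : a k <= a k.+1.
  apply: tuple_measure_integral_rcons => //; first exact: maxsum_ge0.
  exact: maxsum_rcons.
pose S k := [set t : k.-tuple T | (0 < maxsum x t)%R].
have mSE k : measurable_fun setT (fun t : k.-tuple T => (\1_(S k) t)%:E).
  by apply/measurable_EFinP; apply: measurable_indic; exact: mS.
pose G k (t : k.-tuple T) := lam%:E * (\1_(S k) t)%:E + (maxsum x t)%:E.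
have mlS k : measurable_fun setT (fun t => lam%:E * (\1_(S k) t)%:E).
  by apply: emeasurable_funM => //; exact: mSE.
have mG k : measurable_fun setT (G k).
  by apply: emeasurable_funD; [exact: mlS|exact: mME].
have lS0 k t : 0 <= lam%:E * (\1_(S k) t)%:E.
  by rewrite mule_ge0// lee_fin// ltW.
have G0 k t : 0 <= G k t by exact: adde_ge0.
(* Garsia: where it is positive, the maximum over [b :: s] is [x b] plus the
   maximum over [s]. *)
have key k : lam%:E * tuple_measure Q k.+1 (S k.+1) + a k.+1
    <= \int[Q]_x (Z x)%:E + a k.
  have -> : lam%:E * tuple_measure Q k.+1 (S k.+1) + a k.+1 =
      \int[tuple_measure Q k.+1]_t G k.+1 t.
    rewrite ge0_integralD//; [|exact: mlS|exact: mME].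
    rewrite ge0_integralZl_EFin//; [|exact: mSE|exact: ltW].
    by rewrite integral_indic ?setIT//; exact: mS.
  rewrite tuple_measure_integralS; [|exact: mG|exact: G0].
  rewrite -[a k](mule1) -(@probability_setT _ _ _ Q) -integral_cst//.
  rewrite -ge0_integralD//; [|by move=> b _; rewrite lee_fin|exact/measurable_EFinP|by move=> b _ /=].
  apply: ge0_le_integral => //.
  - by move=> b _; apply: integral_ge0.
  - exact: (measurable_tcons_integral Q (mG _)).
  - by apply: emeasurable_funD => //; exact/measurable_EFinP.
  move=> b _.
  apply: (@le_trans _ _ (\int[tuple_measure Q k]_s ((Z b)%:E + (maxsum x s)%:E))).
    apply: ge0_le_integral => //.
    - exact: (measurable_tcons_section b (mG k.+1)).
    - by apply: emeasurable_funD => //; exact: mME.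
    move=> s _; rewrite /G -EFinM -!EFinD lee_fin indicE.
    have xE : x b = (Z b - lam)%R by [].
    have Ms := maxsum_ge0 x s; have Zb := Z0 b.
    case: (boolP (_ \in _)) => [|_]; rewrite ?inE ?mulr1 ?mulr0 /=.
      by rewrite /S/= lt_max ltxx/= => h; rewrite (max_r (ltW h)) xE; lra.
    rewrite add0r ge_max addr_ge0//= xE; lra.
  rewrite ge0_integralD//; last exact: mME.
    by rewrite integral_cst//= (tuple_measure_setT Q k) mule1.
  by move=> s _; rewrite lee_fin.
have afin k : a k < +oo.
  elim: k => [|k IH]; first by rewrite /a tuple_measure_integral0 ltry.
  apply: le_lt_trans (lte_add_pinfty Zoo IH); apply: le_trans (key k).
  by rewrite leeDr// mule_ge0// lee_fin ltW.
rewrite -(@leeD2rE _ (a n.+1)); last by rewrite ge0_fin_numE.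
by apply: (le_trans (key n)); rewrite leeD2l.
Qed.

End maximal_inequality.

Lemma cvge_lt (R : realType) (u : (\bar R)^nat) (a b : \bar R) :
  u @ \oo --> a -> (a < b)%E -> \forall n \near \oo, (u n < b)%E.
Proof. by move=> ua ab; exact: (ua _ (open_ereal_lt' ab)). Qed.

Section one_sided_slln.
Context d (T : measurableType d) (R : realType) (m : {measure set T -> \bar R}).
Context d' (W : measurableType d') (Pr : probability W R).
Variables (f0 : density m) (y : nat -> W -> T).
Hypothesis hy : iid_from Pr f0 y.
Variables (L : T -> R) (eta : R).
Hypotheses (mL : measurable_fun setT L)
  (iL : (law f0).-integrable setT (EFin \o L))
  (Leta : (\int[law f0]_x (L x)%:E < eta%:E)%E).

Let Q : probability T R := law f0.
Let clip (k : nat) x : R := Num.max (- k%:R) (Num.min (L x) k%:R).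
Let excess (k : nat) x : R := Num.max 0 (L x - k%:R).

Let mclip k : measurable_fun setT (clip k).
Proof. by apply: measurable_maxr => //; exact: measurable_minr. Qed.

Let mexcess k : measurable_fun setT (excess k).
Proof. by apply: measurable_maxr => //; exact: measurable_funB. Qed.

Let L_le_clip_excess k x : L x <= clip k x + excess k x.
Proof.
have k0 : 0 <= k%:R :> R by [].
by rewrite /clip /excess; case: (leP (L x) k%:R); rewrite /Num.max; case: ifPn;
  case: ifPn => *; lra.
Qed.

Let near_truncated (e : R) (a : R) : 0 < e -> (\int[Q]_x (L x)%:E < a%:E)%E ->
  exists k : nat, (\int[Q]_x (clip k x)%:E < a%:E)%E /\
    (\int[Q]_x (excess k x)%:E < e%:E)%E.
Proof.
move=> e0 La.
have iLn : Q.-integrable setT (fun x => `|L x|%:E) by exact: integrable_norm.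
have big x : \forall k \near \oo, `|L x| <= k%:R by exact: nbhs_infty_ger.
have c1 : (fun k => \int[Q]_x (clip k x)%:E)%E @ \oo --> (\int[Q]_x (L x)%:E)%E.
  apply: (@dominated_cvg _ _ _ _ _ measurableT _ _ (fun x => `|L x|%:E)) => //.
  - by move=> k; exact/measurable_EFinP.
  - move=> x _; apply: cvg_near_cst; near=> k; congr (_%:E).
    have /ler_normlP[h1 h2] : `|L x| <= k%:R by near: k; exact: big.
    rewrite /clip min_l// max_r//; lra.
  - move=> k x _; rewrite lee_fin /clip ler_norml.
    have := ler_norm (L x); have := ler_norm (- L x); rewrite normrN.
    have : 0 <= k%:R :> R by [].
    by case: (leP (L x) k%:R) => *; rewrite /Num.max; case: ifPn => *; lra.
have c2 : (fun k => \int[Q]_x (excess k x)%:E)%E @ \oo --> (\int[Q]_x (cst 0 x))%E.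
  apply: (@dominated_cvg _ _ _ _ _ measurableT _ _ (fun x => `|L x|%:E)) => //.
  - by move=> k; exact/measurable_EFinP.
  - move=> x _; apply: cvg_near_cst; near=> k; congr (_%:E).
    have /ler_normlP[h1 h2] : `|L x| <= k%:R by near: k; exact: big.
    rewrite /excess max_l//; lra.
  - move=> k x _; rewrite lee_fin /excess ler_norml.
    have := ler_norm (L x); have := normr_ge0 (L x).
    have : 0 <= k%:R :> R by [].
    by rewrite /Num.max; case: ifPn => *; lra.
rewrite integral0 in c2.
have n1 : \forall k \near \oo, (\int[Q]_x (clip k x)%:E < a%:E)%E.
  exact: (cvge_lt c1).
have n2 : \forall k \near \oo, (\int[Q]_x (excess k x)%:E < e%:E)%E.
  by apply: (cvge_lt c2); rewrite lte_fin.
have [N _ h] : \forall k \near \oo, (\int[Q]_x (clip k x)%:E < a%:E)%E /\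
    (\int[Q]_x (excess k x)%:E < e%:E)%E.
  by near=> k; split; near: k.
by exists N; apply: h => /=.
Unshelve. all: by end_near. Qed.

Lemma measurable_iid_sum (phi : T -> R) n : measurable_fun setT phi ->
  measurable_fun setT (fun w => \sum_(i < n) phi (y i w)).
Proof.
have [my _ _] := hy.
by move=> mphi; apply: measurable_sum => i; exact: measurableT_comp.
Qed.

(** A running maximum never decreases, so the events [E n] increase and the bound, uniform in [n],
    passes to their union. *)
Lemma iid_maximal (Z : T -> R) (lam : R) :
  measurable_fun setT Z -> (forall x, 0 <= Z x) -> 0 < lam ->
  (lam%:E * Pr (\bigcup_n [set w | (n%:R * lam < \sum_(i < n) Z (y i w))%R])
    <= \int[Q]_x (Z x)%:E)%E.
Proof.
move=> mZ Z0 lam0; pose x a := Z a - lam.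
have mx : measurable_fun setT x by exact: measurable_funB.
pose E n := [set w | 0 < maxsum x [tuple y i w | i < n]].
have mE n : measurable (E n).
  apply: measurable_set_ltr => //.
  apply: (measurableT_comp (f := fun t : n.-tuple T => maxsum x t)).
    exact: measurable_maxsum.
  exact: (measurable_iid_tuple hy).
have PE n : (lam%:E * Pr (E n) <= \int[Q]_x (Z x)%:E)%E.
  apply: le_trans (maximal_tuple Q n mZ Z0 lam0).
  rewrite (iid_tuple_law hy (A := [set t : n.-tuple T | 0 < maxsum x t]))//.
  by apply: measurable_set_ltr => //; exact: measurable_maxsum.
have ndE : nondecreasing_seq E.
  apply/nondecreasing_seqP => n; apply/subsetPset => w /= /lt_le_trans; apply.
  rewrite (_ : tval [tuple y i w | i < n.+1] =
    rcons [tuple y i w | i < n] (y n w)); first exact: maxsum_rcons.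
  apply: (@eq_from_nth _ (y 0%N w)); rewrite ?size_rcons ?size_tuple// => i ni.
  rewrite nth_rcons size_tuple (nth_mktuple _ _ (Ordinal ni))/=.
  have [i_n|i_n] := ltnP i n; first by rewrite (nth_mktuple _ _ (Ordinal i_n)).
  have -> : i = n by apply/eqP; rewrite eqn_leq i_n -ltnS ni.
  by rewrite eqxx.
apply: (@le_trans _ _ (lam%:E * Pr (\bigcup_n E n))%E).
  rewrite lee_pmul2l ?lte_fin// ?lee_fin//; apply: le_measure; rewrite ?inE.
  - apply: bigcupT_measurable => n; apply: measurable_set_ltr => //.
    exact: measurable_iid_sum.
  - exact: bigcupT_measurable.
  apply: subset_bigcup => n _ w /= h; apply: lt_le_trans (maxsum_take _ _ n).
  rewrite take_oversize ?size_tuple// big_tuple.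
  rewrite (eq_bigr (fun i : 'I_n => Z (y i w) - lam)); last first.
    by move=> i _; rewrite tnth_mktuple.
  by rewrite sumrB sumr_const card_ord subr_gt0 -mulr_natl.
rewrite muleC -lee_pdivlMr//.
have cE : Pr \o E @ \oo --> Pr (\bigcup_n E n).
  by apply: nondecreasing_cvg_mu => //; exact: bigcupT_measurable.
rewrite -(cvg_lim _ cE)//; apply: lime_le; first by apply/cvg_ex; eexists; exact: cE.
by apply: nearW => n /=; rewrite lee_pdivlMr// muleC.
Qed.

(** Integrability is all that a finite Kullback-Leibler divergence gives, so [L] is truncated. The
    bounded part [clip k] obeys Chernoff's bound and Borel-Cantelli; [excess k] has a mean as small
    as desired and obeys the maximal inequality. Values of [L] below [- k%:R] are raised to that
    level, which is harmless for an upper bound. *)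
Lemma one_sided_slln :
  Pr (lim_sup_set (fun n => [set w | n%:R * eta < \sum_(i < n) L (y i w)])) = 0%E.
Proof.
have mS (phi : T -> R) (c : R) n : measurable_fun setT phi ->
    measurable [set w | n%:R * c < \sum_(i < n) phi (y i w)].
  by move=> mphi; apply: measurable_set_ltr => //; exact: measurable_iid_sum.
have mbad (phi : T -> R) (c : R) : measurable_fun setT phi -> measurable
    (lim_sup_set (fun n => [set w | n%:R * c < \sum_(i < n) phi (y i w)])).
  move=> mphi; apply: bigcapT_measurable => n.
  by apply: bigcup_measurable => k _; exact: mS.
set bad := lim_sup_set _.
have [a [La aeta]] : exists a, (\int[Q]_x (L x)%:E < a%:E)%E /\ a < eta.
  have fL := integrable_fin_num measurableT iL.
  exists ((fine (\int[Q]_x (L x)%:E) + eta) / 2).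
  have : fine (\int[Q]_x (L x)%:E) < eta by rewrite -lte_fin fineK.
  by rewrite -[X in (X < _)%E]fineK// lte_fin => ?; split; lra.
(* [eta = a + g + g]: one [g] is the margin of the Chernoff bound, the other one is allotted to the
   excess. *)
pose g := (eta - a) / 2; have g0 : 0 < g by rewrite divr_gt0// subr_gt0.
apply/eqP; rewrite eq_le measure_ge0 andbT.
apply/lee_addgt0Pr => e e0; rewrite add0e.
(* The mean of the excess is made less than [e * g], as the maximal inequality at level [g] divides
   it by [g]. *)
have [k [ck zk]] := near_truncated (mulr_gt0 e0 g0) La.
(* Large enough for both [phi] and the margin [g / b] to be bounded by 1, as [chernoff_tuple]
   demands. *)
pose b : R := k%:R + `|a| + g + 1.
have b0 : 0 < b by rewrite /b; have := normr_ge0 a; have : 0 <= k%:R :> R by []; lra.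
pose phi x := (clip k x - (a + g)) / b.
have mphi : measurable_fun setT phi.
  by apply: measurable_funM => //; exact: measurable_funB.
have clipk x : `|clip k x| <= k%:R.
  rewrite ler_norml /clip; have : 0 <= k%:R :> R by [].
  by case: (leP (L x) k%:R) => *; rewrite /Num.max; case: ifPn => *; lra.
have phi1 x : `|phi x| <= 1.
  rewrite normrM normfV (gtr0_norm b0) ler_pdivrMr// mul1r.
  apply: (le_trans (ler_normB _ _)); rewrite /b.
  have := ler_normD a g; rewrite (gtr0_norm g0); have := clipk x; lra.
have gb : 0 < g / b <= 1.
  rewrite divr_gt0//= ler_pdivrMr// mul1r /b.
  have := normr_ge0 a; have : 0 <= k%:R :> R by []; lra.
have iclip := integrable_bounded Q (mclip k) clipk.
have phig : (\int[Q]_x (phi x)%:E <= (- (g / b))%:E)%E.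
  rewrite (eq_integral (fun x => (b^-1)%:E * ((clip k x)%:E - (a + g)%:E))%E); last first.
    by move=> x _; rewrite /phi mulrC EFinM EFinB.
  have ic : Q.-integrable setT (cst (a + g)%:E) by exact: finite_measure_integrable_cst.
  rewrite integralZl//; last exact: integrableB.
  rewrite integralB_EFin// integral_cst//= probability_setT mule1.
  rewrite -mulNr mulrC EFinM lee_pmul2l ?lte_fin ?invr_gt0// EFinN.
  rewrite leeBlDr// -EFinD (le_trans (ltW ck))// lee_fin; lra.
have P1 : Pr (lim_sup_set
    (fun n => [set w | 0 <= \sum_(i < n) phi (y i w)])) = 0%E.
  apply: (@lim_sup_set_expR_decay _ _ _ _ _ 1 ((g / b) ^+ 2 / 8)).
  - by move=> n; apply: measurable_set_ler => //; exact: measurable_iid_sum.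
  - by rewrite divr_gt0// exprn_gt0//; case/andP: gb.
  - apply: nearW => n; rewrite mul1r.
    apply: (le_trans _ (@chernoff_tuple _ _ _ Q phi (g / b) n mphi phi1 gb phig)).
    rewrite (_ : [set w | _] = [set w |
        [set t : n.-tuple T | 0 <= \sum_(i < n) phi (tnth t i)] [tuple y i w | i < n]]).
      rewrite (iid_tuple_law hy)//; apply: measurable_set_ler => //.
      apply: measurable_sum => i; apply: measurableT_comp => //.
      exact: measurable_tnth.
    by apply/funext => w /=; under [in RHS]eq_bigr do rewrite tnth_mktuple.
have P2 : (Pr (\bigcup_n [set w | (n%:R * g < \sum_(i < n) excess k (y i w))%R]) <= e%:E)%E.
  have := iid_maximal (mexcess k) _ g0.
  move=> /(_ (fun x => _)) => h.
  rewrite -(@lee_pmul2l _ g%:E)// ?lte_fin//.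
  apply: (le_trans (h _)); first by move=> x; rewrite /excess le_max lexx.
  by apply: (le_trans (ltW zk)); rewrite -EFinM mulrC.
apply: (@le_trans _ _ (Pr (lim_sup_set (fun n => [set w | (0 <= \sum_(i < n) phi (y i w))%R])
   `|` \bigcup_n [set w | (n%:R * g < \sum_(i < n) excess k (y i w))%R]))%E).
  apply: le_measure; rewrite ?inE.
  - exact: mbad.
  - apply: measurableU.
      apply: bigcapT_measurable => n; apply: bigcup_measurable => j _.
      by apply: measurable_set_ler => //; exact: measurable_iid_sum.
    by apply: bigcupT_measurable => n; exact: mS.
  move=> w bw; have [[n nw]|h] := pselect (exists n,
      n%:R * g < \sum_(i < n) excess k (y i w)); first by right; exists n.
  left => N _; have [n Nn /= nL] := bw N I; exists n => //=.
  rewrite -mulr_suml mulr_ge0// ?invr_ge0 ?(ltW b0)//.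
  have hn : \sum_(i < n) excess k (y i w) <= n%:R * g.
    by rewrite leNgt; apply/negP => hn; apply: h; exists n.
  have : \sum_(i < n) L (y i w) <=
      \sum_(i < n) clip k (y i w) + \sum_(i < n) excess k (y i w).
    by rewrite -big_split/=; apply: ler_sum => i _; exact: L_le_clip_excess.
  rewrite sumrB sumr_const card_ord -[_ *+ n]mulr_natl.
  have etaE : eta = a + g + g by rewrite /g; lra.
  by rewrite etaE !mulrDr in nL *; lra.
apply: (le_trans (measureU2 _ _ _)).
- apply: bigcapT_measurable => n; apply: bigcup_measurable => j _.
  by apply: measurable_set_ler => //; exact: measurable_iid_sum.
- by apply: bigcupT_measurable => n; exact: mS.
by rewrite -[leRHS]add0e; apply: leeD => //; rewrite -P1.
Qed.

End one_sided_slln.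

(** * Integrals against densities *)

Section weighted_integral.
Context d d' (T : measurableType d) (T' : measurableType d') (R : realType).
Variables (mu : {measure set T -> \bar R}) (nu : {measure set T' -> \bar R}).
Variables (a : T -> T') (w : T -> R).
Hypotheses (ma : measurable_fun setT a) (mw : measurable_fun setT w)
  (w0 : forall x, 0 <= w x).
Local Open Scope ereal_scope.
Hypothesis nuE : forall A, measurable A ->
  nu A = \int[mu]_(x in a @^-1` A) (w x)%:E.

Let mwE : measurable_fun setT (EFin \o w).
Proof. exact/measurable_EFinP. Qed.

Import HBNNSimple.

Let integral_weighted_nnsfun (h : {nnsfun T' >-> R}) :
  \int[nu]_y (h y)%:E = \int[mu]_x ((h (a x))%:E * (w x)%:E).
Proof.
have mr r : measurable (a @^-1` (h @^-1` [set r])).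
  by rewrite -[X in measurable X]setTI; exact: ma.
have mind r : measurable_fun setT (fun x => (\1_(h @^-1` [set r]) (a x))%:E : \bar R).
  by apply/measurable_EFinP; apply: (measurableT_comp _ ma); exact: measurable_indic.
have h0 r y : 0 <= (r * \1_(h @^-1` [set r]) y)%:E.
  by rewrite EFinM nnfun_muleindic_ge0.
rewrite (eq_integral (fun y => \sum_(r \in range h)
    (r * \1_(h @^-1` [set r]) y)%:E)); last first.
  by move=> y _; rewrite fimfunE -fsumEFin.
rewrite ge0_integral_fsum//; last first.
  by move=> r; exact/measurable_EFinP/measurableT_comp.
rewrite (eq_integral (fun x => \sum_(r \in range h)
    ((r * \1_(h @^-1` [set r]) (a x))%:E * (w x)%:E))); last first.
  by move=> x _; rewrite fimfunE -fsumEFin// ge0_mule_fsuml.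
rewrite ge0_integral_fsum//; last 2 first.
- move=> r; apply: emeasurable_funM => //.
  apply/measurable_EFinP; apply: measurable_funM => //.
  by apply: (measurableT_comp _ ma); exact: measurable_indic.
- by move=> r x _; rewrite mule_ge0// lee_fin.
apply: eq_fsbigr => r _.
have [r0|r0] := leP 0%R r; last first.
  rewrite integral0_eq; last first.
    by move=> y _; rewrite preimage_nnfun0// indic0 mulr0.
  rewrite integral0_eq// => x _.
  by rewrite preimage_nnfun0// indic0 mulr0 mul0e.
under eq_integral do rewrite EFinM.
rewrite ge0_integralZl_EFin//; last first.
  by apply/measurable_EFinP; exact: measurable_indic.
rewrite integral_indic// setIT nuE//.
under [RHS]eq_integral do rewrite EFinM -muleA.
rewrite ge0_integralZl_EFin//; last 2 first.
- by move=> x _; rewrite mule_ge0// lee_fin.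
- by apply: emeasurable_funM.
congr (_ * _); rewrite integral_mkcond; apply: eq_integral => x _.
rewrite patchE indicE/= muleC.
have -> : (x \in a @^-1` (h @^-1` [set r])) = (a x \in h @^-1` [set r]).
  by apply/idP/idP; rewrite !inE.
by case: (a x \in _); rewrite ?mule1 ?mule0.
Qed.

(** Serves twice: with [a] the identity it is integration against [law f], and with [a] an inverse
    transformation and [w] its absolute derivative it is the change of variables. *)
Lemma integral_weighted (phi : T' -> \bar R) :
  measurable_fun setT phi -> (forall y, 0 <= phi y) ->
  \int[nu]_y phi y = \int[mu]_x (phi (a x) * (w x)%:E).
Proof.
move=> mphi phi0.
pose f_ := nnsfun_approx measurableT mphi.
have mf n : measurable_fun setT (fun y => (f_ n y)%:E) by exact/measurable_EFinP.
have ndf y : nondecreasing_seq (fun n => (f_ n y)%:E).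
  move=> i j ij; rewrite lee_fin; move: (nd_nnsfun_approx measurableT mphi ij).
  by move=> /lefP; apply.
transitivity (\int[nu]_z (lim ((f_ n z)%:E @[n --> \oo]))).
  by apply/eq_integral => z _; apply/esym/cvg_lim => //=; exact: cvg_nnsfun_approx.
rewrite monotone_convergence//; last by move=> n z _; rewrite lee_fin.
under eq_fun do rewrite integral_weighted_nnsfun.
rewrite -monotone_convergence//; last 3 first.
- move=> n; apply: emeasurable_funM => //; exact: (measurableT_comp (mf n) ma).
- by move=> n x _; rewrite mule_ge0// lee_fin.
- by move=> x _ i j ij; apply: lee_wpmul2r; [rewrite lee_fin|exact: ndf].
apply: eq_integral => x _; apply/cvg_lim => //.
by apply: cvgeZr => //; exact: cvg_nnsfun_approx.
Qed.

End weighted_integral.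

Section density_integral.
Context d (T : measurableType d) (R : realType) (m : {measure set T -> \bar R}).
Implicit Types f g : density m.
Local Open Scope ereal_scope.

Lemma integral_law f (phi : T -> \bar R) :
  measurable_fun setT phi -> (forall x, 0 <= phi x) ->
  \int[law f]_x phi x = \int[m]_x (phi x * (f x)%:E).
Proof.
move=> mphi phi0.
apply: (integral_weighted (a := idfun) (w := f)) => //.
- exact: measurable_id.
- exact: measurable_dens.
- exact: dens_ge0.
Qed.

Lemma L1distE f g : (L1dist f g)%:E = \int[m]_x `|f x - g x|%:E.
Proof.
rewrite /L1dist /Rintegral fineK//.
exact: integrable_fin_num (integrable_dist f g).
Qed.

Lemma L1dist_ge0 f g : (0 <= L1dist f g)%R.
Proof. by rewrite -lee_fin L1distE; apply: integral_ge0 => x _; rewrite lee_fin. Qed.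

Lemma L1distC f g : L1dist f g = L1dist g f.
Proof. by rewrite /L1dist; apply: eq_Rintegral => x _; rewrite distrC. Qed.

Lemma measurable_densE f : measurable_fun setT (fun x => (f x)%:E).
Proof. exact/measurable_EFinP/measurable_dens. Qed.

Lemma measurable_distE f g : measurable_fun setT (fun x => `|f x - g x|%:E).
Proof.
by apply/measurable_EFinP; apply: measurableT_comp => //;
  apply: measurable_funB; exact: measurable_dens.
Qed.

Lemma L1dist_triangle f g h : (L1dist f h <= L1dist f g + L1dist g h)%R.
Proof.
rewrite -lee_fin EFinD !L1distE -ge0_integralD//;
  [|exact: measurable_distE|exact: measurable_distE].
apply: ge0_le_integral => //; first exact: measurable_distE.
  by apply: emeasurable_funD; exact: measurable_distE.
by move=> x _; rewrite -EFinD lee_fin ler_distD.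
Qed.

Lemma integral_dens_le f g (phi : T -> R) : measurable_fun setT phi ->
  (forall x, (0 <= phi x <= 1)%R) ->
  \int[m]_x (phi x * f x)%:E <= \int[m]_x (phi x * g x)%:E + (L1dist f g)%:E.
Proof.
move=> mphi phi01; rewrite L1distE -ge0_integralD//.
- apply: ge0_le_integral => //.
  + by move=> x _; rewrite lee_fin mulr_ge0 ?dens_ge0//; case/andP: (phi01 x).
  + by apply/measurable_EFinP/measurable_funM => //; exact: measurable_dens.
  + apply: emeasurable_funD; last exact: measurable_distE.
    by apply/measurable_EFinP/measurable_funM => //; exact: measurable_dens.
  + move=> x _; rewrite -EFinD lee_fin; have /andP[p0 p1] := phi01 x.
    have := ler_norm (f x - g x)%R; have := normr_ge0 (f x - g x)%R; nra.
- by move=> x _; rewrite lee_fin mulr_ge0 ?dens_ge0//; case/andP: (phi01 x).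
- by apply/measurable_EFinP/measurable_funM => //; exact: measurable_dens.
- exact: measurable_distE.
Qed.

Lemma law_le f g (A : set T) : measurable A ->
  law f A <= law g A + (L1dist f g)%:E.
Proof.
have lawE (h : density m) : measurable A -> law h A = \int[m]_x (\1_A x * h x)%:E.
  move=> mA; transitivity (\int[law h]_x (\1_A x)%:E).
    by rewrite integral_indic// setIT.
  rewrite integral_law//.
  by apply/measurable_EFinP; exact: measurable_indic.
move=> mA; rewrite !lawE//; apply: integral_dens_le.
  exact: measurable_indic.
by move=> x; rewrite indicE ler0n lern1 leq_b1.
Qed.

Lemma iid_law_le1 f n (B : set (n.-tuple T)) : measurable B -> iid_law f n B <= 1.
Proof.
move=> mB; rewrite -(tuple_measure_setT (law f) n).
by apply: le_measure; rewrite ?inE.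
Qed.

Lemma iid_law_fin_num f n (B : set (n.-tuple T)) : measurable B ->
  iid_law f n B \is a fin_num.
Proof.
move=> mB; rewrite ge0_fin_numE//; apply: le_lt_trans (iid_law_le1 f mB) _.
exact: ltry.
Qed.

Lemma measurable_tcons_set n (B : set (n.+1.-tuple T)) x : measurable B ->
  measurable [set s | B (tcons (x, s))].
Proof.
move=> mB; rewrite -[X in measurable X]setTI.
by apply: (measurable_tcons_section x (f := idfun)) => //; exact: measurable_id.
Qed.

Lemma iid_law_section f n (B : set (n.+1.-tuple T)) x : measurable B ->
  iid_law f n [set s | B (tcons (x, s))] =
  \int[tuple_measure (law f) n]_s (\1_B (tcons (x, s)))%:E.
Proof.
move=> mB; rewrite -[X in iid_law f n X]setIT.
by rewrite -integral_indic//; exact: measurable_tcons_set.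
Qed.

Lemma iid_lawS f n (B : set (n.+1.-tuple T)) : measurable B ->
  iid_law f n.+1 B = \int[law f]_x iid_law f n [set s | B (tcons (x, s))].
Proof.
move=> mB; rewrite -[B in LHS]setIT -integral_indic//.
rewrite tuple_measure_integralS//; last first.
  by apply/measurable_EFinP; exact: measurable_indic.
by apply: eq_integral => x _; rewrite iid_law_section.
Qed.

Lemma measurable_iid_section f n (B : set (n.+1.-tuple T)) : measurable B ->
  measurable_fun setT (fun x => iid_law f n [set s | B (tcons (x, s))]).
Proof.
move=> mB; under eq_fun do rewrite iid_law_section//.
apply: (measurable_tcons_integral (law f) (f := fun t => (\1_B t)%:E)) => //.
by apply/measurable_EFinP; exact: measurable_indic.
Qed.

(** One coordinate is replaced at a time, each at the cost of one $L_1$ distance. This continuity is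
    what makes [iid_law f n B] a Borel function of [f], hence the integrals over the prior
    meaningful. *)
Lemma iid_law_lipschitz f g n (B : set (n.-tuple T)) : measurable B ->
  iid_law f n B <= iid_law g n B + (n%:R * L1dist f g)%:E.
Proof.
elim: n B => [|n IH] B mB.
  by rewrite mul0r adde0.
have mBx x := measurable_tcons_set x mB.
rewrite !iid_lawS//; have d0 := L1dist_ge0 f g.
have nd0 : 0 <= (n%:R * L1dist f g)%:E by rewrite lee_fin mulr_ge0.
apply: (@le_trans _ _ (\int[law f]_x (iid_law g n [set s | B (tcons (x, s))]
    + (n%:R * L1dist f g)%:E))).
  apply: ge0_le_integral => //.
  - exact: measurable_iid_section.
  - by apply: emeasurable_funD => //; exact: measurable_iid_section.
  - by move=> x _; exact: IH.
rewrite ge0_integralD//; last exact: measurable_iid_section.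
rewrite integral_cst//= (@probability_setT _ _ _ (law f)) mule1.
have -> : (n.+1%:R * L1dist f g)%:E = (L1dist f g)%:E + (n%:R * L1dist f g)%:E.
  by rewrite -EFinD -natr1 mulrDl mul1r addrC.
rewrite addeA leeD2r//.
have E (h : density m) : \int[law h]_x iid_law g n [set s | B (tcons (x, s))] =
    \int[m]_x (fine (iid_law g n [set s | B (tcons (x, s))]) * h x)%:E.
  rewrite integral_law//; last exact: measurable_iid_section.
  by apply: eq_integral => x _; rewrite EFinM fineK// iid_law_fin_num.
rewrite !E; apply: integral_dens_le.
  apply: (measurableT_comp (@fine_measurable R setT measurableT)).
  exact: measurable_iid_section.
move=> x; rewrite fine_ge0//= -lee_fin fineK ?iid_law_fin_num//.
exact: iid_law_le1.
Qed.

End density_integral.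

(** * Borel sets and functions on the space of densities *)

Section density_borel.
Context d (T : measurableType d) (R : realType) (m : {measure set T -> \bar R}).
Variable base : density m.
Implicit Types f g : density m.

Lemma open_densityP (A : set (dspace base)) :
  (forall f, A f -> exists2 e : R, 0 < e & forall g, L1dist f g < e -> A g) ->
  open A.
Proof.
move=> hA; rewrite openE => f /hA[e e0 fe].
by apply/nbhs_ballP; exists e => //= g; rewrite ball_L1E; exact: fe.
Qed.

Lemma measurable_open_density (A : set (borel_density base)) :
  (forall f, A f -> exists2 e : R, 0 < e & forall g, L1dist f g < e -> A g) ->
  measurable A.
Proof. by move=> hA; apply: sub_sigma_algebra; exact: open_densityP. Qed.

(** The sets where [F] exceeds a constant are open. *)
Lemma measurable_lipschitz (F : density m -> \bar R) (C : R) :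
  (forall f, F f \is a fin_num) ->
  (forall f g, F f <= F g + (C * L1dist f g)%:E)%E ->
  measurable_fun [set: borel_density base] (F : borel_density base -> \bar R).
Proof.
move=> Ffin FC.
rewrite (_ : F = EFin \o (fine \o F)); last first.
  by apply/funext => f /=; rewrite fineK.
apply/measurable_EFinP; apply: (measurability _ (RGenOInfty.measurableE R)).
move=> /= _ [_ [a ->] <-]; rewrite setTI.
apply: measurable_open_density => f /=; rewrite in_itv/= andbT => aF.
(* Positive whatever the sign of [C], so that the radius below is positive too. *)
pose D := `|C| + 1; have D0 : 0 < D by rewrite ltr_wpDl.
exists ((fine (F f) - a) / D); first by rewrite divr_gt0// subr_gt0.
move=> g; rewrite ltr_pdivlMr// => fg; rewrite in_itv/= andbT.
have := FC f g; rewrite -(fineK (Ffin f)) -(fineK (Ffin g)) -EFinD lee_fin.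
have := L1dist_ge0 f g; have := ler_norm C; rewrite /D in fg; nra.
Qed.

Lemma measurable_L1dist f0 :
  measurable_fun [set: borel_density base] (fun f : borel_density base => L1dist f f0).
Proof.
apply/measurable_EFinP; apply: (@measurable_lipschitz (fun f => (L1dist f f0)%:E) 1).
  by [].
by move=> f g; rewrite mul1r -EFinD lee_fin addrC L1dist_triangle.
Qed.

Lemma measurable_iid_law n (B : set (n.-tuple T)) : measurable B ->
  measurable_fun [set: borel_density base]
    (fun f : borel_density base => iid_law f n B).
Proof.
move=> mB; apply: (@measurable_lipschitz (fun f => iid_law f n B) n%:R).
  by move=> f; exact: iid_law_fin_num.
by move=> f g; exact: iid_law_lipschitz.
Qed.

End density_borel.

(** * Kullback-Leibler divergence and likelihood ratios *)

Lemma ln_sub_le (R : realType) (u v : R) : 0 < u -> 0 < v -> ln u - ln v <= (u - v) / v.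
Proof.
move=> u0 v0; rewrite -ln_div ?posrE//.
have -> : u / v = 1 + (u - v) / v by field; rewrite gt_eqF.
apply: le_ln1Dx; rewrite ltr_pdivlMr// mulN1r; lra.
Qed.

Section kullback_leibler.
Context d (T : measurableType d) (R : realType) (m : {measure set T -> \bar R}).
Variable f0 : density m.
Implicit Types f g : density m.
Local Open Scope ereal_scope.

Definition kl_integrand f (x : T) : \bar R :=
  (f0 x)%:E * lne ((f0 x)%:E / (f x)%:E).

Lemma kl_integrandE f x : kl_integrand f x =
  if (f0 x <= 0)%R then 0 else
  if (f x <= 0)%R then +oo else (f0 x * (ln (f0 x) - ln (f x)))%:E.
Proof.
rewrite /kl_integrand; case: leP => [f00|f00].
  have -> : f0 x = 0%R by apply/eqP; rewrite eq_le f00 dens_ge0.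
  by rewrite mul0e.
rewrite inver; case: leP => [fx|fx].
  have -> : f x = 0%R by apply/eqP; rewrite eq_le fx dens_ge0.
  by rewrite eqxx gt0_muley ?lte_fin//= gt0_muley ?lte_fin.
by rewrite gt_eqF// -EFinM lne_EFin ?divr_gt0// ln_div ?posrE// EFinM.
Qed.

Lemma measurable_kl_integrand f : measurable_fun setT (kl_integrand f).
Proof.
have mf g := measurable_dens (g : density m).
rewrite (_ : kl_integrand f = fun x => if (f0 x <= 0)%R then 0 else
  if (f x <= 0)%R then +oo else (f0 x * (ln (f0 x) - ln (f x)))%:E); last first.
  by apply/funext => x; rewrite kl_integrandE.
apply: measurable_fun_ifT => //; first exact: measurable_fun_ler.
apply: measurable_fun_ifT => //; first exact: measurable_fun_ler.
apply/measurable_EFinP; apply: measurable_funM => //.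
by apply: measurable_funB; apply: (measurableT_comp (@measurable_ln R)).
Qed.

(** Where both densities are positive, [ln_sub_le] bounds the integrand below by [f0 x - f x]. The
    integrable minorant makes the negative part of the integrand harmless. *)
Lemma kl_integrand_geN f x : - (f x)%:E <= kl_integrand f x.
Proof.
rewrite kl_integrandE; case: (leP (f0 x) 0%R) => [_|f00]; first by rewrite lee_fin oppr_le0 dens_ge0.
case: (leP (f x) 0%R) => [_|fx]; first by rewrite leey.
rewrite -EFinN lee_fin.
have := ln_sub_le fx f00; rewrite ler_pdivlMr//.
set a := ln _; set b := ln _; nra.
Qed.

Lemma kl_integrand_neg_le f x : (kl_integrand f)^\- x <= (f x)%:E.
Proof.
rewrite funenegE ge_max lee_fin dens_ge0 andbT leeNl.
exact: kl_integrand_geN.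
Qed.

(** Compensating the minorant makes the integrand nonnegative and shifts its integral by exactly 1,
    so that monotone convergence becomes available. *)
Definition kl_positive f (x : T) : \bar R := kl_integrand f x + (f x)%:E.

Lemma kl_positive_ge0 f x : 0 <= kl_positive f x.
Proof. by rewrite -leeBlDr// sub0e kl_integrand_geN. Qed.

Lemma KL_positive f : \int[m]_x kl_positive f x = KL f0 f + 1.
Proof.
have mk := measurable_kl_integrand f.
have mf := measurable_densE f.
have nfin x : (kl_integrand f)^\- x \is a fin_num.
  by rewrite ge0_fin_numE ?funeneg_ge0// (le_lt_trans (kl_integrand_neg_le f x)) ?ltry.
have d0 x : 0 <= (f x)%:E - (kl_integrand f)^\- x.
  by rewrite suber_ge0 ?nfin//; exact: kl_integrand_neg_le.
have md : measurable_fun setT (fun x => (f x)%:E - (kl_integrand f)^\- x).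
  by apply: emeasurable_funB => //; exact: measurable_funeneg.
rewrite (eq_integral (fun x => (kl_integrand f)^\+ x +
    ((f x)%:E - (kl_integrand f)^\- x))); last first.
  move=> x _; rewrite /kl_positive.
  have -> : kl_integrand f x = (kl_integrand f)^\+ x - (kl_integrand f)^\- x.
    exact: (congr1 (@^~ x) (funeposneg (kl_integrand f))).
  by rewrite -addeA (addeC (- _)).
rewrite ge0_integralD//; last exact: measurable_funepos.
have I1 : \int[m]_x (kl_integrand f)^\- x <= 1.
  rewrite -(integral_dens f); apply: ge0_le_integral => //.
    exact: measurable_funeneg.
  by move=> x _; exact: kl_integrand_neg_le.
have Ifin : \int[m]_x (kl_integrand f)^\- x \is a fin_num.
  by rewrite ge0_fin_numE ?(le_lt_trans I1) ?ltry//; exact: integral_ge0.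
have -> : \int[m]_x ((f x)%:E - (kl_integrand f)^\- x) =
    1 - \int[m]_x (kl_integrand f)^\- x.
  rewrite -(integral_dens f) [in RHS](eq_integral (fun x =>
      ((f x)%:E - (kl_integrand f)^\- x) + (kl_integrand f)^\- x)); last first.
    by move=> x _; rewrite subeK.
  rewrite [X in _ = X - _]ge0_integralD//; last exact: measurable_funeneg.
  by rewrite addeK.
rewrite [in RHS]/KL [X in _ = X + _]integralE -/(kl_integrand f).
by rewrite (addeC 1) addeA.
Qed.

(* Adding [f0 x / j.+1] to the argument of the logarithm makes the integrand of
   [KL f0 f + 1] Lipschitz in [f x]. *)
Let shift (j : nat) f (x : T) : R := (f x + f0 x / j.+1%:R)%R.

Let kl_trunc (j : nat) f (x : T) : R :=
  (if f0 x <= 0 then f x else f0 x * (ln (f0 x) - ln (shift j f x)) + f x)%R.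

Let shift_gt0 j f x : (0 < f0 x -> 0 < shift j f x)%R.
Proof. by move=> f00; rewrite ltr_wpDl ?dens_ge0// divr_gt0. Qed.

Let shift_ge j f x : (f0 x <= shift j f x * j.+1%:R)%R.
Proof. by rewrite mulrDl divfK ?pnatr_eq0// lerDr mulr_ge0 ?dens_ge0. Qed.

Let kl_trunc_ge0 j f x : (0 <= kl_trunc j f x)%R.
Proof.
rewrite /kl_trunc; case: (leP (f0 x) 0%R) => [_|f00]; first exact: dens_ge0.
have := ln_sub_le (shift_gt0 j f f00) f00; rewrite ler_pdivlMr//.
have : (shift j f x <= f x + f0 x)%R.
  by rewrite lerD2l ler_pdivrMr// ler_peMr ?ler1n ?ltW.
set a := ln _; set b := ln _; nra.
Qed.

Let kl_trunc_le j f x : (kl_trunc j f x <= j.+1%:R * f0 x + f x)%R.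
Proof.
rewrite /kl_trunc; case: (leP (f0 x) 0%R) => [_|f00].
  by rewrite lerDr mulr_ge0// dens_ge0.
rewrite lerD2r; have s0 := shift_gt0 j f f00.
apply: (le_trans (ler_wpM2l (ltW f00) (ln_sub_le f00 s0))).
rewrite mulrA ler_pdivrMr// mulrAC.
have := shift_ge j f x; have := s0; set s := shift j f x => s0' fs.
rewrite mulrC -mulrA (mulrC _ (f0 x)) mulrA; nra.
Qed.

(** As [shift j f x] is at least [f0 x / j.+1%:R], the logarithm multiplied by [f0 x] varies at rate
    at most [j.+1%:R]; the added [f x] contributes one more. *)
Let kl_trunc_lipschitz j f g x :
  (kl_trunc j f x <= kl_trunc j g x + j.+2%:R * `|f x - g x|)%R.
Proof.
have fg : (f x <= g x + `|f x - g x|)%R by have := ler_norm (f x - g x)%R; lra.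
have gf : (g x - f x <= `|f x - g x|)%R by rewrite distrC ler_norm.
have n0 := normr_ge0 (f x - g x)%R.
rewrite /kl_trunc -[j.+2%:R]natr1 mulrDl mul1r.
case: (leP (f0 x) 0%R) => [_|f00].
  have : (0 <= j.+1%:R * `|f x - g x|)%R by rewrite mulr_ge0.
  lra.
have sf := shift_gt0 j f f00; have sg := shift_gt0 j g f00.
suff : (f0 x * (ln (shift j g x) - ln (shift j f x)) <= j.+1%:R * `|f x - g x|)%R.
  lra.
apply: (le_trans (ler_wpM2l (ltW f00) (ln_sub_le sg sf))).
have -> : (shift j g x - shift j f x = g x - f x)%R.
  by rewrite /shift opprD addrACA subrr addr0.
rewrite mulrA ler_pdivrMr//.
have := shift_ge j f x; set s := shift j f x in sf *; set N := j.+1%:R => h.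
have N0 : (0 <= N)%R by [].
apply: (@le_trans _ _ (f0 x * `|f x - g x|)%R); first by apply: ler_wpM2l => //; exact: ltW.
by rewrite (mulrC N) -mulrA mulrC ler_wpM2l// mulrC.
Qed.

Let measurable_kl_trunc j f : measurable_fun setT (kl_trunc j f).
Proof.
have mf g := measurable_dens (g : density m).
apply: measurable_fun_ifT => //; first exact: measurable_fun_ler.
apply: measurable_funD => //; apply: measurable_funM => //.
apply: measurable_funB; apply: (measurableT_comp (@measurable_ln R)) => //.
by apply: measurable_funD => //; exact: measurable_funM.
Qed.

Let kl_trunc_nd f x : nondecreasing_seq (fun j => (kl_trunc j f x)%:E).
Proof.
move=> i j ij; rewrite lee_fin /kl_trunc; case: (leP (f0 x) 0%R) => // f00.
rewrite lerD2r; apply: ler_wpM2l; first exact: ltW.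
rewrite lerD2l lerN2 ler_ln ?posrE ?shift_gt0//.
rewrite /shift lerD2l; apply: ler_wpM2l; first exact: ltW.
by rewrite lef_pV2 ?posrE// ler_nat.
Qed.

Let kl_trunc_cvg f x :
  (fun j => (kl_trunc j f x)%:E) @ \oo --> kl_positive f x.
Proof.
rewrite /kl_positive kl_integrandE /kl_trunc.
case: (leP (f0 x) 0%R) => [_|f00]; first by rewrite add0e; exact: cvg_cst.
have shift_cvg : shift j f x @[j --> \oo] --> f x.
  rewrite -[X in _ --> X]addr0; apply: cvgD; first exact: cvg_cst.
  rewrite -[X in _ --> X](mulr0 (f0 x)); apply: cvgM; first exact: cvg_cst.
  exact: cvg_harmonic.
case: (leP (f x) 0%R) => [fx|fx]; last first.
  rewrite -EFinD; apply: cvg_EFin; first exact: nearW.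
  apply: cvgD; last exact: cvg_cst.
  apply: cvgM; first exact: cvg_cst.
  apply: cvgB; first exact: cvg_cst.
  by apply: (cvg_comp _ _ shift_cvg); exact: continuous_ln.
(* Here [shift j f x] is [f0 x / j.+1%:R], so the truncation is [f0 x] times the logarithm of
   [j.+1%:R], which diverges. *)
have fx0 : f x = 0%R by apply/eqP; rewrite eq_le fx dens_ge0.
rewrite fx0 addye//; apply/cvgeyPge => A.
have [N _ hN] : \forall n \near \oo, (expR (A / f0 x) <= n%:R)%R.
  exact: nbhs_infty_ger.
exists N => // j /= Nj; rewrite lee_fin addr0 -ler_pdivrMl// mulrC.
rewrite -ln_div ?posrE ?shift_gt0// /shift fx0 add0r.
rewrite invfM invrK mulrA divff ?gt_eqF// mul1r -[leLHS]expRK.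
rewrite ler_ln ?posrE ?expR_gt0// (le_trans (hN j Nj))// ler_nat.
exact: leqnSn.
Qed.

Variable base : density m.

(** After the shift by 1, the divergence is the increasing limit of $L_1$-Lipschitz functionals of
    [f]. *)
Lemma measurable_KL : measurable_fun [set: borel_density base]
  (fun f : borel_density base => KL f0 f).
Proof.
suff : measurable_fun [set: borel_density base]
    (fun f : borel_density base => \int[m]_x kl_positive f x).
  move=> h; rewrite (_ : (fun _ => _) =
      (fun f : borel_density base => (\int[m]_x kl_positive f x) - 1)).
    by apply: emeasurable_funB => //; exact: measurable_cst.
  by apply/funext => f; rewrite KL_positive addeK.
apply: (@emeasurable_fun_cvg _ _ _ _
  (fun j (f : borel_density base) => \int[m]_x (kl_trunc j f x)%:E)); last first.
  move=> f _; have -> : \int[m]_x kl_positive f x =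
      \int[m]_x limn (fun j => (kl_trunc j f x)%:E).
    by apply: eq_integral => x _; apply/esym/cvg_lim => //; exact: kl_trunc_cvg.
  apply: cvg_monotone_convergence => //.
  - by move=> j; apply/measurable_EFinP; exact: measurable_kl_trunc.
  - by move=> j x _; rewrite lee_fin; exact: kl_trunc_ge0.
move=> j; apply: (@measurable_lipschitz _ _ _ _ base
  (fun f => \int[m]_x (kl_trunc j f x)%:E) j.+2%:R).
  move=> f; rewrite ge0_fin_numE; last first.
    by apply: integral_ge0 => x _; rewrite lee_fin; exact: kl_trunc_ge0.
  apply: (@le_lt_trans _ _ (\int[m]_x ((j.+1%:R)%:E * (f0 x)%:E + (f x)%:E))).
    apply: ge0_le_integral => //.
    - by move=> x _; rewrite lee_fin; exact: kl_trunc_ge0.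
    - by apply/measurable_EFinP; exact: measurable_kl_trunc.
    - apply: emeasurable_funD; last exact: measurable_densE.
      by apply: emeasurable_funM => //; exact: measurable_densE.
    - by move=> x _; rewrite -EFinM -EFinD lee_fin; exact: kl_trunc_le.
  rewrite ge0_integralD//; last 4 first.
  - by move=> x _; rewrite mule_ge0// lee_fin dens_ge0.
  - by apply: emeasurable_funM => //; exact: measurable_densE.
  - by move=> x _; rewrite lee_fin dens_ge0.
  - exact: measurable_densE.
  rewrite ge0_integralZl_EFin//; last 2 first.
  - by move=> x _; rewrite lee_fin dens_ge0.
  - exact: measurable_densE.
  by rewrite !integral_dens mule1 -EFinD ltry.
move=> f g; rewrite EFinM L1distE -ge0_integralZl_EFin//; last exact: measurable_distE.
rewrite -ge0_integralD//; last 3 first.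
- by move=> x _; rewrite lee_fin; exact: kl_trunc_ge0.
- by apply/measurable_EFinP; exact: measurable_kl_trunc.
- by apply: emeasurable_funM => //; exact: measurable_distE.
apply: ge0_le_integral => //.
- by move=> x _; rewrite lee_fin; exact: kl_trunc_ge0.
- by apply/measurable_EFinP; exact: measurable_kl_trunc.
- apply: emeasurable_funD.
    by apply/measurable_EFinP; exact: measurable_kl_trunc.
  by apply: emeasurable_funM => //; exact: measurable_distE.
- by move=> x _; rewrite -EFinM -EFinD lee_fin; exact: kl_trunc_lipschitz.
Qed.

End kullback_leibler.

Section likelihood_ratio.
Context d (T : measurableType d) (R : realType) (m : {measure set T -> \bar R}).
Variables (f0 f : density m).
Local Open Scope ereal_scope.

(** The default 0 makes it real-valued. Where [f0] vanishes, [law f0] does not see it; the points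
    where [f] vanishes but [f0] does not are negligible as soon as the divergence is finite. *)
Definition llr (x : T) : R :=
  (if (0 < f0 x) && (0 < f x) then ln (f0 x) - ln (f x) else 0)%R.

Lemma measurable_llr : measurable_fun setT llr.
Proof.
have mf g := measurable_dens (g : density m).
apply: measurable_fun_ifT => //.
  by apply: measurable_and; exact: measurable_fun_ltr.
by apply: measurable_funB; apply: (measurableT_comp (@measurable_ln R)).
Qed.

Let k := kl_integrand f0 f.

Let llr_pos_le x : (Num.max (llr x) 0 * f0 x)%:E <= k^\+ x.
Proof.
rewrite funeposE /k kl_integrandE /llr.
have [f00|f00] /= := leP (f0 x) 0%R.
  have -> : f0 x = 0%R by apply/eqP; rewrite eq_le f00 dens_ge0.
  by rewrite mulr0 maxxx.
have [fx|fx] /= := leP (f x) 0%R.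
  by rewrite maxxx mul0r le_max lexx orbT.
by rewrite -EFin_max lee_fin (maxr_pMl _ _ (ltW f00)) mul0r mulrC.
Qed.

Let llr_neg_eq x : (Num.max (- llr x) 0 * f0 x)%:E = k^\- x.
Proof.
rewrite funenegE /k kl_integrandE /llr.
have [f00|f00] /= := leP (f0 x) 0%R.
  have -> : f0 x = 0%R by apply/eqP; rewrite eq_le f00 dens_ge0.
  by rewrite mulr0 oppr0 maxxx.
have [fx|fx] /= := leP (f x) 0%R.
  by rewrite oppr0 maxxx mul0r/= max_r ?leNye.
by rewrite -EFin_max (maxr_pMl _ _ (ltW f00)) mul0r mulNr mulrC.
Qed.

Let mE (phi : T -> R) : measurable_fun setT phi ->
  measurable_fun setT (fun x => (Num.max (phi x) 0)%:E).
Proof. by move=> mphi; apply/measurable_EFinP; exact: measurable_maxr. Qed.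

Let int_pos : \int[law f0]_x (Num.max (llr x) 0)%:E <= \int[m]_x k^\+ x.
Proof.
have mp := mE measurable_llr.
rewrite integral_law//; last by move=> x; rewrite lee_fin le_max lexx orbT.
apply: ge0_le_integral => //.
- by move=> x _; rewrite -EFinM lee_fin mulr_ge0 ?dens_ge0// le_max lexx orbT.
- by apply: emeasurable_funM => //; exact: measurable_densE.
- by apply: measurable_funepos; exact: measurable_kl_integrand.
- by move=> x _; rewrite -EFinM.
Qed.

Let int_neg : \int[law f0]_x (Num.max (- llr x) 0)%:E = \int[m]_x k^\- x.
Proof.
have mp : measurable_fun setT (fun x => (Num.max (- llr x) 0)%:E : \bar R).
  by apply: mE; apply: measurableT_comp => //; exact: measurable_llr.
rewrite integral_law//; last by move=> x; rewrite lee_fin le_max lexx orbT.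
by apply: eq_integral => x _; rewrite -EFinM.
Qed.

Let llr_posE : (EFin \o llr)^\+ = (fun x => (Num.max (llr x) 0)%:E).
Proof. by apply/funext => x; rewrite funeposE EFin_max. Qed.

Let llr_negE : (EFin \o llr)^\- = (fun x => (Num.max (- llr x) 0)%:E).
Proof. by apply/funext => x; rewrite funenegE EFin_max. Qed.

(** Only an inequality, since finiteness is not assumed yet: where [f] vanishes and [f0] does not,
    [llr] is 0 but the integrand of [KL] is infinite. *)
Lemma integral_llr_le : \int[law f0]_x (llr x)%:E <= KL f0 f.
Proof.
rewrite integralE llr_posE llr_negE /KL [leRHS]integralE -/(kl_integrand f0 f).
by rewrite int_neg leeD2r// int_pos.
Qed.

Hypothesis KLoo : KL f0 f < +oo.

Let ik : m.-integrable setT k.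
Proof.
have mk := measurable_kl_integrand f0 f.
apply/integrableP; split=> //.
apply: (@le_lt_trans _ _ (\int[m]_x (kl_positive f0 f x + (f x)%:E))).
  apply: ge0_le_integral => //.
  - exact: measurableT_comp.
  - by apply: emeasurable_funD; [apply: emeasurable_funD => //|];
      exact: measurable_densE.
  move=> x _.
  have -> : k x = kl_positive f0 f x - (f x)%:E by rewrite addeK.
  by rewrite (le_trans (lee_abs_sub _ _))// !gee0_abs ?kl_positive_ge0 ?lee_fin ?dens_ge0.
rewrite ge0_integralD//; last 4 first.
- by move=> x _; exact: kl_positive_ge0.
- by apply: emeasurable_funD => //; exact: measurable_densE.
- by move=> x _; rewrite lee_fin dens_ge0.
- exact: measurable_densE.
by rewrite KL_positive integral_dens lte_add_pinfty ?ltry// lte_add_pinfty ?ltry.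
Qed.

Lemma integrable_llr : (law f0).-integrable setT (EFin \o llr).
Proof.
have mp := mE measurable_llr.
have mn : measurable_fun setT (fun x => (Num.max (- llr x) 0)%:E : \bar R).
  by apply: mE; apply: measurableT_comp => //; exact: measurable_llr.
apply/integrableP; split; first by apply/measurable_EFinP; exact: measurable_llr.
rewrite (eq_integral (fun x =>
    (Num.max (llr x) 0)%:E + (Num.max (- llr x) 0)%:E)); last first.
  move=> x _; rewrite -EFinD /=; congr (_%:E).
  by case: (leP (llr x) 0%R) => h; rewrite ?(ler0_norm h) ?(gtr0_norm h);
    [rewrite max_l ?oppr_ge0// add0r|rewrite max_r ?oppr_le0 ?ltW// addr0].
rewrite ge0_integralD//; last 2 first.
- by move=> x _; rewrite lee_fin le_max lexx orbT.
- by move=> x _; rewrite lee_fin le_max lexx orbT.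
apply: lte_add_pinfty.
  by apply: (le_lt_trans int_pos); exact: integral_funepos_lt_pinfty.
by rewrite int_neg; exact: integral_funeneg_lt_pinfty.
Qed.

(** An integrable function is finite almost everywhere, which excludes the points where [f] vanishes
    and [f0] does not; elsewhere this is an equality, or [f0] vanishes. *)
Let dens_le_llr : {ae m, forall x, (f0 x <= expR (llr x) * f x)%R}.
Proof.
have := integrable_ae measurableT ik; apply: filterS => x /(_ I).
rewrite /k kl_integrandE /llr.
have [f00|f00] /= := leP (f0 x) 0%R.
  by rewrite (le_trans f00)// mulr_ge0 ?expR_ge0 ?dens_ge0.
have [//|fx] /= := leP (f x) 0%R => _.
by rewrite expRB !lnK ?posrE// divfK ?gt_eqF.
Qed.

Let law_le_llr (phi : T -> \bar R) : measurable_fun setT phi ->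
  (forall x, 0 <= phi x) ->
  \int[law f0]_x (phi x * 1%:E) <= \int[law f]_x (phi x * (expR (llr x))%:E).
Proof.
move=> mphi phi0.
have me : measurable_fun setT (fun x => (expR (llr x))%:E).
  apply/measurable_EFinP; apply: measurableT_comp => //; exact: measurable_llr.
have -> : \int[law f0]_x (phi x * 1%:E) = \int[law f0]_x phi x.
  by apply: eq_integral => x _; rewrite mule1.
rewrite integral_law// integral_law//; last 2 first.
- exact: emeasurable_funM.
- by move=> x; rewrite mule_ge0// lee_fin expR_ge0.
apply: ae_ge0_le_integral => //.
- by move=> x _; rewrite mule_ge0// lee_fin dens_ge0.
- by apply: emeasurable_funM => //; exact: measurable_densE.
- by move=> x _; rewrite !mule_ge0// lee_fin ?dens_ge0 ?expR_ge0.
- apply: emeasurable_funM; last exact: measurable_densE.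
  exact: emeasurable_funM.
move: dens_le_llr; apply: filterS => x h _.
by rewrite -muleA lee_wpmul2l// -EFinM lee_fin.
Qed.

(** Change of measure from [f] to [f0] on samples, by [tuple_measure_transport_le] with identity
    maps; on [B] the product of likelihood ratios is at most [expR c]. *)
Lemma iid_law_likelihood n (B : set (n.-tuple T)) (c : R) : measurable B ->
  (forall t, B t -> (\sum_(i < n) llr (tnth t i) <= c)%R) ->
  iid_law f0 n B <= (expR c)%:E * iid_law f n B.
Proof.
move=> mB Bc.
have mI : measurable_fun setT (fun t => (\1_B t)%:E : \bar R).
  by apply/measurable_EFinP; exact: measurable_indic.
have me : measurable_fun setT (expR \o llr).
  by apply: measurableT_comp => //; exact: measurable_llr.
have := @tuple_measure_transport_le _ _ T T R (law f0) (law f) n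
  (fun=> idfun) (fun=> cst 1%R) (fun=> expR \o llr) (fun=> @measurable_id _ _ _)
  (fun=> @measurable_cst _ _ _ _ _ _) (fun _ _ => ler01) (fun=> me)
  (fun _ _ => expR_ge0 _) (fun _ => law_le_llr) (fun t => (\1_B t)%:E) mI.
move=> /(_ (fun t => ltac:(by rewrite lee_fin))) h.
have -> : iid_law f0 n B = \int[tuple_measure (law f0) n]_t ((\1_B
    [tuple idfun (tnth t i) | i < n])%:E * (\prod_(i < n) cst 1%R (tnth t i))%:E).
  rewrite -[B in LHS]setIT -integral_indic//; apply: eq_integral => t _.
  rewrite big1// mule1; congr (\1_B _)%:E.
  by apply: eq_from_tnth => i; rewrite tnth_mktuple.
apply: (le_trans h).
rewrite -[B in leRHS]setIT -integral_indic// -ge0_integralZl_EFin//.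
apply: ge0_le_integral => //.
- by move=> t _; rewrite mule_ge0// lee_fin prodr_ge0// => i _; exact: expR_ge0.
- apply: emeasurable_funM => //; apply/measurable_EFinP.
  exact: (measurable_prod_tnth (w := fun=> expR \o llr)).
- exact: emeasurable_funM.
move=> t _; rewrite -!EFinM lee_fin indicE; case: (boolP (t \in B)) => tB.
  rewrite mul1r mulr1 -expR_sum ler_expR; apply: Bc; exact: set_mem.
by rewrite mul0r mulr0.
Qed.

End likelihood_ratio.

(** * Posterior probabilities *)

Lemma ge0_markov d (T : measurableType d) (R : realType)
    (mu : {measure set T -> \bar R}) (F : T -> \bar R) (a : R) :
  measurable_fun setT F -> (forall x, 0 <= F x)%E -> 0 <= a ->
  (a%:E * mu [set x | (a%:E < F x)%E] <= \int[mu]_x F x)%E.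
Proof.
move=> mF F0 a0.
have mS : measurable [set x | (a%:E < F x)%E] by exact: measurable_set_lte.
rewrite -[X in mu X]setIT -integral_indic// -ge0_integralZl_EFin//; last first.
  by apply/measurable_EFinP; exact: measurable_indic.
apply: ge0_le_integral => //.
- by move=> x _; rewrite mule_ge0// lee_fin.
- by apply: emeasurable_funM => //; apply/measurable_EFinP; exact: measurable_indic.
move=> x _; rewrite indicE; case: (boolP (x \in _)); last by rewrite mule0.
by rewrite inE /= mule1 => /ltW.
Qed.

Section posterior_consistency.
Context d (T : measurableType d) (R : realType) (m : {measure set T -> \bar R}).
Variables (base : density m) (P : probability (borel_density base) R).
Variables (f0 : density m) (hf0 : KL_support P f0).
Context d' (W : measurableType d') (Pr : probability W R) (y : nat -> W -> T).
Hypothesis hy : iid_from Pr f0 y.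

Let sample n w := [tuple y i w | i < n].

Let measurable_sample_set n (B : set (n.-tuple T)) : measurable B ->
  measurable [set w | B (sample n w)].
Proof.
by move=> mB; rewrite -[X in measurable X]setTI; exact: (measurable_iid_tuple hy).
Qed.

(* If the marginal law of the data gives exponentially small mass to [B n], then
   so does the law of the data given some [f] close to [f0]; the likelihood ratio
   of [f0] to [f] grows too slowly to compensate for it. *)
Lemma marginal_exp_small (B : forall n, set (n.-tuple T)) (C c : R) :
  (forall n, measurable (B n)) -> 0 < c ->
  (\forall n \near \oo,
    (\int[P]_f iid_law (f : density m) n (B n) <= (C * expR (- (n%:R * c)))%:E)%E) ->
  Pr (lim_sup_set (fun n => [set w | B n (sample n w)])) = 0%E.
Proof.
move=> mB c0 PB.
(* The rate [c] is spent as follows: Markov's inequality under [P] leaves rate [c / 2] for the laws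
   from [f], the likelihood ratio costs [c / 4], and [c / 4] remains. *)
have c4 : 0 < c / 4 by rewrite divr_gt0.
have mKL := @measurable_KL _ _ _ _ f0 base.
pose D := [set f : borel_density base | (KL f0 (f : density m) < (c / 4)%:E)%E].
have mD : measurable D by exact: measurable_set_lte.
have PD : (0 < P D)%E by exact: hf0.
pose E n := [set f : borel_density base |
  ((expR (- (n%:R * (c / 2))))%:E < iid_law (f : density m) n (B n))%E].
have mE n : measurable (E n).
  by apply: measurable_set_lte => //; exact: measurable_iid_law.
have PE : P (lim_sup_set E) = 0%E.
  apply: (@lim_sup_set_expR_decay _ _ _ P _ C (c / 2)) => //.
    by rewrite divr_gt0.
  apply: filterS PB => n Pn.
  rewrite -(@lee_pmul2l _ (expR (- (n%:R * (c / 2))))%:E)//; last first.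
    by rewrite lte_fin expR_gt0.
  apply: (le_trans (ge0_markov _ _ _ (expR_ge0 _))).
  - exact: measurable_iid_law.
  - by [].
  apply: (le_trans Pn); rewrite -EFinM lee_fin mulrCA -expRD.
  by have -> : - (n%:R * (c / 2)) - n%:R * (c / 2) = - (n%:R * c) by field.
(* A set of positive mass is not contained in a null set: this yields one density close to [f0]
   under which [B n] is eventually small. *)
have [f [Df fE]] : exists f, D f /\ ~ lim_sup_set E f.
  apply: contrapT => h; suff : (P D <= P (lim_sup_set E))%E by rewrite PE leNgt PD.
  apply: le_measure; rewrite ?inE//.
    by apply: bigcapT_measurable => n; apply: bigcup_measurable => j _.
  by move=> f Df; apply: contrapT => fE; apply: h; exists f.
have KLoo : (KL f0 (f : density m) < +oo)%E by exact: lt_le_trans Df (leey _).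
have [N hN] : exists N, forall n, (N <= n)%N ->
    (iid_law (f : density m) n (B n) <= (expR (- (n%:R * (c / 2))))%:E)%E.
  apply: contrapT => h; apply: fE => N _; apply: contrapT => h'; apply: h.
  exists N => n Nn; rewrite leNgt; apply/negP => hn; apply: h'.
  by exists n.
pose L := llr f0 f; have mL : measurable_fun setT L by exact: measurable_llr.
pose G n := [set t : n.-tuple T | \sum_(i < n) L (tnth t i) <= n%:R * (c / 4)].
have mG n : measurable (G n).
  apply: measurable_set_ler => //; apply: measurable_sum => i.
  by apply: measurableT_comp => //; exact: measurable_tnth.
have slln : Pr (lim_sup_set
    (fun n => [set w | n%:R * (c / 4) < \sum_(i < n) L (y i w)])) = 0%E.
  apply: (one_sided_slln hy) => //; first exact: integrable_llr.
  by apply: (le_lt_trans (integral_llr_le _ _)); exact: Df.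
have BG : Pr (lim_sup_set (fun n => [set w | (B n `&` G n) (sample n w)])) = 0%E.
  apply: (@lim_sup_set_expR_decay _ _ _ Pr _ 1 (c / 4)) => //.
    by move=> n; apply: measurable_sample_set; exact: measurableI.
  exists N => // n /= Nn.
  rewrite [leLHS](_ : _ = iid_law f0 n (B n `&` G n)); last first.
    by apply: (iid_tuple_law hy (A := B n `&` G n)); exact: measurableI.
  apply: (le_trans (iid_law_likelihood (f := f) (c := n%:R * (c / 4)) _ _ _)) => //.
  - exact: measurableI.
  - by move=> t [].
  apply: (@le_trans _ _ ((expR (n%:R * (c / 4)))%:E *
      (expR (- (n%:R * (c / 2))))%:E)%E).
    apply: lee_wpmul2l; first by rewrite lee_fin expR_ge0.
    apply: le_trans (hN n Nn); apply: le_measure; rewrite ?inE//.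
      by apply: measurableI; [exact: mB|exact: mG].
    exact: mB.
  rewrite -EFinM lee_fin -expRD mul1r ler_expR; lra.
have mlim (F : nat -> set W) : (forall n, measurable (F n)) ->
    measurable (lim_sup_set F).
  by move=> mF; apply: bigcapT_measurable => n; exact: bigcup_measurable.
have mS n : measurable [set w | n%:R * (c / 4) < \sum_(i < n) L (y i w)].
  by apply: measurable_set_ltr => //; exact: (measurable_iid_sum hy).
have mBG n : measurable [set w | (B n `&` G n) (sample n w)].
  by apply: measurable_sample_set; exact: measurableI.
apply/eqP; rewrite eq_le measure_ge0 andbT.
apply: (@le_trans _ _ (Pr (lim_sup_set (fun n => [set w | (B n `&` G n) (sample n w)])
  `|` lim_sup_set
    (fun n => [set w | (n%:R * (c / 4) < \sum_(i < n) L (y i w))%R])))%E).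
  apply: le_measure; rewrite ?inE.
  - by apply: mlim => n; exact: measurable_sample_set.
  - by apply: measurableU; exact: mlim.
  move=> w Bw; have [h|h] := pselect (lim_sup_set
      (fun n => [set w | n%:R * (c / 4) < \sum_(i < n) L (y i w)]) w).
    by right.
  left => j _.
  have [k hk] : exists k, forall n, (k <= n)%N ->
      \sum_(i < n) L (y i w) <= n%:R * (c / 4).
    apply: contrapT => h1; apply: h => k _; apply: contrapT => h2; apply: h1.
    exists k => n kn; rewrite leNgt; apply/negP => hn; apply: h2.
    by exists n.
  have [n nk Bn] := Bw (maxn j k) I.
  exists n; first by move: nk => /=; rewrite geq_max => /andP[].
  split => //; rewrite /G/=; under eq_bigr do rewrite tnth_mktuple.
  by apply: hk; move: nk => /=; rewrite geq_max => /andP[].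
apply: (le_trans (measureU2 _ _ _)); [exact: mlim|exact: mlim|].
rewrite -[leRHS]adde0; apply: leeD; rewrite le_eqVlt; apply/orP; left; apply/eqP.
  exact: BG.
exact: slln.
Qed.

Variable K : forall n : nat, R.-pker (n.-tuple T) ~> borel_density base.
Hypothesis hK : forall n : nat, is_posterior P (K n).

(** What is left of Bayes' formula: the identity of [is_posterior] writes the right side as the mean
    of [K n t A] over [S] under the marginal law of the sample, and Markov's inequality applies. *)
Lemma marginal_posterior_le n (A : set (borel_density base)) (S : set (n.-tuple T))
    (e : R) : measurable A -> measurable S -> 0 <= e ->
  (e%:E * \int[P]_f iid_law (f : density m) n (S `&` [set t | (e%:E < K n t A)%E])
    <= \int[P]_(f in A) iid_law (f : density m) n S)%E.
Proof.
move=> mA mS e0; rewrite [leRHS]hK//.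
have mKA : measurable_fun setT (fun t => K n t A) by exact: (measurable_kernel (K n) A mA).
have mB : measurable (S `&` [set t | (e%:E < K n t A)%E]).
  by apply: measurableI => //; exact: measurable_set_lte.
have mSK : measurable_fun setT ((fun t => K n t A) \_ S).
  by apply/(measurable_restrictT _ mS); exact: measurable_funTS.
rewrite -ge0_integralZl_EFin//; last exact: measurable_iid_law.
apply: ge0_le_integral => //.
- by move=> f _; rewrite mule_ge0.
- by apply: emeasurable_funM => //; exact: measurable_iid_law.
- under eq_fun do rewrite integral_mkcond.
  apply: (@measurable_fun_integral_kernel _ _ (borel_density base) _ R
    (fun f => iid_law (f : density m) n)) => //.
    by move=> U mU; exact: measurable_iid_law.
  by move=> t; exact: erestrict_ge0.
move=> f _; rewrite integral_mkcond -[X in iid_law _ _ X]setIT.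
rewrite -integral_indic// -ge0_integralZl_EFin//; last first.
  by apply/measurable_EFinP; exact: measurable_indic.
apply: ge0_le_integral => //.
- by move=> t _; rewrite mule_ge0// lee_fin.
- by apply: emeasurable_funM => //; apply/measurable_EFinP; exact: measurable_indic.
move=> t _; rewrite indicE patchE; case: (boolP (t \in _ `&` _)).
  by rewrite inE => -[St] /= /ltW; rewrite mem_set// mule1.
by move=> _; rewrite mule0; case: ifP.
Qed.

(** For each [k], the samples outside [C n] where the posterior mass of [A] exceeds [k.+1%:R^-1]
    have exponentially small marginal probability, hence almost surely occur finitely often under
    [f0]; so do the samples in [C n]. Countably many [k] are enough for convergence to 0. *)
Lemma posterior_cvg0 (A : set (borel_density base)) (C : forall n, set (n.-tuple T))
    (C0 c : R) : measurable A -> (forall n, measurable (C n)) -> 0 < c ->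
  (\forall n \near \oo,
    (iid_law f0 n (C n) <= (C0 * expR (- (n%:R * c)))%:E)%E /\
    (\int[P]_(f in A) iid_law (f : density m) n (~` C n)
      <= (C0 * expR (- (n%:R * c)))%:E)%E) ->
  {ae Pr, forall w, K n (sample n w) A @[n --> \oo] --> 0%E}.
Proof.
move=> mA mC c0 CA.
have mKA n : measurable_fun setT (fun t => K n t A) by exact: (measurable_kernel (K n) A mA).
pose B k n := ~` C n `&` [set t | (k.+1%:R^-1%:E < K n t A)%E].
have mB k n : measurable (B k n).
  apply: measurableI; first by apply: measurableC; exact: mC.
  by apply: measurable_set_lte => //; exact: mKA.
have Bk k : Pr (lim_sup_set (fun n => [set w | B k n (sample n w)])) = 0%E.
  apply: (@marginal_exp_small _ (k.+1%:R * C0) c) => //.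
  apply: filterS CA => n [_ h].
  rewrite -mulrA EFinM -lee_pdivrMl// ?ltr0n//.
  apply: le_trans h; apply: marginal_posterior_le => //.
  by apply: measurableC; exact: mC.
have Ck : Pr (lim_sup_set (fun n => [set w | C n (sample n w)])) = 0%E.
  apply: (@lim_sup_set_expR_decay _ _ _ Pr _ C0 c) => //.
    by move=> n; exact: measurable_sample_set.
  apply: filterS CA => n [h _]; apply: le_trans h.
  by rewrite -(iid_tuple_law hy).
have mlim (F : nat -> set W) : (forall n, measurable (F n)) ->
    measurable (lim_sup_set F).
  by move=> mF; apply: bigcapT_measurable => n; exact: bigcup_measurable.
pose LB k := lim_sup_set (fun n => [set w | B k n (sample n w)]).
have mLB k : measurable (LB k) by apply: mlim => n; exact: measurable_sample_set.
pose LC := lim_sup_set (fun n => [set w | C n (sample n w)]).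
have mLC : measurable LC by apply: mlim => n; exact: measurable_sample_set.
have mULB : measurable (\bigcup_k LB k) by exact: bigcupT_measurable.
exists (LC `|` \bigcup_k LB k); split; first exact: measurableU.
  apply/eqP; rewrite eq_le measure_ge0 andbT.
  apply: (le_trans (measureU2 _ mLC mULB)).
  rewrite -[leRHS]adde0; apply: leeD.
    by rewrite le_eqVlt; apply/orP; left; apply/eqP; exact: Ck.
  apply: (le_trans (@measure_sigma_subadditive _ _ _ Pr _ LB mLB mULB (@subset_refl _ _))).
  by rewrite eseries0// => k _ _; exact: Bk.
move=> w /= hw; apply: contrapT => /not_orP[wC wB]; apply: hw.
apply/fine_cvgP; split.
  apply: nearW => n; rewrite ge0_fin_numE//.
  rewrite (le_lt_trans _ (ltry 1))// -(prob_kernel (s := K n) (sample n w)).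
  by apply: le_measure; rewrite ?inE.
apply/cvgrPdist_le => e e0.
have [k hk] : exists k : nat, k.+1%:R^-1 <= e.
  have [k _ hk] := near_infty_natSinv_lt (PosNum e0).
  by exists k; apply: ltW; apply: hk => /=.
have [N1 h1] : exists N, forall n, (N <= n)%N -> ~ C n (sample n w).
  apply: contrapT => h1; apply: wC => j _; apply: contrapT => h2; apply: h1.
  by exists j => n jn hn; apply: h2; exists n.
have [N2 h2] : exists N, forall n, (N <= n)%N -> ~ B k n (sample n w).
  apply: contrapT => h2; apply: wB; exists k => // j _.
  by apply: contrapT => h3; apply: h2; exists j => n jn hn; apply: h3; exists n.
exists (maxn N1 N2) => // n /=; rewrite geq_max => /andP[n1 n2].
rewrite sub0r normrN ger0_norm ?fine_ge0//.
have hn : (K n (sample n w) A <= k.+1%:R^-1%:E)%E.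
  rewrite leNgt; apply/negP => hn; apply: (h2 n n2); split => //.
  exact: h1.
apply: le_trans hk; rewrite -lee_fin fineK// ge0_fin_numE//.
exact: (le_lt_trans hn (ltry _)).
Qed.

End posterior_consistency.

(** * Tests of a density against small balls *)

Section testing.
Context d (T : measurableType d) (R : realType) (m : {measure set T -> \bar R}).
Implicit Types f g : density m.

(* The supremum defining the total variation distance is attained at {g < f}. *)
Lemma L1dist_law f g :
  L1dist f g = 2 * (fine (law f [set x | g x < f x]) - fine (law g [set x | g x < f x])).
Proof.
set A := [set x | g x < f x].
have mA : measurable A by apply: measurable_set_ltr; exact: measurable_dens.
have fin h : law (h : density m) A \is a fin_num.
  by rewrite ge0_fin_numE// (le_lt_trans (probability_le1 (law h) mA)) ?ltry.
have lawE (h : density m) (B : set T) : measurable B ->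
    law (h : density m) B = (\int[m]_x (\1_B x * h x)%:E)%E.
  move=> mB; transitivity (\int[law h]_x (\1_B x)%:E)%E.
    by rewrite integral_indic// setIT.
  rewrite integral_law//.
  by apply/measurable_EFinP; exact: measurable_indic.
have lawC h : law (h : density m) (~` A) = (1 - law h A)%E.
  exact: (probability_setC (law h) mA).
have mI h (B : set T) : measurable B ->
    measurable_fun setT (fun x => (\1_B x * (h : density m) x)%:E).
  move=> mB; apply/measurable_EFinP; apply: measurable_funM => //.
  exact: measurable_dens.
have I0 h (B : set T) x : (0 <= (\1_B x * (h : density m) x)%:E)%E.
  by rewrite lee_fin mulr_ge0 ?dens_ge0.
have mAC := measurableC mA.
have : ((L1dist f g)%:E + (law g A + law f (~` A)) = law f A + law g (~` A))%E.
  rewrite L1distE !lawE// -!ge0_integralD//; try exact: mI; try exact: measurable_distE; last 2 first.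
  - by move=> x _; rewrite adde_ge0.
  - by apply: emeasurable_funD; exact: mI.
  apply: eq_integral => x _; rewrite -!EFinD; congr (_%:E).
  rewrite !indicE in_setC; case: (boolP (x \in A)) => /=.
    by rewrite inE /A/= => fg; rewrite gtr0_norm ?subr_gt0//; lra.
  move/negP; rewrite inE /A/= => /negP; rewrite -leNgt => fg.
  by rewrite ler0_norm ?subr_le0//; lra.
rewrite !lawC -(fineK (fin f)) -(fineK (fin g)) -!EFinB -!EFinD => -[].
lra.
Qed.

(** Probabilities of a fixed event vary by at most the $L_1$ distance, so the event that separates
    [f0] from the center [f1] still separates [f0] from the whole ball when [rho] is small. *)
Lemma iid_test_ball f0 f1 (e rho : R) n : 0 < e <= 1 -> rho <= e / 10 ->
  exists S : set (n.-tuple T), [/\ measurable S,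
    (iid_law f0 n S <= (expR (- (n%:R * (e ^+ 2 / 2048))))%:E)%E &
    forall f, L1dist f f1 < rho -> e <= L1dist f f0 ->
      (iid_law f n (~` S) <= (expR (- (n%:R * (e ^+ 2 / 2048))))%:E)%E].
Proof.
move=> /andP[e0 e1] re.
(* The center need not be far from [f0] itself; some [g] of the ball has to be. If there is none, no
   density is to be tested and the empty set will do. *)
have [[g [gf1 gf0]]|none] := pselect (exists g, L1dist g f1 < rho /\ e <= L1dist g f0);
  last first.
  exists set0; split => //; first by rewrite measure0 lee_fin expR_ge0.
  by move=> f ff1 ff0; exfalso; apply: none; exists f.
pose A := [set x | f0 x < f1 x].
have mA : measurable A by apply: measurable_set_ltr; exact: measurable_dens.
have fin h : law (h : density m) A \is a fin_num.
  by rewrite ge0_fin_numE// (le_lt_trans (probability_le1 (law h) mA)) ?ltry.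
pose p h := fine (law (h : density m) A).
have pE h : law (h : density m) A = (p h)%:E by rewrite fineK.
have p01 h : 0 <= p h <= 1.
  by rewrite fine_ge0//= -lee_fin -pE probability_le1.
(* [f1] is at distance at least [e - rho] from [f0], half of which is the difference of
   probabilities of [A]; passing from [f1] to [f] costs [rho] more. What remains is at least
   [7 * e / 20]. *)
have gap f : L1dist f f1 < rho -> p f0 + e / 4 <= p f.
  move=> ff1.
  have h1 : p f1 <= p f + L1dist f f1.
    by rewrite -lee_fin EFinD -!pE L1distC; exact: law_le.
  have h2 : L1dist f1 f0 = 2 * (p f1 - p f0) by exact: L1dist_law.
  have := L1dist_triangle g f1 f0; lra.
(* The middle of the gap leaves a margin [e / 8] on either side, hence [e / 16] after halving;
   Chernoff's exponent [(e / 16) ^+ 2 / 8] is then [e ^+ 2 / 2048]. *)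
pose theta := p f0 + e / 8.
(* The test compares the empirical frequency of A with a threshold between f0 and
   the ball around f1; halving makes phi bounded by 1. *)
pose phi x : R := (\1_A x - theta) / 2.
have mphi : measurable_fun setT phi.
  by apply: measurable_funM => //; apply: measurable_funB.
have phi1 x : `|phi x| <= 1.
  have := p01 f0; rewrite /phi /theta indicE ler_norml => /andP[q0 q1].
  by case: (x \in A) => /=; lra.
have e16 : 0 < e / 16 <= 1 by apply/andP; split; lra.
have phiE (s : R) h : (\int[law (h : density m)]_x ((\1_A x - theta) * s)%:E =
    ((p h - theta) * s)%:E)%E.
  rewrite (eq_integral (fun x => s%:E * ((\1_A x)%:E - theta%:E))%E); last first.
    by move=> x _; rewrite mulrC EFinM EFinB.
  have i1 : (law h).-integrable setT (EFin \o \1_A) by exact: integrable_indic.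
  have i2 : (law h).-integrable setT (cst theta%:E).
    by exact: finite_measure_integrable_cst.
  rewrite integralZl//; last exact: integrableB.
  rewrite integralB_EFin// integral_cst// integral_indic// setIT.
  rewrite [X in (_ * (_ - _ * X))%E](@probability_setT _ _ _ (law h)) mule1.
  by rewrite [X in (_ * (X - _))%E](pE h) -EFinB -EFinM mulrC.
have exE : (e / 16) ^+ 2 / 8 = e ^+ 2 / 2048 by field.
pose S := [set t : n.-tuple T | 0 <= \sum_(i < n) phi (tnth t i)].
have msum (psi : T -> R) : measurable_fun setT psi ->
    measurable [set t : n.-tuple T | 0 <= \sum_(i < n) psi (tnth t i)].
  move=> mpsi; apply: measurable_set_ler => //; apply: measurable_sum => i.
  by apply: measurableT_comp => //; exact: measurable_tnth.
exists S; split; first exact: msum.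
  rewrite -exE; apply: (@chernoff_tuple _ _ _ (law f0)) => //.
  by rewrite phiE lee_fin /theta; lra.
move=> f ff1 _; rewrite -exE.
have mN : measurable_fun setT (fun x => - phi x) by exact: measurableT_comp.
apply: (le_trans _ (@chernoff_tuple _ _ _ (law f) (fun x => - phi x) _ n mN _ e16 _)).
- apply: le_measure; rewrite ?inE.
  + by apply: measurableC; exact: msum.
  + exact: (msum (fun x => - phi x)).
  move=> t /= /negP; rewrite -ltNge => /ltW h.
  by rewrite sumrN oppr_ge0.
- by move=> x; rewrite normrN.
rewrite (eq_integral (fun x => ((\1_A x - theta) * - 2^-1)%:E)); last first.
  by move=> x _; rewrite /phi mulrN.
by rewrite phiE lee_fin /theta; have := gap f ff1; lra.
Qed.

(** The union of the rejection regions costs a factor [N] under [f0] only: a far density of the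
    cover is rejected by the test of its own ball. *)
Lemma iid_test_cover f0 (N : nat) (f1 : 'I_N -> density m) (e rho : R) n :
  0 < e <= 1 -> rho <= e / 10 ->
  exists S : set (n.-tuple T), [/\ measurable S,
    (iid_law f0 n S <= (N%:R * expR (- (n%:R * (e ^+ 2 / 2048))))%:E)%E &
    forall f, (exists i, L1dist f (f1 i) < rho) -> e <= L1dist f f0 ->
      (iid_law f n (~` S) <= (expR (- (n%:R * (e ^+ 2 / 2048))))%:E)%E].
Proof.
move=> e01 re.
have /choice[S hS] i := iid_test_ball f0 (f1 i) n e01 re.
have mS i : measurable (S i) by have [] := hS i.
have mUS : measurable (\big[setU/set0]_(i < N) S i) by exact: bigsetU_measurable.
exists (\big[setU/set0]_(i < N) S i); split => //.
  apply: (@le_trans _ _ (\sum_(i < N) iid_law f0 n (S i))%E).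
    suff [] : measurable (\big[setU/set0]_(i < N) S i) /\
      (iid_law f0 n (\big[setU/set0]_(i < N) S i) <= \sum_(i < N) iid_law f0 n (S i))%E.
      by [].
    apply: (big_rec2 (fun X x => measurable X /\ (iid_law f0 n X <= x)%E)).
      by rewrite measure0.
    move=> i x X _ [mX Xx]; split; first exact: measurableU.
    by apply: (le_trans (measureU2 _ (mS i) mX)); rewrite leeD2l.
  apply: (@le_trans _ _ (\sum_(i < N) (expR (- (n%:R * (e ^+ 2 / 2048))))%:E)%E).
    by apply: lee_sum => i _; have [] := hS i.
  by rewrite sumEFin sumr_const card_ord -[_ *+ N]mulr_natl.
move=> f [i fi] ff0; have [_ _ /(_ f fi ff0)] := hS i.
apply: le_trans; apply: le_measure; rewrite ?inE.
- by apply: measurableC.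
- by apply: measurableC; exact: mS.
- apply: subsetC => t Sit; rewrite -bigcup_seq; exists i => //=.
  by rewrite mem_index_enum.
Qed.

End testing.

Section cover_consistency.
Context d (T : measurableType d) (R : realType) (m : {measure set T -> \bar R}).
Variables (base : density m) (P : probability (borel_density base) R).
Variables (f0 : density m) (hf0 : KL_support P f0).
Context d' (W : measurableType d') (Pr : probability W R) (y : nat -> W -> T).
Hypothesis hy : iid_from Pr f0 y.
Variable K : forall n : nat, R.-pker (n.-tuple T) ~> borel_density base.
Hypothesis hK : forall n : nat, is_posterior P (K n).

Lemma posterior_consistency_of_covers (e rho c1 c2 beta : R) :
  0 < e <= 1 -> rho <= e / 10 -> 0 < c2 -> beta < e ^+ 2 / 2048 ->
  (\forall n \near \oo, exists (N : nat) (f1 : 'I_N -> density m),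
    N%:R <= expR (n%:R * beta) /\
    (P (~` [set f : borel_density base | exists i, (L1dist f (f1 i) < rho)%R])
      <= (c1 * expR (- (n%:R * c2)))%:E)%E) ->
  {ae Pr, forall w,
    K n [tuple y i w | i < n] [set f : borel_density base | (e <= L1dist f f0)%R]
      @[n --> \oo] --> 0%E}.
Proof.
move=> e01 re c20 be cov.
set kap := e ^+ 2 / 2048 in be.
have kap0 : 0 < kap.
  by apply: divr_gt0; [apply: exprn_gt0; case/andP: e01|rewrite ltr0n].
(* Three rates compete: [kap - beta] for the error under [f0], where [N] is at most
   [expR (n%:R * beta)]; [kap] for the error on the cover; [c2] for the prior mass off the cover. *)
pose c := Num.min (kap - beta) (Num.min kap c2).
have c0 : 0 < c by rewrite !lt_min subr_gt0 be kap0 c20.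
have cb : c <= kap - beta by rewrite ge_min lexx.
have ck : c <= kap by rewrite !ge_min lexx orbT.
have cc2 : c <= c2 by rewrite !ge_min lexx !orbT.
set A := [set f : borel_density base | (e <= L1dist f f0)%R].
have mL := measurable_L1dist (base := base).
have mA : measurable A by apply: measurable_set_ler => //; exact: mL.
pose good n (S : set (n.-tuple T)) :=
  (iid_law f0 n S <= ((1 + `|c1|) * expR (- (n%:R * c)))%:E)%E /\
  (\int[P]_(f in A) iid_law (f : density m) n (~` S)
      <= ((1 + `|c1|) * expR (- (n%:R * c)))%:E)%E.
have expc n (k : R) : c <= k -> expR (- (n%:R * k)) <= expR (- (n%:R * c)).
  by move=> ?; rewrite ler_expR lerN2 ler_wpM2l.
(* An implication, because the regions must be chosen for every [n] while a cover exists only for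
   large [n]. *)
have exC : forall n, exists S : set (n.-tuple T), measurable S /\
    ((exists (N : nat) (f1 : 'I_N -> density m),
    N%:R <= expR (n%:R * beta) /\
    (P (~` [set f : borel_density base | exists i, (L1dist f (f1 i) < rho)%R])
      <= (c1 * expR (- (n%:R * c2)))%:E)%E) -> good n S).
  move=> n; have [[N [f1 [Nb Pc]]]|no] := pselect (exists (N : nat) (f1 : 'I_N -> density m),
    N%:R <= expR (n%:R * beta) /\
    (P (~` [set f : borel_density base | exists i, (L1dist f (f1 i) < rho)%R])
      <= (c1 * expR (- (n%:R * c2)))%:E)%E); last by exists set0; split.
  have [S [mS S0 S1]] := iid_test_cover f0 f1 n e01 re.
  exists S; split => // _; split.
    apply: (le_trans S0); rewrite lee_fin mulrDl mul1r.
    rewrite -[leLHS]addr0 lerD ?mulr_ge0 ?expR_ge0//.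
    apply: (@le_trans _ _ (expR (n%:R * beta) * expR (- (n%:R * kap)))).
      by rewrite ler_wpM2r ?expR_ge0.
    have := expc n _ cb; apply: le_trans; rewrite -expRD ler_expR.
    by rewrite mulrBr opprB.
  set G := [set f : borel_density base | exists i, (L1dist f (f1 i) < rho)%R] in Pc.
  have mG : measurable G.
    rewrite (_ : G = \bigcup_(i in [set: 'I_N]) [set f : borel_density base |
        L1dist f (f1 i) < rho]); last first.
      by apply/seteqP; split => f; [move=> [i fi]; exists i|move=> [i _ fi]; exists i].
    apply: fin_bigcup_measurable => // i _.
    by apply: measurable_set_ltr => //; exact: mL.
  have mSC : measurable (~` S) by exact: measurableC.
  have mF := @measurable_iid_law _ _ _ _ base _ _ mSC.
  rewrite integral_mkcond.
  (* On the cover the test bounds the error; off it, the trivial bound 1 is integrated over a set of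
     small prior mass. *)
  apply: (@le_trans _ _ (\int[P]_f ((expR (- (n%:R * kap)))%:E +
      (\1_(~` G) f)%:E))%E).
    apply: ge0_le_integral => //.
    - by move=> f _; exact: erestrict_ge0.
    - by apply/(measurable_restrictT _ mA); exact: measurable_funTS.
    - apply: emeasurable_funD => //; apply/measurable_EFinP.
      by apply: measurable_indic; exact: measurableC.
    move=> f _; rewrite patchE; case: (boolP (f \in A)) => [|_]; last first.
      by rewrite adde_ge0// lee_fin ?expR_ge0.
    rewrite inE => fA; rewrite indicE in_setC.
    case: (boolP (f \in G)) => [|_].
      by rewrite inE => fG; rewrite adde0; exact: S1.
    apply: (le_trans (iid_law_le1 _ mSC)).
    by rewrite -EFinD lee_fin lerDr expR_ge0.
  rewrite ge0_integralD//; last first.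
    by apply/measurable_EFinP; apply: measurable_indic; exact: measurableC.
  rewrite integral_cst//= probability_setT mule1 integral_indic ?setIT//; last first.
    exact: measurableC.
  apply: (@le_trans _ _ ((expR (- (n%:R * kap)))%:E + (c1 * expR (- (n%:R * c2)))%:E)%E).
    by rewrite leeD2l.
  rewrite -EFinD lee_fin mulrDl mul1r lerD// ?expc//.
  apply: (@le_trans _ _ (`|c1| * expR (- (n%:R * c2)))).
    by rewrite ler_wpM2r ?expR_ge0 ?ler_norm.
  by rewrite ler_wpM2l// expc.
pose C n := projT1 (cid (exC n)).
have hC n := projT2 (cid (exC n)).
apply: (posterior_cvg0 hf0 hy hK (A := A) (C := C) (C0 := 1 + `|c1|) (c := c)) => //.
  by move=> n; have [] := hC n.
by apply: filterS cov => n h; have [_ /(_ h)] := hC n.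
Qed.

End cover_consistency.

(** * Monotone changes of variable *)

Section lebesgue_domination.
Context (R : realType).
Notation leb := (@lebesgue_measure R).

(** Lebesgue measure is an infimum over countable covers by half-open intervals, and [nu] is
    countably subadditive. *)
Lemma measure_le_lebesgue (nu : {measure set (measurableTypeR R) -> \bar R}) :
  (forall a b : R, a < b -> (nu `]a, b]%classic <= (b - a)%:E)%E) ->
  forall A, measurable A -> (nu A <= leb A)%E.
Proof.
move=> nuab A mA; rewrite /lebesgue_measure /lebesgue_stieltjes_measure.
rewrite /measure_extension; apply: le_ereal_inf_tmp => _ [F [mF AF] <-].
have mF' k : measurable (F k : set (measurableTypeR R)).
  exact: sub_sigma_algebra (mF k).
apply: (@le_trans _ _ (nu (\bigcup_k F k))).
  by apply: le_measure; rewrite ?inE//; exact: bigcupT_measurable.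
apply: (@le_trans _ _ (\sum_(0 <= k <oo) nu (F k))%E).
  by apply: measure_sigma_subadditive => //; exact: bigcupT_measurable.
apply: lee_nneseries => [k _ _|k _]; first exact: measure_ge0.
have /ocitvP[->|[[a b] /= ab ->]] := mF k; first by rewrite !measure0.
rewrite wlength_itv /= lte_fin ab; exact: nuab.
Qed.

Lemma integral_shift (f : R -> \bar R) (t : R) : measurable_fun setT f ->
  (forall x, 0 <= f x)%E -> (\int[leb]_x f (x + t)%R = \int[leb]_x f x)%E.
Proof.
move=> mf f0.
have mt : measurable_fun setT (fun x : measurableTypeR R => x + t : measurableTypeR R).
  by apply: measurable_funD.
have := @ge0_integral_pushforward _ _ _ _ R _ mt leb setT f measurableT mf (fun y _ => f0 y).
rewrite preimage_setT => <-; apply: eq_measure_integral => A mA _.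
apply/esym; apply: (@lebesgue_measure_unique R
  (measure_function_pushforward__canonical__measure_function_Measure leb mt)) => //.
move=> _ [[a b] _ <-]; transitivity (leb `]a - t, b - t]%classic).
  rewrite !lebesgue_measure_itv/= !lte_fin ltrD2r; case: ifP => // _.
  by rewrite -!EFinB; congr (_%:E); ring.
rewrite -[RHS]/(leb [set x | `]a, b]%classic (x + t)]); congr (leb _).
by apply/seteqP; split => x /=; rewrite !in_itv/= ltrBlDr lerBrDr.
Qed.

Lemma integral_EFin_indic (D : set R) (g : R -> R) :
  (\int[leb]_(x in D) (g x)%:E = \int[leb]_x (\1_D x * g x)%:E)%E.
Proof.
rewrite integral_mkcond; apply: eq_integral => x _.
by rewrite patchE indicE; case: (x \in D); rewrite ?mul1r ?mul0r.
Qed.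

Lemma integral_nd_increment_le (u : R -> R) (c d t : R) : c <= d -> 0 < t ->
  {homo u : x y / x <= y} -> (forall x, d <= x -> u x = u d) ->
  (\int[leb]_(x in `]c, d]) (u (x + t) - u x)%:E <= (t * (u d - u c))%:E)%E.
Proof.
move=> cd t0 ndu ud.
(* The integrals of u over ]c + t, d + t] and ]c, d] differ only by end pieces of
   length t; v keeps the left one nonnegative. *)
pose v x := u (Num.max c x) - u c.
have v0 x : 0 <= v x by rewrite subr_ge0 ndu// le_max lexx.
have mu_ : measurable_fun setT u by exact: nondecreasing_measurable.
have mv : measurable_fun setT v.
  apply: measurable_funB => //; apply: (measurableT_comp mu_).
  exact: measurable_maxr.
have mI a b : measurable (`]a, b]%classic : set R) by exact: measurable_itv.
have mi (D : set R) : measurable D -> measurable_fun setT (\1_D : R -> R).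
  by move=> mD; exact: measurable_indic.
pose I := `]c, d]%classic : set R.
have miI : measurable_fun setT (\1_I : R -> R) := mi _ (mI c d).
have M0 : 0 <= u d - u c by rewrite subr_ge0 ndu.
have ms s : measurable_fun setT (fun x : R => u (x + s)).
  by apply: (measurableT_comp mu_); exact: measurable_funD.
have finv : (\int[leb]_x (\1_I x * v x)%:E \is a fin_num)%E.
  rewrite ge0_fin_numE; last first.
    by apply: integral_ge0 => x _; rewrite lee_fin mulr_ge0.
  apply: (@le_lt_trans _ _ (\int[leb]_x ((u d - u c)%:E * (\1_I x)%:E))%E).
    apply: ge0_le_integral => //.
    - by move=> x _; rewrite lee_fin mulr_ge0.
    - by apply/measurable_EFinP; apply: measurable_funM => //; exact: miI.
    - by apply: emeasurable_funM => //; apply/measurable_EFinP; exact: miI.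
    move=> x _; rewrite -EFinM lee_fin indicE; case: (boolP (x \in I)).
      rewrite inE /I/= in_itv/= => /andP[cx xd]; rewrite mul1r mulr1 lerD2r.
      by apply: ndu; rewrite ge_max cd.
    by rewrite mul0r mulr0.
  rewrite ge0_integralZl_EFin//; last by apply/measurable_EFinP; exact: miI.
  rewrite integral_indic ?setIT//; last exact: (mI c d).
  rewrite [X in (_ * X)%E]lebesgue_measure_itv/= lte_fin.
  by case: ifP => _; rewrite ?mule0 ?ltry// -EFinB -EFinM ltry.
rewrite [leLHS](_ : _ = \int[leb]_x (\1_I x * (u (x + t) - u x))%:E)%E; last first.
  exact: integral_EFin_indic.
(* A finite integral is added on both sides, so that only integrals of nonnegative functions are
   left to combine. *)
rewrite -(@leeD2rE _ (\int[leb]_x (\1_I x * v x)%:E)%E)//.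
have mdiff : measurable_fun setT (fun x => (\1_I x * (u (x + t) - u x))%:E).
  apply/measurable_EFinP; apply: measurable_funM; first exact: miI.
  by apply: measurable_funB => //; exact: ms.
have mIv : measurable_fun setT (fun x => (\1_I x * v x)%:E).
  by apply/measurable_EFinP; apply: measurable_funM => //; exact: miI.
rewrite -ge0_integralD//; last 2 first.
- by move=> x _; rewrite lee_fin mulr_ge0// subr_ge0 ndu// lerDl ltW.
- by move=> x _; rewrite lee_fin mulr_ge0.
pose f z := (\1_I (z - t) * v z)%:E.
have mf : measurable_fun setT f.
  apply/measurable_EFinP; apply: measurable_funM => //.
  by apply: (measurableT_comp (mi _ (mI c d))); exact: measurable_funB.
have f0 z : (0 <= f z)%E by rewrite lee_fin mulr_ge0.
rewrite [leLHS](_ : _ = \int[leb]_x f (x + t)%R)%E; last first.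
  apply: eq_integral => x _; rewrite /f addrK -EFinD -mulrDr indicE.
  case: (boolP (x \in I)); last by rewrite !mul0r.
  rewrite inE /I/= in_itv/= => /andP[cx xd]; congr (_ * _)%:E.
  have cxt : c <= x + t by rewrite (le_trans (ltW cx))// lerDl ltW.
  rewrite /v (max_r cxt) (max_r (ltW cx)); ring.
rewrite integral_shift//.
pose J := `]d, d + t]%classic : set R.
have miJ : measurable_fun setT (\1_J : R -> R) := mi _ (mI d (d + t)).
apply: (@le_trans _ _ (\int[leb]_x ((u d - u c)%:E * (\1_J x)%:E +
    (\1_I x * v x)%:E))%E).
  apply: ge0_le_integral => //.
  - apply: emeasurable_funD => //; apply: emeasurable_funM => //.
    by apply/measurable_EFinP; exact: miJ.
  move=> z _; rewrite /f -EFinM -EFinD lee_fin !indicE.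
  case: (boolP (z - t \in I)); last first.
    by rewrite mul0r addr_ge0// mulr_ge0.
  rewrite inE /I/= in_itv/= => /andP[cz zd]; rewrite mul1r.
  have cz' : c < z by rewrite (lt_le_trans cz)// gerBl ltW.
  have [dz|zd'] := ltP d z.
    rewrite [z \in J]mem_set/=; last by rewrite /J/= in_itv/= dz -lerBlDr.
    rewrite mulr1 -[leLHS]addr0 lerD ?mulr_ge0//.
    by rewrite /v (max_r (ltW cz')) (ud _ (ltW dz)).
  rewrite [z \in `]c, d]%classic]mem_set/=; last by rewrite in_itv/= cz' zd'.
  by rewrite mul1r lerDr mulr_ge0.
rewrite ge0_integralD//; last 2 first.
- by apply: emeasurable_funM => //; apply/measurable_EFinP; exact: miJ.
- by move=> x _; rewrite lee_fin mulr_ge0.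
rewrite leeD2r// ge0_integralZl_EFin//; last by apply/measurable_EFinP; exact: miJ.
rewrite integral_indic ?setIT//; last exact: (mI d (d + t)).
rewrite [X in (_ * X)%E]lebesgue_measure_itv/= lte_fin ltrDl t0.
  by rewrite -EFinB -EFinM lee_fin mulrC addrAC subrr add0r.
by move=> x _; rewrite mule_ge0// lee_fin.
Qed.

(* Fatou's lemma for the difference quotients: equality would need absolute
   continuity, but the inequality does not. *)
Lemma integral_nd_derivative_le (u w : R -> R) (c d : R) : c <= d ->
  {homo u : x y / x <= y} -> (forall x, d <= x -> u x = u d) ->
  (forall x, c < x < d -> (n.+1%:R * (u (x + n.+1%:R^-1) - u x)) @[n --> \oo] --> w x) ->
  (\int[leb]_(x in `]c, d[) (w x)%:E <= (u d - u c)%:E)%E.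
Proof.
move=> cd ndu ud uw.
pose q (n : nat) x := (n.+1%:R * (u (x + n.+1%:R^-1) - u x))%:E.
have mu_ : measurable_fun setT u by exact: nondecreasing_measurable.
have mq n : measurable_fun setT (q n).
  apply/measurable_EFinP; apply: measurable_funM => //.
  apply: measurable_funB => //; apply: (measurableT_comp mu_).
  exact: measurable_funD.
have n0 n : 0 < n.+1%:R^-1 :> R by rewrite invr_gt0.
have q0 n x : (0 <= q n x)%E.
  by rewrite lee_fin mulr_ge0// subr_ge0 ndu// lerDl ltW.
have mcd : measurable (`]c, d[%classic : set R) by exact: measurable_itv.
have mcd' : measurable (`]c, d]%classic : set R) by exact: measurable_itv.
rewrite [leLHS](_ : _ = \int[leb]_(x in `]c, d[) limn_einf (q ^~ x))%E; last first.
  apply: eq_integral => x; rewrite inE/= in_itv/= => /uw wx.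
  have h : q ^~ x @ \oo --> (w x)%:E by apply: cvg_EFin => //; exact: nearW.
  by rewrite (cvg_limn_einf_sup h).1.
apply: (le_trans (fatou _ _ _ _)) => //.
- by move=> n; exact: (measurable_funTS (mq n)).
suff qle n : (\int[leb]_(x in `]c, d[) q n x <= (u d - u c)%:E)%E.
  rewrite limn_einf_lim; apply: lime_le; first exact: is_cvg_einfs.
  apply: nearW => n; apply: (le_trans _ (qle n)).
  by apply: ereal_inf_lbound; exists n => /=.
apply: (@le_trans _ _ (\int[leb]_(x in `]c, d]) q n x)%E).
  apply: ge0_subset_integral => //; first exact: (measurable_funTS (mq n)).
  by apply: subset_itvl; rewrite bnd_simp.
have := integral_nd_increment_le cd (n0 n) ndu ud.
rewrite -(@lee_pmul2l _ n.+1%:R%:E)//.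
rewrite -EFinM mulrA divff ?pnatr_eq0// mul1r; apply: le_trans.
rewrite -ge0_integralZl_EFin//.
- by move=> x _; rewrite lee_fin subr_ge0 ndu// lerDl ltW.
- apply: measurable_funTS; apply/measurable_EFinP.
  apply: measurable_funB => //; apply: (measurableT_comp mu_).
  exact: measurable_funD.
Qed.

End lebesgue_domination.

Section weighted_measure.
Context d (T : measurableType d) (R : realType) (mu : {measure set T -> \bar R}).
Variables (w : T -> R) (mw : measurable_fun setT w) (w0 : forall x, 0 <= w x).

Definition weighted (A : set T) : \bar R := (\int[mu]_(x in A) (w x)%:E)%E.

Let weighted0 : weighted set0 = 0%E.
Proof. exact: integral_set0. Qed.

Let weighted_ge0 A : (0 <= weighted A)%E.
Proof. by apply: integral_ge0 => x _; rewrite lee_fin. Qed.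

Let weighted_sigma_additive : semi_sigma_additive weighted.
Proof.
move=> F mF tF mU; rewrite /weighted ge0_integral_bigcup//.
- by apply: is_cvg_ereal_nneg_natsum_cond => n _ _; exact: weighted_ge0.
- by apply: measurable_funTS; exact/measurable_EFinP.
- by move=> x _; rewrite lee_fin.
Qed.

HB.instance Definition _ :=
  isMeasure.Build _ _ _ weighted weighted0 weighted_ge0 weighted_sigma_additive.

Definition weighted_measure : {measure set T -> \bar R} := weighted.

End weighted_measure.

Section monotone_bijection.
Context (R : realType).
Notation leb := (@lebesgue_measure R).
Variables (Y : set R) (h g : R -> R) (sig : R).
Hypotheses (sigE : `|sig| = 1)
  (h_mono : forall x y, x < y -> 0 < sig * (h y - h x))
  (hY : forall x, Y (h x)) (hK : cancel h g)
  (gK : forall y, Y y -> h (g y) = y)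
  (Y_itv : is_interval Y)
  (g_derivable : forall y, Y y -> derivable g y 1).

Lemma derivable_harmonic (f : R -> R) y : derivable f y 1 ->
  (n.+1%:R * (f (y + n.+1%:R^-1) - f y)) @[n --> \oo] --> 'D_1 f y.
Proof.
move=> df.
have h0 : (fun n => n.+1%:R^-1 : R) @ \oo --> 0^'.
  move=> A [e /= e0 eA]; have [N _ hN] := @cvg_harmonic R _ (nbhsx_ballx 0 e e0).
  exists N => // n Nn; apply: eA; first exact: hN.
  by rewrite /= invr_eq0 pnatr_eq0.
have := cvg_comp _ _ h0 df; apply: cvg_trans; apply: near_eq_cvg; apply: nearW => n /=.
by rewrite invrK [_%:A]mulr1 (addrC y).
Qed.

(** The sign [sig] lets increasing and decreasing bijections share their proofs. *)
Let sig_cases : sig = 1 \/ sig = -1.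
Proof.
have [s0|s0] := leP 0 sig; move: sigE.
  by rewrite ger0_norm// => ->; left.
by rewrite ltr0_norm// => <-; right; rewrite opprK.
Qed.

Let g_mono y z : Y y -> Y z -> y < z -> 0 < sig * (g z - g y).
Proof.
move=> Yy Yz yz; have [] := ltgtP (g y) (g z).
- move=> gg; have := h_mono gg; rewrite !gK//.
  by case: sig_cases => ->; lra.
- move=> gg; have := h_mono gg; rewrite !gK//.
  by case: sig_cases => ->; lra.
- by move=> gg; have := gK Yy; rewrite gg gK// => zy; move: yz; rewrite zy ltxx.
Qed.

(** [Y] is open: [h] is strictly monotone on the whole line, so its values at [g y - 1] and
    [g y + 1] surround [y]. *)
Let Y_nbhs y : Y y -> exists2 e, 0 < e & forall z, `|z - y| < e -> Y z.
Proof.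
move=> Yy; set x := g y.
have h1 : 0 < sig * (h (x + 1) - h x) by apply: h_mono; rewrite ltrDl.
have h2 : 0 < sig * (h x - h (x - 1)) by apply: h_mono; rewrite gtrBl.
rewrite gK// in h1 h2.
exists (Num.min (sig * (h (x + 1) - y)) (sig * (y - h (x - 1)))).
  by rewrite lt_min h1.
move=> z; rewrite lt_min => /andP[]; rewrite !ltr_norml => /andP[z1 z2] /andP[z3 z4].
have Y1 := hY (x + 1); have Y2 := hY (x - 1).
case: sig_cases => sE; rewrite sE in h1 h2 z1 z2 z3 z4.
  by apply: (Y_itv Y2 Y1); apply/andP; split; lra.
by apply: (Y_itv Y1 Y2); apply/andP; split; lra.
Qed.

Let gY := g \_ Y.
Let w (y : R) : R := `|'D_1 g y|.
Let wY := w \_ Y.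

Let mY : measurable Y.
Proof. exact: is_interval_measurable. Qed.

Lemma measurable_monotone_inverse : measurable_fun setT (g \_ Y).
Proof.
apply/(measurable_restrictT _ mY).
apply: (measurability _ (RGenOInfty.measurableE R)).
move=> /= _ [_ [a ->] <-].
rewrite (_ : _ `&` _ = Y `&` [set y | 0 < sig * (y - h a)]).
  apply: measurableI => //; apply: measurable_set_ltr => //.
  by apply: measurable_funM => //; exact: measurable_funB.
apply/seteqP; split => y [Yy] /=; rewrite in_itv/= andbT => hy; split => //=.
  by rewrite -(gK Yy); exact: h_mono.
rewrite ltNge; apply/negP; rewrite le_eqVlt => /orP[/eqP ga|ga].
  by move: hy; rewrite -ga gK// subrr mulr0 ltxx.
have := h_mono ga; rewrite gK//; move: hy; case: sig_cases => ->; lra.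
Qed.

(** Difference quotients of the extension by 0 are measurable; since [Y] is open, they eventually
    agree with those of [g] at each of its points. *)
Lemma measurable_monotone_derivative : measurable_fun setT wY.
Proof.
apply/(measurable_restrictT _ mY).
apply: (@measurable_fun_cvg _ _ _ Y
  (fun n y => `|n.+1%:R * (gY (y + n.+1%:R^-1) - gY y)|)).
  move=> n; apply: measurable_funTS; apply: measurableT_comp => //.
  apply: measurable_funM => //; apply: measurable_funB.
    apply: (measurableT_comp measurable_monotone_inverse).
    exact: measurable_funD.
  exact: measurable_monotone_inverse.
move=> y Yy; have [e e0 eY] := Y_nbhs Yy.
have dg : `|n.+1%:R * (g (y + n.+1%:R^-1) - g y)| @[n --> \oo] --> w y.
  by apply: cvg_norm; exact: derivable_harmonic (g_derivable Yy).
apply: cvg_trans dg; apply: near_eq_cvg.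
have [N _ hN] := near_infty_natSinv_lt (PosNum e0).
exists N => // n Nn /=; rewrite /gY !patchE !mem_set//.
by apply: eY; rewrite addrAC subrr add0r ger0_norm ?invr_ge0//; exact: hN.
Qed.

Let wY0 y : 0 <= wY y.
Proof. by rewrite /wY patchE; case: ifP => // _; exact: normr_ge0. Qed.

Let nu_itv (a b : R) : a < b ->
  (\int[leb]_(y in gY @^-1` `]a, b]) (wY y)%:E <= (b - a)%:E)%E.
Proof.
move=> ab.
pose c := Num.min (h a) (h b); pose d := Num.max (h a) (h b).
have cd : c <= d by rewrite /c /d ge_min le_max lexx.
have Yc : Y c by rewrite /c; case: leP.
have Yd : Y d by rewrite /d; case: leP.
have Ycd z : c <= z -> z <= d -> Y z by move=> cz zd; apply: (Y_itv Yc Yd); rewrite cz.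
(* Composed with [clamp] and multiplied by [sig], [g] becomes nondecreasing on the whole line and
   constant beyond [d], as [integral_nd_derivative_le] requires. *)
pose clamp y := Num.max c (Num.min y d).
have c1 y : c <= clamp y by rewrite le_max lexx.
have c2 y : clamp y <= d by rewrite ge_max cd ge_min lexx orbT.
have clamp_mono : {homo clamp : x y / x <= y}.
  move=> x y xy; rewrite /clamp ge_max le_max lexx/= le_max.
  apply/orP; right; rewrite le_min; apply/andP; split; last by rewrite ge_min lexx orbT.
  by rewrite ge_min xy.
have clampE y : c <= y -> y <= d -> clamp y = y.
  by move=> cy yd; rewrite /clamp min_l// max_r.
pose u y := sig * g (clamp y).
have ndu : {homo u : x y / x <= y}.
  move=> x y /clamp_mono; rewrite le_eqVlt => /orP[/eqP e|xy]; first by rewrite /u e.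
  have := g_mono (Ycd _ (c1 x) (c2 x)) (Ycd _ (c1 y) (c2 y)) xy.
  by rewrite mulrBr subr_gt0 => /ltW.
have ud x : d <= x -> u x = u d.
  by move=> dx; rewrite /u /clamp min_r// minxx.
have udc : u d - u c = b - a.
  rewrite /u !clampE// /c /d; have := h_mono ab.
  case: sig_cases => -> hab.
    have : h a < h b by lra.
    by move=> /ltW hh; rewrite (max_r hh) (min_l hh) !hK; lra.
  have : h b < h a by lra.
  by move=> /ltW hh; rewrite (max_l hh) (min_r hh) !hK; lra.
have uw x : c < x < d ->
    (n.+1%:R * (u (x + n.+1%:R^-1) - u x)) @[n --> \oo] --> wY x.
  move=> /andP[cx xd]; have Yx := Ycd _ (ltW cx) (ltW xd).
  have dg : (sig * (n.+1%:R * (g (x + n.+1%:R^-1) - g x))) @[n --> \oo]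
      --> sig * 'D_1 g x.
    by apply: cvgM; [exact: cvg_cst|exact: derivable_harmonic (g_derivable Yx)].
  have ug : (n.+1%:R * (u (x + n.+1%:R^-1) - u x)) @[n --> \oo] --> sig * 'D_1 g x.
    apply: cvg_trans dg; apply: near_eq_cvg.
    have dx0 : 0 < d - x by rewrite subr_gt0.
    have [N _ hN] := near_infty_natSinv_lt (PosNum dx0).
    exists N => // n Nn /=; have {}hN := hN n Nn.
    have n0 : 0 < n.+1%:R^-1 :> R by rewrite invr_gt0.
    rewrite /u !clampE ?(ltW cx) ?(ltW xd)//.
    - by rewrite -mulrBr mulrCA.
    - by rewrite (le_trans (ltW cx))// lerDl ltW.
    - by rewrite -lerBrDl ltW.
  have D0 : 0 <= sig * 'D_1 g x.
    apply: (cvgr_to_ge ug); apply: nearW => n.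
    by rewrite mulr_ge0// subr_ge0 ndu// lerDl invr_ge0.
  have -> : wY x = sig * 'D_1 g x; last exact: ug.
  by rewrite /wY patchE mem_set// /w -[RHS]ger0_norm// normrM sigE mul1r.
rewrite -udc; apply: le_trans (integral_nd_derivative_le cd ndu ud uw).
have mwYE : measurable_fun setT (fun y => (wY y)%:E).
  by apply/measurable_EFinP; exact: measurable_monotone_derivative.
(* The preimage of []a, b]] may contain an endpoint of [[c, d]], while derivatives were controlled
   strictly inside; endpoints are null. *)
rewrite -(@integral_itv_bndoo _ c d _ true false); last exact: measurable_funTS.
rewrite integral_mkcond [leRHS]integral_mkcond.
have mpre : measurable (gY @^-1` (`]a, b]%classic)).
  have mab : measurable (`]a, b]%classic : set R) by exact: measurable_itv.
  by have := measurable_monotone_inverse measurableT mab; rewrite setTI.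
apply: ge0_le_integral => //.
- by move=> y _; apply: erestrict_ge0 => z _; rewrite lee_fin.
- by apply/(measurable_restrictT _ mpre); exact: measurable_funTS.
- have mcd : measurable (`[c, d]%classic : set R) by exact: measurable_itv.
  by apply/(measurable_restrictT _ mcd); exact: measurable_funTS.
move=> y _; rewrite !patchE; case: ifPn => [|_]; last first.
  by case: ifP => // _; rewrite lee_fin.
have [Yy|nYy] := pselect (Y y); last first.
  have -> : wY y = 0 by rewrite /wY patchE memNset.
  by case: ifP.
rewrite inE /= /gY patchE mem_set// in_itv/= => /andP[agy gyb].
rewrite mem_set//= in_itv/=.
have h1 := h_mono agy; rewrite gK// in h1.
have h2 : 0 <= sig * (h b - y).
  move: gyb; rewrite le_eqVlt => /orP[/eqP <-|/h_mono]; rewrite gK//.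
    by rewrite subrr mulr0.
  exact: ltW.
rewrite /c /d ge_min le_max; case: sig_cases => sE; rewrite sE in h1 h2.
  by apply/andP; split; apply/orP; [left|right]; lra.
by apply/andP; split; apply/orP; [right|left]; lra.
Qed.

(** The image under [g] of the measure with density $|g'|$ gives an interval at most its length,
    hence is dominated by Lebesgue measure. The weight is 0 off [Y], so the values of the extension
    of [g] there do not matter. *)
Lemma monotone_transport_le (phi : R -> \bar R) :
  measurable_fun setT phi -> (forall x, 0 <= phi x)%E ->
  (\int[leb]_y (phi ((g \_ Y) y) * (((fun y => `|'D_1 g y|) \_ Y) y)%:E)
    <= \int[leb]_x phi x)%E.
Proof.
move=> mphi phi0.
pose W := weighted_measure leb measurable_monotone_derivative wY0.
have mg : measurable_fun setT (gY : measurableTypeR R -> measurableTypeR R).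
  exact: measurable_monotone_inverse.
pose nu := measure_function_pushforward__canonical__measure_function_Measure W mg.
rewrite -(integral_weighted (nu := nu) mg measurable_monotone_derivative wY0)//.
apply: ge0_le_measure_integral => //; apply: measure_le_lebesgue => a b ab.
exact: nu_itv.
Qed.

End monotone_bijection.

Section jacobian_product.
Context (R : realType) (p1 p2 : nat) (r : rounding_map R p1 p2).

Lemma differentiable_h1inv_mx (u : 'rV[R]_p1) :
  (forall j, Yfac r j (u ord0 j)) -> differentiable (h1inv_mx r) u.
Proof.
move=> Yu; have -> : h1inv_mx r =
    \sum_(j < p1) (fun u : 'rV[R]_p1 => h1inv r j (u ord0 j) *: delta_mx ord0 j).
  apply/funext => v; rewrite fct_sumE {1}[h1inv_mx r v]row_sum_delta.
  by apply: eq_bigr => j _; rewrite mxE.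
apply: differentiable_sum => j; apply: differentiableZl.
apply: (@differentiable_comp _ _ _ _ (fun u : 'rV[R]_p1 => u ord0 j) (h1inv r j)).
  exact: differentiable_coord.
by apply/derivable1_diffP; exact: h1inv_derivable.
Qed.

Lemma derive_coord_comp (f : R -> R) (u : 'rV[R]_p1) i j :
  'D_(delta_mx ord0 i) (fun v : 'rV[R]_p1 => f (v ord0 j)) u =
  if i == j then 'D_1 f (u ord0 j) else 0.
Proof.
case: eqP => [->|/eqP ij].
  rewrite /derive; do 2 f_equal; apply/funext => h /=.
  by rewrite !mxE !eqxx.
rewrite /derive (_ : (fun h => _) = cst 0) ?lim_cst//.
apply/funext => h /=; rewrite !mxE !eqxx/= eq_sym (negbTE ij) mulr0n mulr0 add0r.
by rewrite subrr scaler0.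
Qed.

(** The transformation acts coordinate by coordinate, so its Jacobian matrix is diagonal;
    differentiability is what identifies its rows with directional derivatives. *)
Lemma absJE (y : p1.-tuple (measurableTypeR R)) : Yset r y ->
  absJ r y = \prod_j `|'D_1 (h1inv r j) (tnth y j)|.
Proof.
move=> Yy; set u := \row_j tnth y j.
have uE j : u ord0 j = tnth y j by rewrite mxE.
have dh : differentiable (h1inv_mx r) u.
  by apply: differentiable_h1inv_mx => j; rewrite uE; exact: Yy.
rewrite /absJ -/u (_ : jacobian _ _ = diag_mx (\row_j 'D_1 (h1inv r j) (tnth y j))).
  by rewrite det_diag normr_prod; apply: eq_bigr => j _; rewrite mxE.
apply/row_matrixP => i; rewrite rowE -deriveEjacobian// derive_mx; last exact: diff_derivable.
apply/rowP => j; rewrite !mxE.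
rewrite (_ : (fun t => h1inv_mx r t 0 j) = fun v => h1inv r j (v ord0 j)); last first.
  by apply/funext => v; rewrite mxE.
by rewrite derive_coord_comp uE; case: eqP => [->|_].
Qed.

End jacobian_product.

(** * The rounding map *)

Section rounding_transport.
Context (R : realType) (p1 p2 : nat) (r : rounding_map R p1 p2).
Notation leb := (@lebesgue_measure R).

Lemma Yfac_h1 j x : Yfac r j (h1 r j x).
Proof. by have [hf _ _] := h1_bij r j; exact: (hf x). Qed.

Lemma h1invK j y : Yfac r j y -> h1 r j (h1inv r j y) = y.
Proof. by have [_ _ hs] := h1_bij r j; move=> /hs[x _ <-]; rewrite h1K. Qed.

Lemma h1_strict j : exists2 sig : R, `|sig| = 1 &
  forall x y, x < y -> 0 < sig * (h1 r j y - h1 r j x).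
Proof.
have hI x y : h1 r j x = h1 r j y -> x = y by move=> /(congr1 (h1inv r j)); rewrite !h1K.
have [inc|dec] := h1_monotone r j.
  exists 1; first by rewrite normr1.
  move=> x y xy; rewrite mul1r subr_gt0 lt_neqAle inc ?ltW// andbT.
  by apply/eqP => /hI e; move: xy; rewrite e ltxx.
exists (-1); first by rewrite normrN1.
move=> x y xy; rewrite mulN1r oppr_gt0 subr_lt0 lt_neqAle dec ?ltW// andbT.
by apply/eqP => /hI e; move: xy; rewrite e ltxx.
Qed.

(** [h1inv r j] is arbitrary off [Yfac r j]; cutting it off makes it measurable on the whole
    line. *)
Definition inverse_on j : R -> R := h1inv r j \_ (Yfac r j).

Definition abs_derivative_on j : R -> R :=
  (fun y => `|'D_1 (h1inv r j) y|) \_ (Yfac r j).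

Lemma measurable_inverse_on j : measurable_fun setT (inverse_on j).
Proof.
have [sig s1 hm] := h1_strict j.
exact: (measurable_monotone_inverse s1 hm (@h1invK j) (@Yfac_interval _ _ _ r j)).
Qed.

Lemma measurable_abs_derivative_on j : measurable_fun setT (abs_derivative_on j).
Proof.
have [sig s1 hm] := h1_strict j.
exact: (measurable_monotone_derivative s1 hm (@Yfac_h1 j) (@h1invK j)
  (@Yfac_interval _ _ _ r j) (@h1inv_derivable _ _ _ r j)).
Qed.

Lemma abs_derivative_on_ge0 j y : 0 <= abs_derivative_on j y.
Proof. by rewrite /abs_derivative_on patchE; case: ifP => // _; exact: normr_ge0. Qed.

Definition inverse_tuple (t : p1.-tuple (measurableTypeR R)) :
  p1.-tuple (measurableTypeR R) := [tuple inverse_on j (tnth t j) | j < p1].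

Definition jacobian_weight (t : p1.-tuple (measurableTypeR R)) : R :=
  \prod_j abs_derivative_on j (tnth t j).

Lemma jacobian_weight_ge0 t : 0 <= jacobian_weight t.
Proof. by apply: prodr_ge0 => j _; exact: abs_derivative_on_ge0. Qed.

Lemma measurable_inverse_tuple : measurable_fun setT inverse_tuple.
Proof.
apply/measurable_fun_tnthP => j.
rewrite (_ : _ \o _ = fun t : p1.-tuple (measurableTypeR R) => inverse_on j (tnth t j)).
  apply: (measurableT_comp (measurable_inverse_on j)); exact: measurable_tnth.
by apply/funext => t /=; rewrite tnth_mktuple.
Qed.

Lemma measurable_jacobian_weight : measurable_fun setT jacobian_weight.
Proof.
exact: (measurable_prod_tnth (U := measurableTypeR R) (w := abs_derivative_on)
  measurable_abs_derivative_on).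
Qed.

Lemma inverse_tupleE t : Yset r t -> inverse_tuple t = [tuple h1inv r j (tnth t j) | j < p1].
Proof.
by move=> Yt; apply: eq_from_tnth => j; rewrite !tnth_mktuple /inverse_on patchE mem_set//.
Qed.

Lemma jacobian_weightE t : Yset r t -> jacobian_weight t = absJ r t.
Proof.
move=> Yt; rewrite absJE//; apply: eq_bigr => j _.
by rewrite /abs_derivative_on patchE mem_set//.
Qed.

Lemma inverse_tuple_transport_le (phi : p1.-tuple (measurableTypeR R) -> \bar R) :
  measurable_fun setT phi -> (forall x, 0 <= phi x)%E ->
  (\int[lebesgue_vec R p1]_t (phi (inverse_tuple t) * (jacobian_weight t)%:E)
    <= \int[lebesgue_vec R p1]_x phi x)%E.
Proof.
move=> mphi phi0.
have := @tuple_measure_transport_le _ _ (measurableTypeR R) (measurableTypeR R) R leb leb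
  p1 inverse_on abs_derivative_on (fun _ _ => 1)
  measurable_inverse_on measurable_abs_derivative_on abs_derivative_on_ge0.
have m1 (i : 'I_p1) : measurable_fun setT (fun _ : measurableTypeR R => 1 : R) by [].
move=> /(_ m1 (fun _ _ => ler01)) h.
apply: le_trans (h _ phi mphi phi0) _; last first.
  by under eq_integral do rewrite big1// mule1.
move=> j f mf f0; under [leRHS]eq_integral do rewrite mule1.
have [sig s1 hm] := h1_strict j.
exact: (monotone_transport_le s1 hm (@Yfac_h1 j) (@h1K _ _ _ r j) (@h1invK j)
  (@Yfac_interval _ _ _ r j) (@h1inv_derivable _ _ _ r j)).
Qed.

End rounding_transport.

Section rounding_contraction.
Context (R : realType) (p1 p2 : nat) (r : rounding_map R p1 p2).
Notation leb1 := (lebesgue_vec R p1).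
Notation leb2 := (lebesgue_vec R p2).
Notation T1 := (p1.-tuple (measurableTypeR R)).
Notation T2 := (p2.-tuple (measurableTypeR R)).

Lemma measurable_fun_nat_tuple d (T : measurableType d) d' (U : measurableType d') n
    (f : T * n.-tuple nat -> U) :
  (forall t, measurable_fun setT (fun x => f (x, t))) -> measurable_fun setT f.
Proof.
move=> mf _ B mB; rewrite setTI (_ : _ @^-1` _ =
    \bigcup_t (((fun x => f (x, t)) @^-1` B) `*` [set t])); last first.
  apply/seteqP; split => -[x t] /=; first by move=> Bf; exists t.
  by move=> [s _ [/= Bf ->]].
apply: countable_bigcupT_measurable => // t; apply: measurableX.
  by rewrite -[X in measurable X]setTI; exact: mf.
exact: measurable_nat_tuple.
Qed.

Lemma measurable_fun_nat_fun d' (U : measurableType d') n (f : n.-tuple nat -> U) D :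
  measurable_fun D f.
Proof. by move=> _ B _; exact: measurable_nat_tuple. Qed.

(** A point between two points of a cell lies in some cell, and the ordering of cells leaves only
    the same one. This is where measurability of the cells comes from. *)
Lemma Acell_interval j k : level_set (qlev r j) k -> is_interval (Acell r j k).
Proof.
move=> qk a b Aa Ab c /andP[ac cb]; have [cov _ _] := Acell_partition r j.
have [l ql Alc] : (\bigcup_(i in level_set (qlev r j)) Acell r j i) c.
  by rewrite [X in X c]cov.
have [lk|kl|<-//] := ltngtP l k.
  by have := Acell_ordered ql qk lk Alc Aa; rewrite ltNge ac.
by have := Acell_ordered qk ql kl Ab Alc; rewrite ltNge cb.
Qed.

Lemma measurable_cell_of t : Qset r t -> measurable (cell_of r t : set T2).
Proof.
move=> Qt; rewrite (_ : cell_of r t = \bigcap_(i in [set: 'I_p2])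
    ((@tnth _ (measurableTypeR R) ^~ i) @^-1` Acell r i (tnth t i))).
  apply: fin_bigcap_measurable => // i _.
  rewrite -[X in measurable X]setTI; apply: measurable_tnth => //.
  by apply: is_interval_measurable; apply: Acell_interval; exact: Qt.
by apply/seteqP; split => u /= h i; [move=> _; exact: h|exact: h].
Qed.

Lemma cell_of_inj s t u : Qset r s -> Qset r t ->
  cell_of r s u -> cell_of r t u -> s = t.
Proof.
move=> Qs Qt su tu; apply: eq_from_tnth => j.
have [_ + _] := Acell_partition r j.
apply; [exact: Qs|exact: Qt|].
by exists (tnth u j); split; [exact: su|exact: tu].
Qed.

(** The integral on the left is a sum over [Qset r], and the cells that bound its terms are
    disjoint. *)
Lemma integral_mu_count_le (F : p2.-tuple nat -> \bar R) (psi : T2 -> \bar R) :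
  (forall t, 0 <= F t)%E -> measurable_fun setT psi -> (forall u, 0 <= psi u)%E ->
  (forall t, Qset r t -> F t <= \int[leb2]_(u in cell_of r t) psi u)%E ->
  (\int[mu_count r]_t F t <= \int[leb2]_u psi u)%E.
Proof.
move=> F0 mpsi psi0 FQ.
(* Tuples and cells are enumerated in parallel by the codes of tuples. [pickle_inv] keeps only the
   code that [pickle] assigns, so no tuple is met twice; [C k] is empty for tuples outside
   [Qset r]. *)
pose S k : set (p2.-tuple nat) := [set t | choice.pickle_inv k = Some t].
pose C k : set T2 := if choice.pickle_inv k is Some t then
  if t \in Qset r then cell_of r t else set0 else set0.
have mS k : measurable (S k) by exact: measurable_nat_tuple.
have mC k : measurable (C k).
  rewrite /C; case: choice.pickle_inv => // t.
  by case: ifPn => // /set_mem; exact: measurable_cell_of.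
have ST : \bigcup_k S k = setT.
  apply/seteqP; split => // t _; exists (choice.pickle t) => //.
  by rewrite /S/= choice.pickleK_inv.
have tS : trivIset setT S.
  move=> i j _ _ [t []]; rewrite /S/= => it jt.
  have := @choice.pickle_invK (p2.-tuple nat) i;
  have := @choice.pickle_invK (p2.-tuple nat) j.
  by rewrite it jt /= => -> ->.
have tC : trivIset setT C.
  move=> i j _ _ [u []]; rewrite /C.
  have := @choice.pickle_invK (p2.-tuple nat) i;
  have := @choice.pickle_invK (p2.-tuple nat) j.
  case: (choice.pickle_inv i) => // s; case: (choice.pickle_inv j) => // t /= tj si.
  case: ifPn => // /set_mem Qs su; case: ifPn => // /set_mem Qt tu.
  by rewrite -tj -si (cell_of_inj Qs Qt su tu).
rewrite -ST ge0_integral_bigcup//; last by rewrite ST; exact: measurable_fun_nat_fun.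
apply: (@le_trans _ _ (\int[leb2]_(u in \bigcup_k C k) psi u)%E); last first.
  apply: ge0_subset_integral => //; exact: bigcupT_measurable.
rewrite ge0_integral_bigcup//; last exact: measurable_funTS.
apply: lee_nneseries => [k _ _|k _]; first by apply: integral_ge0.
rewrite /S /C; case E : choice.pickle_inv => [t|]; last first.
  by rewrite [X in integral _ X](_ : _ = set0) ?integral_set0//; apply/seteqP; split.
rewrite (_ : [set s | _] = [set t]); last by apply/seteqP; split => [s [->]|s ->].
rewrite (eq_integral (cst (F t))); last by move=> s; rewrite inE => ->.
rewrite integral_cst//; last exact: measurable_nat_tuple.
rewrite -[leLHS]/(F t * @counting _ R ([set t] `&` Qset r))%E.
case: ifPn => [/set_mem Qt|/negP nQt].
  rewrite setIidl => [|_ ->//]; rewrite /counting asboolT// fset_set1 cardfs1 mule1.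
  exact: FQ.
rewrite (_ : _ `&` _ = set0) ?measure0 ?mule0 ?integral_set0//.
by apply/seteqP; split => // s [-> Qt]; apply: nQt; rewrite inE.
Qed.

End rounding_contraction.

Section rounding_lipschitz.
Context (R : realType) (p1 p2 : nat) (r : rounding_map R p1 p2).
Notation leb1 := (lebesgue_vec R p1).
Notation leb2 := (lebesgue_vec R p2).
Notation T1 := (p1.-tuple (measurableTypeR R)).
Notation T2 := (p2.-tuple (measurableTypeR R)).
Implicit Types fs gs : density (latent_measure R p1 p2).

Definition transported fs (z : T1 * T2) : R :=
  fs (inverse_tuple r z.1, z.2) * jacobian_weight r z.1.

Lemma transported_ge0 fs z : 0 <= transported fs z.
Proof. by rewrite mulr_ge0 ?dens_ge0 ?jacobian_weight_ge0. Qed.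

Lemma measurable_transported fs : measurable_fun setT (transported fs).
Proof.
apply: measurable_funM; last first.
  exact: (measurableT_comp (measurable_jacobian_weight r) measurable_fst).
apply: (measurableT_comp (measurable_dens fs)).
apply/measurable_fun_pairP; split; last exact: measurable_snd.
exact: (measurableT_comp (measurable_inverse_tuple r) measurable_fst).
Qed.

Lemma jacobian_weight0 t : ~ Yset r t -> jacobian_weight r t = 0.
Proof.
move=> /existsNP[j nY]; rewrite /jacobian_weight (bigD1 j)//=.
by rewrite /abs_derivative_on patchE memNset ?mul0r.
Qed.

(** The weight vanishes off [Yset r], so the restriction to [Omega] reduces to a condition on the
    discrete coordinates, and measurability can be read off the integral. *)
Lemma round_densityE fs y : round_density r fs y =
  if y.2 \in Qset r then
    \int[leb2]_(u in cell_of r y.2) transported fs (y.1, u)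
  else 0.
Proof.
rewrite /round_density patchE; case: ifPn => [/set_mem[Yy Qy]|nO].
  rewrite mem_set//; apply: eq_Rintegral => u _.
  by rewrite /transported/= inverse_tupleE// jacobian_weightE.
case: ifPn => // /set_mem Qy; apply/esym.
have nY : ~ Yset r y.1 by move=> Yy; move/negP: nO; apply; rewrite inE.
rewrite /Rintegral integral0_eq// => u _.
by rewrite /transported/= jacobian_weight0// mulr0.
Qed.

Lemma round_density_ge0 fs y : 0 <= round_density r fs y.
Proof.
rewrite round_densityE; case: ifP => // _.
by apply: Rintegral_ge0 => u _; exact: transported_ge0.
Qed.

Lemma measurable_round_density fs : measurable_fun setT (round_density r fs).
Proof.
apply: measurable_fun_nat_tuple => t.
have [Qt|nQt] := boolP (t \in Qset r); last first.
  rewrite (_ : (fun _ => _) = cst 0)//.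
  by apply/funext => x; rewrite round_densityE/= (negbTE nQt).
have mcell := measurable_cell_of (set_mem Qt).
pose f (z : T1 * T2) := (transported fs z * \1_(cell_of r t : set T2) z.2)%:E.
have mf : measurable_fun setT f.
  apply/measurable_EFinP; apply: measurable_funM; first exact: measurable_transported.
  have mi : measurable_fun setT (\1_(cell_of r t : set T2) : T2 -> R).
    exact: measurable_indic.
  exact: (measurableT_comp mi measurable_snd).
have f0 z : (0 <= f z)%E by rewrite lee_fin mulr_ge0 ?transported_ge0.
have mF := measurable_fun_fubini_tonelli_F (m2 := leb2) f mf f0.
rewrite (_ : (fun x => _) = fine \o fubini_F leb2 f).
  by apply: measurableT_comp => //; exact: fine_measurable.
apply/funext => x; rewrite round_densityE/= Qt /Rintegral/=; congr fine.
rewrite integral_mkcond; apply: eq_integral => u _.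
by rewrite patchE /f indicE; case: ifP => _; rewrite ?mulr1 ?mulr0.
Qed.

(* fine sends +oo to 0; when c is finite, a and b are infinite together. *)
Lemma dist_fine_le (a b c : \bar R) : (0 <= a)%E -> (0 <= b)%E -> (0 <= c)%E ->
  (a <= b + c)%E -> (b <= a + c)%E -> (`|fine a - fine b|%:E <= c)%E.
Proof.
case: c => [c| |] a0 b0 c0 //; last by rewrite leey.
case: a a0 => [a| |] // a0; case: b b0 => [b| |] // b0; rewrite -?EFinD ?lee_fin//=.
- by move=> ab ba; rewrite ler_norml; apply/andP; split; lra.
- by rewrite subrr normr0.
Qed.

Let dist_dens fs gs (z : T1 * T2) : \bar R := `|fs z - gs z|%:E.

Let fubini_dist fs gs (x : T1) : \bar R := (\int[leb2]_u dist_dens fs gs (x, u))%E.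

Let measurable_fubini_dist fs gs : measurable_fun setT (fubini_dist fs gs).
Proof.
apply: (measurable_fun_fubini_tonelli_F (m2 := leb2) (dist_dens fs gs)).
  exact: measurable_distE.
by move=> z; rewrite lee_fin.
Qed.

Let transported_dist fs gs x u :
  `|transported fs (x, u) - transported gs (x, u)|%:E =
  (dist_dens fs gs (inverse_tuple r x, u) * (jacobian_weight r x)%:E)%E.
Proof.
rewrite /transported/= -mulrBl normrM (ger0_norm (jacobian_weight_ge0 _ _)).
by rewrite EFinM.
Qed.

Let measurable_transported_section fs x :
  measurable_fun setT (fun u : T2 => transported fs (x, u)).
Proof. exact: (measurableT_comp (measurable_transported fs) (pair1_measurable x)). Qed.

Let transported_dist_int fs gs x :
  (\int[leb2]_u `|transported fs (x, u) - transported gs (x, u)|%:E =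
  fubini_dist fs gs (inverse_tuple r x) * (jacobian_weight r x)%:E)%E.
Proof.
under eq_integral do rewrite transported_dist.
rewrite ge0_integralZr//; last 2 first.
- by move=> u _; rewrite lee_fin.
- by rewrite lee_fin jacobian_weight_ge0.
exact: (measurableT_comp (measurable_distE fs gs) (pair1_measurable _)).
Qed.

Let cell_integral_le fs gs x t : Qset r t ->
  (\int[leb2]_(u in cell_of r t) (transported fs (x, u))%:E <=
   \int[leb2]_(u in cell_of r t) (transported gs (x, u))%:E +
   \int[leb2]_(u in cell_of r t) `|transported fs (x, u) - transported gs (x, u)|%:E)%E.
Proof.
move=> Qt; have mcell := measurable_cell_of Qt.
have mt hs : measurable_fun (cell_of r t : set T2)
    (fun u : T2 => (transported hs (x, u))%:E).
  by apply: measurable_funTS; apply/measurable_EFinP; exact: measurable_transported_section.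
have md : measurable_fun (cell_of r t : set T2)
    (fun u : T2 => `|transported fs (x, u) - transported gs (x, u)|%:E).
  apply: measurable_funTS; apply/measurable_EFinP; apply: measurableT_comp => //.
  by apply: measurable_funB; exact: measurable_transported_section.
rewrite -ge0_integralD//; last first.
  by move=> u _; rewrite lee_fin transported_ge0.
apply: ge0_le_integral => //.
- by move=> u _; rewrite lee_fin transported_ge0.
- exact: emeasurable_funD.
move=> u _; rewrite -EFinD lee_fin -lerBlDl; exact: ler_norm.
Qed.

Lemma round_density_dist_le fs gs :
  (\int[mixed_measure r]_y `|round_density r fs y - round_density r gs y|%:E
    <= (L1dist fs gs)%:E)%E.
Proof.
pose D y := `|round_density r fs y - round_density r gs y|%:E.
have mD : measurable_fun setT D.
  apply/measurable_EFinP; apply: measurableT_comp => //.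
  by apply: measurable_funB; exact: measurable_round_density.
have D0 y : (0 <= D y)%E by rewrite lee_fin.
pose mu := [the {sigma_finite_measure set _ -> \bar R} of mu_count r].
(* Lifting the restriction to [Yset r] can only increase an integral of a nonnegative function, and
   makes Tonelli's theorem applicable with [leb1]. *)
apply: (@le_trans _ _ (\int[(leb1 \x mu)%E]_y D y)%E).
  apply: ge0_le_measure_integral => // A mA.
  apply: ge0_le_measure_integral => //.
    move=> S mS; apply: le_measure; rewrite ?inE//.
      by apply: measurableI => //; exact: measurable_Yset.
    exact: measurable_fun_xsection.
rewrite fubini_tonelli1//.
apply: (@le_trans _ _ (\int[leb1]_x (fubini_dist fs gs (inverse_tuple r x) *
    (jacobian_weight r x)%:E))%E); last first.
  apply: le_trans (inverse_tuple_transport_le r (measurable_fubini_dist fs gs) _) _.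
    by move=> x; apply: integral_ge0 => u _; rewrite lee_fin.
  rewrite L1distE /latent_measure fubini_tonelli1//; exact: measurable_distE.
apply: ge0_le_integral => //.
- by move=> x _; apply: integral_ge0.
- exact: measurable_fun_fubini_tonelli_F.
- apply: emeasurable_funM.
    exact: (measurableT_comp (measurable_fubini_dist fs gs) (measurable_inverse_tuple r)).
  by apply/measurable_EFinP; exact: measurable_jacobian_weight.
move=> x _; rewrite -transported_dist_int.
apply: integral_mu_count_le => //.
- apply/measurable_EFinP; apply: measurableT_comp => //.
  by apply: measurable_funB; exact: measurable_transported_section.
- move=> t Qt; rewrite /D !round_densityE/= mem_set// /Rintegral.
  apply: dist_fine_le; try by apply: integral_ge0 => u _; rewrite lee_fin ?transported_ge0.
    exact: cell_integral_le.
  under [X in (_ + X)%E]eq_integral do rewrite distrC.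
  exact: cell_integral_le.
Qed.

End rounding_lipschitz.

Section rounding_preimage.
Context (R : realType) (p1 p2 : nat) (r : rounding_map R p1 p2).
Implicit Types fs gs : density (latent_measure R p1 p2).
Notation rnd := (round_density r).

Lemma round_density_integral_le fs gs :
  (\int[mixed_measure r]_y (rnd fs y)%:E <=
   \int[mixed_measure r]_y (rnd gs y)%:E + (L1dist fs gs)%:E)%E.
Proof.
have mr (hs : density (latent_measure R p1 p2)) :
    measurable_fun setT (fun y => (rnd hs y)%:E).
  by apply/measurable_EFinP; exact: measurable_round_density.
have md : measurable_fun setT (fun y => `|rnd fs y - rnd gs y|%:E).
  apply/measurable_EFinP; apply: measurableT_comp => //.
  by apply: measurable_funB; exact: measurable_round_density.
apply: le_trans (leeD (lexx _) (round_density_dist_le r fs gs)).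
rewrite -ge0_integralD//; [|by move=> y _; rewrite lee_fin round_density_ge0|exact: mr].
apply: ge0_le_integral => //.
- by move=> y _; rewrite lee_fin round_density_ge0.
- exact: mr.
- by apply: emeasurable_funD => //; exact: mr.
by move=> y _; rewrite -EFinD lee_fin -lerBlDl; exact: ler_norm.
Qed.

Lemma L1dist_round_density fs gs (f g : density (mixed_measure r)) :
  dens f = rnd fs -> dens g = rnd gs -> L1dist f g <= L1dist fs gs.
Proof. by move=> ef eg; rewrite -lee_fin L1distE ef eg round_density_dist_le. Qed.

(* The preimage of a closed set B is closed.  A limit of its points has a rounding
   of integral 1, hence is again rounded to a density. *)
Lemma measurable_round_preimage (B : set (density (mixed_measure r))) :
  (forall f, ~ B f -> exists2 e : R, 0 < e & forall g, L1dist f g < e -> ~ B g) ->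
  measurable [set fs : Fstar R p1 p2 | exists2 f : density (mixed_measure r), B f &
    dens f = rnd (fs : density (latent_measure R p1 p2))].
Proof.
move=> Bcl; set S := [set fs | _]; rewrite -[S]setCK; apply: measurableC.
apply: measurable_open_density => fs nS; apply: contrapT => noball.
have near_S (e : R) : 0 < e -> exists2 gs, L1dist fs gs < e & S gs.
  move=> e0; apply: contrapT => h; apply: noball; exists e => // gs fgs Sgs.
  by apply: h; exists gs.
have int1 : (\int[mixed_measure r]_y (rnd fs y)%:E = 1)%E.
  apply/eqP; rewrite eq_le; apply/andP; split; apply/lee_addgt0Pr => e e0.
    have [gs fgs [g _ eg]] := near_S e e0.
    apply: (le_trans (round_density_integral_le fs gs)).
    by rewrite -eg integral_dens leeD2l// lee_fin ltW.
  have [gs fgs [g _ eg]] := near_S e e0.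
  have := round_density_integral_le gs fs; rewrite -eg integral_dens.
  by move=> /le_trans; apply; rewrite leeD2l// lee_fin L1distC ltW.
pose f := Density (mu := mixed_measure r) (measurable_round_density r fs) (round_density_ge0 r fs) int1.
have nBf : ~ B f by move=> Bf; apply: nS; exists f.
have [e e0 ball_e] := Bcl f nBf; have [gs fgs [g Bg eg]] := near_S e e0.
by apply: (ball_e g) => //; apply: le_lt_trans fgs; exact: L1dist_round_density.
Qed.

End rounding_preimage.

(** * Entropy of the sieves and posterior consistency *)

Section entropy.
Context d (T : measurableType d) (R : realType) (m : {measure set T -> \bar R}).

Lemma L1_entropy_cover (delta x : R) (G : set (density m)) :
  (L1_entropy delta G < x%:E)%E ->
  exists (N : nat) (c : 'I_N -> density m), N%:R <= expR x /\
    forall f, G f -> exists i, L1dist f (c i) < delta.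
Proof.
move=> Gx; have cov0 : (0 <= covering_number delta G)%E.
  by apply: le_ereal_inf_tmp => _ [N _ <-]; rewrite lee_fin.
have /ereal_inf_lt[_ [N [c Gc] <-]] : (covering_number delta G < (expR x)%:E)%E.
  rewrite ltNge; apply/negP => xG; move: Gx; rewrite ltNge => /negP; apply.
  have -> : x%:E = lne (expR x)%:E by rewrite lne_EFin ?expR_gt0// expRK.
  by rewrite lee_lne// in_itv/= ?leey ?andbT// lee_fin expR_ge0.
rewrite lte_fin => Nx; exists N, c; split; first exact: ltW.
by move=> f /Gc[i _ fi]; exists i.
Qed.

End entropy.

Theorem theorem1 (R : realType) (p1 p2 : nat) (r : rounding_map R p1 p2)
  (Ps : probability (Fstar R p1 p2) R) (P : probability (Fmix r) R)
  (hP : induced_prior Ps P)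
  (f0 : density (mixed_measure r)) (hf0 : KL_support P f0)
  (K : forall n : nat, R.-pker (n.-tuple (obsT R p1 p2)) ~> Fmix r)
  (hK : forall n : nat, is_posterior P (K n))
  (d : measure_display) (W : measurableType d) (Pr : probability W R)
  (y : nat -> W -> obsT R p1 p2) (hy : iid_from Pr f0 y)
  (hF : forall eps : R, 0 < eps ->
    exists (delta c1 c2 beta : R) (F : nat -> set (Fstar R p1 p2)),
      [/\ 0 < delta < eps, 0 < c1, 0 < c2 & beta < eps ^+ 2 / 8] /\
      (forall n : nat, measurable (F n)) /\
      (\forall n \near \oo,
        (Ps (~` F n) <= (c1 * expR (- (n%:R * c2)))%:E)%E /\
        (L1_entropy delta (F n : set (density (latent_measure R p1 p2)))
           < (n%:R * beta)%:E)%E)) :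
  forall eps : R, 0 < eps ->
    let U : set (Fmix r) :=
      [set f : density (mixed_measure r) | L1dist f f0 < eps] in
    {ae Pr, forall w, K n [tuple y i w | i < n] U @[n --> \oo] --> 1%E}.
Proof.
move=> eps eps0 U.
(* The tests need a radius at most 1; decreasing it only enlarges the set of far densities. *)
pose e := Num.min eps 1.
have e0 : 0 < e by rewrite lt_min eps0 ltr01.
have e01 : 0 < e <= 1 by rewrite e0 ge_min lexx orbT.
have e20 : 0 < e / 20 by rewrite divr_gt0.
(* At [e / 20], doubling [delta] stays below [e / 10], and [beta] is less than [e ^+ 2 / 3200]. *)
have [delta [c1 [c2 [beta [F [[/andP[d0 de] c10 c20 be] [mF hFn]]]]]]] := hF _ e20.
have rho_le : 2 * delta <= e / 10 by lra.
have beta_lt : beta < e ^+ 2 / 2048 by apply: (lt_le_trans be); have := exprn_gt0 2 e0; lra.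
have mU : measurable U.
  by apply: measurable_set_ltr => //; exact: (measurable_L1dist (base := mixed_base r)).
have := @posterior_consistency_of_covers _ _ _ _ (mixed_base r) P f0 hf0 _ _ _ _ hy K hK
  e (2 * delta) c1 c2 beta e01 rho_le c20 beta_lt.
set far := [set f | _] => main.
have mfar : measurable far.
  by apply: measurable_set_ler => //; exact: (measurable_L1dist (base := mixed_base r)).
apply: filterS (main _) => [w Kw|].
  have K0 : K n [tuple y i w | i < n] (~` U) @[n --> \oo] --> 0%E.
    apply: (@squeeze_cvge _ _ _ _ (cst 0%E) _ _ _ _ (cvg_cst _) Kw).
    apply: nearW => n; rewrite measure_ge0/= le_measure ?inE//; first exact: measurableC.
    by move=> f /= /negP; rewrite -leNgt; apply: le_trans; rewrite ge_min lexx.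
  have -> : (fun n => K n [tuple y i w | i < n] U) =
      (fun n => 1 - K n [tuple y i w | i < n] (~` U))%E.
    apply/funext => n; set x := [tuple y i w | i < n].
    have KT := prob_kernel (s := K n) x.
    have KC : K n x (~` U) \is a fin_num.
      rewrite ge0_fin_numE//; apply: (@le_lt_trans _ _ (K n x setT)); last by rewrite KT ltry.
      by apply: le_measure; rewrite ?inE//; exact: measurableC.
    rewrite -KT -(setUv U) measureU ?addeK//; first exact: measurableC.
    exact: setICr.
  rewrite -[X in _ --> X]sube0; apply: cvgeB => //; exact: cvg_cst.
apply: filterS hFn => n [PFn /L1_entropy_cover[N [c [Ne Fc]]]].
pose img (fs : density (latent_measure R p1 p2)) (f : density (mixed_measure r)) :=
  dens f = round_density r fs.
(* The centers c i need not be rounded to densities, as the mass of a rounded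
   function is not shown to be 1; moving them to points that are doubles delta. *)
have center i : exists f1 : density (mixed_measure r), forall fs f,
    L1dist fs (c i) < delta -> img fs f -> L1dist f f1 < 2 * delta.
  have [[gs [g [gc gsg]]]|none] := pselect (exists gs g, L1dist gs (c i) < delta /\ img gs g).
    exists g => fs f fc fsf.
    apply: (le_lt_trans (L1dist_round_density fsf gsg)).
    apply: (le_lt_trans (L1dist_triangle fs (c i) gs)).
    by rewrite (L1distC (c i)); lra.
  by exists f0 => fs f fc fsf; exfalso; apply: none; exists fs, f.
have /choice[f1 hf1] := center.
exists N, f1; split => //.
set G := [set f | _].
(* Openness of [G] gives its measurability and, its complement being closed, that of the preimage of
   the complement under rounding. *)
have Gopen (f : density (mixed_measure r)) : G f ->
    exists2 t : R, 0 < t & forall g, L1dist f g < t -> G g.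
  move=> [i fi]; exists (2 * delta - L1dist f (f1 i)); first by rewrite subr_gt0.
  move=> g fg; exists i; apply: (le_lt_trans (L1dist_triangle g f (f1 i))).
  by rewrite (L1distC g); lra.
have mG : measurable G by apply: measurable_open_density.
rewrite hP; last exact: measurableC.
apply: le_trans PFn; apply: le_measure; rewrite ?inE.
- apply: (measurable_round_preimage (B := ~` G)) => f /contrapT /Gopen[t t0 ft].
  by exists t => // g /ft Gg; apply.
- exact: measurableC.
move=> fs [f nGf fsf] Ffs; apply: nGf; have [i ci] := Fc fs Ffs.
by exists i; exact: hf1 ci fsf.
Qed.
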